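(* Let $T$ be a tree with color classes $B$ (black) and $W$ (white). Let $\omega:B^n\to\mathbf{R}$ be a 2-separable convex function consisting of $m$ terms, and let $\bar\omega:T^n\to\mathbf{R}$ be its L-convex relaxation. (1) For a given $x\in B^n$, there is an $O(d(\mathrm{opt}(\bar\omega),x)\,\mathrm{MF}(kn,km))$ time algorithm to find a global minimizer $x^*$ of $\bar\omega$ over $T^n$, where $k$ is the maximum degree of $T$. (2) Suppose that $\omega$ is a convex multifacility location function. For any $y\in B$, the rounded solution $(x^* )_{\rightarrow y}$ (where $x^*$ is a global minimizer of $\bar\omega$ over $T^n$) is a 2-approximate solution of $\omega$.
   Context: The vertex set of $T$ is also denoted $T$, with path metric $d$; on $T^n$, $d(x,y):=\max_i d(x_i,y_i)$. $\mathrm{opt}(\bar\omega)$ is the set of minimizers of $\bar\omega$ over $T^n$ and $d(\mathrm{opt}(\bar\omega),x):=\min\{d(y,x)\mid y\in\mathrm{opt}(\bar\omega)\}$. $\mathrm{MF}(n',m')$ denotes the time complexity of finding a maximum flow in a network with $n'$ nodes and $m'$ edges. A 2-approximate solution of $\omega$ is a point $u\in B^n$ with $\omega(u)\le 2\min_{p\in B^n}\omega(p)$. A function $h$ on $\mathbf{Z}$ is nondecreasing if $h(t)\ge h(t-1)$ for all $t$, and convex if $h(t+1)-2h(t)+h(t-1)\ge0$ for all $t$. A function $f$ on $T$ is convex if along every path of $T$ (parametrized by consecutive integers) it is convex. A function $\omega$ on $B^n$ is 2-separable convex if it has the form $$\omega(x)=\sum_i f_i(x_i)+\sum_{i,j}g_{ij}(d(x_i,x_j))+\sum_{i,j}h_{ij}(d(x_i,z_i)+d(x_j,w_j)),$$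 where each $f_i$ is a convex function on $T$, each $g_{ij},h_{ij}$ is a nondecreasing convex function on $\mathbf{Z}$, and $z_i,w_j$ are vertices of $T$ in the same color class. Its L-convex relaxation is $$\bar\omega(x)=\sum_i f_i(x_i)+\sum_{i,j}\bar g_{ij}(d(x_i,x_j))+\sum_{i,j}\bar h_{ij}(d(x_i,z_i)+d(x_j,w_j))\quad(x\in T^n),$$ where for a function $g$ on $\mathbf{Z}$, $\bar g(t):=g(t)$ for even $t$ and $\bar g(t):=(g(t-1)+g(t+1))/2$ for odd $t$. A convex multifacility location function is a 2-separable convex function of the form $\omega(x)=\sum_{i,j}f_{ij}(d(x_i,z_j))+\sum_{i,j}g_{ij}(d(x_i,x_j))$ ($x\in B^n$), where $f_{ij},g_{ij}$ are nonnegative-valued nondecreasing convex functions on $\mathbf{Z}$ and the $z_j$ are black vertices; in this case the L-convex relaxation taken is $\bar\omega(x)=\sum_{i,j}\bar f_{ij}(d(x_i,z_j))+\sum_{i,j}\bar g_{ij}(d(x_i,x_j))$ ($x\in T^n$). For $y\in B$ and $x\in T^n$, $x_{\rightarrow y}\in B^n$ is the vertex $p$ with $p_i=x_i$ if $x_i\in B$, and $p_i$ the unique neighbor of $x_i$ with $d(x_i,y)=1+d(p_i,y)$ if $x_i\in W$. *)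

(* Defs.v *)
From HB Require Import structures.
From mathcomp Require Import all_boot all_order all_algebra.
From mathcomp Require Import boolp classical_sets reals.

Set Implicit Arguments.
Unset Strict Implicit.
Unset Printing Implicit Defensive.

Import Order.TTheory GRing.Theory Num.Theory.

Local Open Scope ring_scope.

(** * Trees *)

(* A tree, possibly infinite, together with its two color classes
   B = [black] and W = the complement of [black]. *)
Record tree := Tree {
  vertex :> choiceType;
  adj : rel vertex;
  black : pred vertex;
  tree_nonempty : inhabited vertex;
  adj_sym : symmetric adj;
  adj_irr : irreflexive adj;
  tree_connected : forall u v : vertex, exists p, path adj u p /\ last u p = v;
  tree_acyclic : forall c : seq vertex, (2 < size c)%N -> ~ ucycle adj c;
  black_proper : forall u v, adj u v -> black u != black v }.

Definition walk (T : tree) (u v : T) (l : nat) : Prop :=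
  exists p, [/\ path (@adj T) u p, last u p = v & size p = l].

Definition dist (T : tree) (u v : T) : nat :=
  xget 0%N [set l : nat | walk u v l /\ forall l', walk u v l' -> (l <= l')%N]%classic.

Definition dist_max (T : tree) (n : nat) (x y : 'I_n -> T) : nat :=
  \max_(i < n) dist (x i) (y i).

Definition in_Bn (T : tree) (n : nat) (x : 'I_n -> T) : Prop :=
  forall i, black (x i).

Definition adjacency_lists (T : tree) (nb : T -> seq T) : Prop :=
  forall v, uniq (nb v) /\ forall u, (u \in nb v) = adj v u.

Definition max_degree (T : tree) (nb : T -> seq T) (k : nat) : Prop :=
  (forall v, (size (nb v) <= k)%N) /\ exists v, size (nb v) = k.

(** * Convexity *)

Definition nondecreasingZ (R : realType) (h : int -> R) : Prop :=
  forall t, h (t - 1) <= h t.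

Definition convexZ (R : realType) (h : int -> R) : Prop :=
  forall t, 0 <= h (t + 1) - 2 * h t + h (t - 1).

(* Paths in a tree are the simple ones. *)
Definition convexT (R : realType) (T : tree) (f : T -> R) : Prop :=
  forall u p, path (@adj T) u p -> uniq (u :: p) ->
  forall t : nat, (t.+2 < size (u :: p))%N ->
  let v := nth u (u :: p) in
  0 <= f (v t.+2) - 2 * f (v t.+1) + f (v t).

Definition bar (R : realType) (g : int -> R) (t : int) : R :=
  if (2 %| t)%Z then g t else (g (t - 1) + g (t + 1)) / 2.

(** * 2-separable convex functions *)

(* [idxF], [idxG], [idxH] are the indices of the terms that are present in the
   three sums; the other f_i, g_ij, h_ij play no role. *)
Record sep2 (R : realType) (T : tree) (n : nat) := Sep2 {
  idxF : {set 'I_n};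
  idxG : {set 'I_n * 'I_n};
  idxH : {set 'I_n * 'I_n};
  sf : 'I_n -> T -> R;
  sg : 'I_n -> 'I_n -> int -> R;
  sh : 'I_n -> 'I_n -> int -> R;
  sz : 'I_n -> T;
  sw : 'I_n -> T }.

Record sep2_convex (R : realType) (T : tree) (n : nat) (P : sep2 R T n) : Prop := {
  sf_convex : forall i, i \in idxF P -> convexT (sf P i);
  sg_convex : forall i j, (i, j) \in idxG P ->
    nondecreasingZ (sg P i j) /\ convexZ (sg P i j);
  sh_convex : forall i j, (i, j) \in idxH P ->
    nondecreasingZ (sh P i j) /\ convexZ (sh P i j);
  same_color : forall i j, (i, j) \in idxH P ->
    black (sz P i) = black (sw P j) }.

Definition nterms (R : realType) (T : tree) (n : nat) (P : sep2 R T n) : nat :=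
  (#|idxF P| + #|idxG P| + #|idxH P|)%N.

(* [sep2_sum id P] is omega and [sep2_sum (@bar R) P] its L-convex relaxation. *)
Definition sep2_sum (R : realType) (tr : (int -> R) -> int -> R)
    (T : tree) (n : nat) (P : sep2 R T n) (x : 'I_n -> T) : R :=
  \sum_(i in idxF P) sf P i (x i)
  + \sum_(ij in idxG P)
      tr (sg P ij.1 ij.2) (dist (x ij.1) (x ij.2))%:Z
  + \sum_(ij in idxH P)
      tr (sh P ij.1 ij.2)
        (dist (x ij.1) (sz P ij.1) + dist (x ij.2) (sw P ij.2))%N%:Z.

Definition sep2_fun (R : realType) (T : tree) (n : nat) (P : sep2 R T n) :=
  sep2_sum id P.

Definition sep2_relax (R : realType) (T : tree) (n : nat) (P : sep2 R T n) :=
  sep2_sum (@bar R) P.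

(** * Convex multifacility location functions *)

Record multifac (R : realType) (T : tree) (n : nat) := Multifac {
  nsites : nat;
  site : 'I_nsites -> T;
  mf : 'I_n -> 'I_nsites -> int -> R;
  mg : 'I_n -> 'I_n -> int -> R }.
Arguments site {R T n} m _.
Arguments mf {R T n} m _ _ _.

Record multifac_convex (R : realType) (T : tree) (n : nat)
    (P : multifac R T n) : Prop := {
  site_black : forall j, black (site P j);
  mf_convex : forall i j,
    [/\ forall t, 0 <= mf P i j t, nondecreasingZ (mf P i j) & convexZ (mf P i j)];
  mg_convex : forall i j,
    [/\ forall t, 0 <= mg P i j t, nondecreasingZ (mg P i j) & convexZ (mg P i j)] }.

Definition multifac_sum (R : realType) (tr : (int -> R) -> int -> R)
    (T : tree) (n : nat) (P : multifac R T n) (x : 'I_n -> T) : R :=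
  \sum_(i < n) \sum_(j < nsites P) tr (mf P i j) (dist (x i) (site P j))%:Z
  + \sum_(i < n) \sum_(j < n) tr (mg P i j) (dist (x i) (x j))%:Z.

Definition multifac_fun (R : realType) (T : tree) (n : nat) (P : multifac R T n) :=
  multifac_sum id P.

Definition multifac_relax (R : realType) (T : tree) (n : nat) (P : multifac R T n) :=
  multifac_sum (@bar R) P.

(** * Minimizers, rounding, approximation *)

Definition opt (R : realType) (T : tree) (n : nat) (F : ('I_n -> T) -> R) :
    set ('I_n -> T) :=
  [set x | forall y, F x <= F y]%classic.

(* d(A, x) = D; in particular A is nonempty. *)
Definition dist_to (T : tree) (n : nat) (A : set ('I_n -> T)) (x : 'I_n -> T)
    (D : nat) : Prop :=
  (exists y, A y /\ dist_max y x = D) /\ forall y, A y -> (D <= dist_max y x)%N.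

Definition round1 (T : tree) (y v : T) : T :=
  if black v then v
  else xget v [set p | adj v p /\ dist v y = (1 + dist p y)%N]%classic.

Definition round_to (T : tree) (n : nat) (y : T) (x : 'I_n -> T) : 'I_n -> T :=
  fun i => round1 y (x i).

Definition approx2 (R : realType) (T : tree) (n : nat) (F : ('I_n -> T) -> R)
    (u : 'I_n -> T) : Prop :=
  in_Bn u /\
  exists q, [/\ in_Bn q, forall p, in_Bn p -> F q <= F p & F u <= 2 * F q].

(** * Maximum flows *)

(* Nodes are 0, ..., [nodes] - 1 and edges 0, ..., [edges] - 1; parallel edges
   are allowed.  [etail], [ehead] and [ecap] are meaningless beyond [edges]. *)
Record network (R : realType) := Network {
  nodes : nat;
  edges : nat;
  source : nat;
  sink : nat;
  etail : nat -> nat;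
  ehead : nat -> nat;
  ecap : nat -> R }.

Definition network_ok (R : realType) (N : network R) : Prop :=
  [/\ (source N < nodes N)%N, (sink N < nodes N)%N, source N != sink N
    & forall e, (e < edges N)%N ->
        [/\ (etail N e < nodes N)%N, (ehead N e < nodes N)%N & 0 <= ecap N e]].

Definition inflow (R : realType) (N : network R) (phi : nat -> R) (v : nat) : R :=
  \sum_(e < edges N | ehead N e == v) phi e.

Definition outflow (R : realType) (N : network R) (phi : nat -> R) (v : nat) : R :=
  \sum_(e < edges N | etail N e == v) phi e.

Definition flow (R : realType) (N : network R) (phi : nat -> R) : Prop :=
  (forall e, (e < edges N)%N -> 0 <= phi e <= ecap N e) /\
  (forall v, (v < nodes N)%N -> v != source N -> v != sink N ->
     inflow N phi v = outflow N phi v).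

Definition flow_value (R : realType) (N : network R) (phi : nat -> R) : R :=
  outflow N phi (source N) - inflow N phi (source N).

Definition max_flow (R : realType) (N : network R) (phi : nat -> R) : Prop :=
  flow N phi /\ forall psi, flow N psi -> flow_value N psi <= flow_value N phi.

Definition max_flow_solver (R : realType) (solve : network R -> nat -> R) : Prop :=
  forall N, network_ok N -> max_flow N (solve N).

(* Standing conventions on the running time MF(n', m') of a maximum flow
   algorithm: it is monotone, it is at least linear (the network has to be
   read), and constant factors in n' and m' cost a constant factor. *)
Record flow_time (MF : nat -> nat -> nat) : Prop := {
  MF_mono : forall a b a' b', (a <= a')%N -> (b <= b')%N -> (MF a b <= MF a' b')%N;
  MF_linear : exists c, forall a b, (a + b + 1 <= c * MF a b)%N;
  MF_scale : forall c, exists c', forall a b, (0 < a)%N -> (0 < b)%N ->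
    (MF (c * a) (c * b) <= c' * MF a b)%N }.

(** * Machine model *)

(* A random access machine whose cells hold natural numbers, vertices of the
   tree, or real numbers.  The memory of each type consists of arrays; [Get a i]
   reads cell [i] of array [a].  A program is a closed finite syntactic object,
   which does not depend on the instance.  It accesses vertices and the
   functions f_i, g_ij, h_ij only through unit-cost oracles; arithmetic is
   restricted to addition and subtraction, and scaling of reals by rational
   constants. *)
Inductive ty := TNat | TVtx | TReal.

Inductive exp : ty -> Type :=
| Get (s : ty) of nat & exp TNat : exp s
| NLit of nat : exp TNat
| NAdd of exp TNat & exp TNat : exp TNat
| NSub of exp TNat & exp TNat : exp TNat
| Deg of exp TVtx : exp TNat
| Dist of exp TVtx & exp TVtx : exp TNat
| Nbr of exp TVtx & exp TNat : exp TVtx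
| RLit of rat : exp TReal
| RAdd of exp TReal & exp TReal : exp TReal
| RSub of exp TReal & exp TReal : exp TReal
| RScale of rat & exp TReal : exp TReal
| FVal of exp TNat & exp TVtx : exp TReal
| GVal of exp TNat & exp TNat & exp TNat : exp TReal
| HVal of exp TNat & exp TNat & exp TNat : exp TReal.

Inductive test :=
| NLt of exp TNat & exp TNat
| RLe of exp TReal & exp TReal
| IsBlack of exp TVtx.

(* [Assign a i e] is a[i] := e.  [MaxFlow n m s t aT aH aC aF] reads a network
   with [n] nodes, [m] edges, source [s] and sink [t] from the arrays [aT]
   (tails), [aH] (heads) and [aC] (capacities) and writes a maximum flow to the
   array [aF]. *)
Inductive cmd :=
| Skip
| Assign (s : ty) of nat & exp TNat & exp s
| Seq of cmd & cmd
| If of test & cmd & cmd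
| While of test & cmd
| MaxFlow of exp TNat & exp TNat & exp TNat & exp TNat & nat & nat & nat & nat.

Fixpoint exp_cost (s : ty) (e : exp s) : nat :=
  match e with
  | Get _ _ i => (exp_cost i).+1
  | NLit _ => 1
  | NAdd a b => (exp_cost a + exp_cost b).+1
  | NSub a b => (exp_cost a + exp_cost b).+1
  | Deg v => (exp_cost v).+1
  | Dist u v => (exp_cost u + exp_cost v).+1
  | Nbr v j => (exp_cost v + exp_cost j).+1
  | RLit _ => 1
  | RAdd a b => (exp_cost a + exp_cost b).+1
  | RSub a b => (exp_cost a + exp_cost b).+1
  | RScale _ a => (exp_cost a).+1
  | FVal i v => (exp_cost i + exp_cost v).+1
  | GVal i j t => (exp_cost i + exp_cost j + exp_cost t).+1
  | HVal i j t => (exp_cost i + exp_cost j + exp_cost t).+1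
  end.

Definition test_cost (b : test) : nat :=
  match b with
  | NLt x y => (exp_cost x + exp_cost y).+1
  | RLe x y => (exp_cost x + exp_cost y).+1
  | IsBlack v => (exp_cost v).+1
  end.

Definition den (R : realType) (V : Type) (s : ty) : Type :=
  match s with TNat => nat | TVtx => V | TReal => R end.

Record state (R : realType) (V : Type) := State {
  nat_mem : nat -> nat -> nat;
  vtx_mem : nat -> nat -> V;
  real_mem : nat -> nat -> R }.

Definition get (R : realType) (V : Type) (st : state R V) (s : ty) :
    nat -> nat -> den R V s :=
  match s with
  | TNat => nat_mem st
  | TVtx => vtx_mem st
  | TReal => real_mem st
  end.

Definition upd (A : Type) (mem : nat -> nat -> A) (a i : nat) (v : A) :
    nat -> nat -> A :=
  fun a' i' => if (a' == a) && (i' == i) then v else mem a' i'.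

Definition set_cell (R : realType) (V : Type) (st : state R V) (s : ty)
    (a i : nat) : den R V s -> state R V :=
  match s with
  | TNat => fun v => State (upd (nat_mem st) a i v) (vtx_mem st) (real_mem st)
  | TVtx => fun v => State (nat_mem st) (upd (vtx_mem st) a i v) (real_mem st)
  | TReal => fun v => State (nat_mem st) (vtx_mem st) (upd (real_mem st) a i v)
  end.

Record oracles (R : realType) (V : Type) := Oracles {
  odeg : V -> nat;
  onbr : V -> nat -> V;
  odist : V -> V -> nat;
  oblack : V -> bool;
  of_ : nat -> V -> R;
  og : nat -> nat -> nat -> R;
  oh : nat -> nat -> nat -> R;
  oflow : network R -> nat -> R;
  otime : nat -> nat -> nat }.

Fixpoint eval (R : realType) (V : Type) (O : oracles R V) (st : state R V)
    (s : ty) (e : exp s) : den R V s :=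
  match e with
  | Get s a i => get st s a (eval O st i)
  | NLit c => c
  | NAdd a b => (eval O st a + eval O st b)%N
  | NSub a b => (eval O st a - eval O st b)%N
  | Deg v => odeg O (eval O st v)
  | Dist u v => odist O (eval O st u) (eval O st v)
  | Nbr v j => onbr O (eval O st v) (eval O st j)
  | RLit q => ratr q
  | RAdd a b => eval O st a + eval O st b
  | RSub a b => eval O st a - eval O st b
  | RScale q a => ratr q * eval O st a
  | FVal i v => of_ O (eval O st i) (eval O st v)
  | GVal i j t => og O (eval O st i) (eval O st j) (eval O st t)
  | HVal i j t => oh O (eval O st i) (eval O st j) (eval O st t)
  end.

Definition eval_test (R : realType) (V : Type) (O : oracles R V)
    (st : state R V) (b : test) : bool :=
  match b with
  | NLt x y => (eval O st x < eval O st y)%N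
  | RLe x y => (eval O st x : R) <= eval O st y
  | IsBlack v => oblack O (eval O st v)
  end.

Definition write_flow (R : realType) (V : Type) (st : state R V) (a m : nat)
    (phi : nat -> R) : state R V :=
  State (nat_mem st) (vtx_mem st)
    (fun a' e => if (a' == a) && (e < m)%N then phi e else real_mem st a' e).

(* [exec O c st st' t]: started in [st], the program [c] halts in [st'] after
   [t] time units; a maximum flow call on n' nodes and m' edges takes
   MF(n', m') = [otime O n' m'] units. *)
Inductive exec (R : realType) (V : Type) (O : oracles R V) :
    cmd -> state R V -> state R V -> nat -> Prop :=
| ExecSkip st : exec O Skip st st 0
| ExecAssign st s a i (e : exp s) :
    exec O (Assign a i e) st (set_cell st a (eval O st i) (eval O st e))
      (exp_cost i + exp_cost e).+1
| ExecSeq c1 c2 st1 st2 st3 t1 t2 :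
    exec O c1 st1 st2 t1 -> exec O c2 st2 st3 t2 ->
    exec O (Seq c1 c2) st1 st3 (t1 + t2)%N
| ExecIf b c1 c2 st st' t :
    exec O (if eval_test O st b then c1 else c2) st st' t ->
    exec O (If b c1 c2) st st' (test_cost b + t).+1
| ExecWhileStop b c st :
    ~~ eval_test O st b ->
    exec O (While b c) st st (test_cost b).+1
| ExecWhileLoop b c st1 st2 st3 t1 t2 :
    eval_test O st1 b ->
    exec O c st1 st2 t1 -> exec O (While b c) st2 st3 t2 ->
    exec O (While b c) st1 st3 (test_cost b + t1 + t2).+1
| ExecMaxFlow (en em es et : exp TNat) aT aH aC aF st :
    let n' : nat := eval O st en in
    let m' : nat := eval O st em in
    let N := Network n' m' (eval O st es) (eval O st et)
               (nat_mem st aT) (nat_mem st aH) (real_mem st aC) in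
    exec O (MaxFlow en em es et aT aH aC aF) st
      (write_flow st aF m' (oflow O N))
      (exp_cost en + exp_cost em + exp_cost es + exp_cost et
       + otime O n' m').+1.

(* Oracles of an instance; out-of-range queries return default values. *)
Definition sep2_oracles (R : realType) (T : tree) (nb : T -> seq T) (n : nat)
    (P : sep2 R T n) (solve : network R -> nat -> R) (MF : nat -> nat -> nat) :
    oracles R T :=
  {| odeg := fun v => size (nb v);
     onbr := fun v j => nth v (nb v) j;
     odist := @dist T;
     oblack := @black T;
     of_ := fun i v => if insub i is Some i' then sf P i' v else 0;
     og := fun i j t => if (insub i, insub j) is (Some i', Some j')
                        then sg P i' j' t%:Z else 0;
     oh := fun i j t => if (insub i, insub j) is (Some i', Some j')
                        then sh P i' j' t%:Z else 0;
     oflow := solve;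
     otime := MF |}.

(* Input layout: array 0 of naturals holds n and the numbers of terms, arrays
   1 to 5 list the indices of the terms, and arrays 0, 1, 2 of vertices hold
   x, z, w.  All other cells are arbitrary. *)
Record sep2_input (R : realType) (T : tree) (n : nat) (P : sep2 R T n)
    (x : 'I_n -> T) (st : state R T) : Prop := {
  in_n : nat_mem st 0 0 = n;
  in_nF : nat_mem st 0 1 = #|idxF P|;
  in_nG : nat_mem st 0 2 = #|idxG P|;
  in_nH : nat_mem st 0 3 = #|idxH P|;
  in_F : forall e : 'I_#|idxF P|, nat_mem st 1 e = enum_val e;
  in_G : forall e : 'I_#|idxG P|,
    nat_mem st 2 e = (enum_val e).1 /\ nat_mem st 3 e = (enum_val e).2;
  in_H : forall e : 'I_#|idxH P|,
    nat_mem st 4 e = (enum_val e).1 /\ nat_mem st 5 e = (enum_val e).2;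
  in_x : forall i : 'I_n, vtx_mem st 0 i = x i;
  in_z : forall i : 'I_n, vtx_mem st 1 i = sz P i;
  in_w : forall i : 'I_n, vtx_mem st 2 i = sw P i }.

(* The output overwrites x in array 0 of vertices. *)
Definition output (R : realType) (T : tree) (n : nat) (st : state R T) :
    'I_n -> T :=
  fun i => vtx_mem st 0 i.

(* Main.v *)
(* A pair of points x, z of T^n may be replaced by the pair obtained by moving
   some coordinates one step towards each other, without increasing
   F x + F z for F the relaxation, provided the moving coordinates are the most
   distant ones (up to colors, for coordinates at the same distance).

   Descent: alternately minimize F exactly over the moves of the black and of the
   white coordinates of the current point.  By the exchange inequality each such
   step decreases the distance to the minimizers of F by one, so there are at
   most D + 1 steps, and a point that is optimal for both colors is a minimizer.

   One step: all moving coordinates have the same color, and choosing for each of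
   them either to stay or one of its neighbors is a minimum cut problem with one
   node per neighbor; cuts that select several neighbors of a coordinate are
   dominated by staying.  The minimal minimum cut is the set of nodes reachable
   in the residual graph; it is found by a second maximum flow computation, so
   no graph search is needed.  Taking the minimal cut ensures that the point
   moves only if F strictly decreases, which is the stopping rule.

   Rounding: moving all white coordinates towards y changes an odd distance by at
   most one and does not increase an even one, and g (d + 1) <= 2 bar g d.  The
   minimum over B^n is attained because the cost is monotone in finitely many
   natural numbers. *)

Require Import Defs.
From mathcomp Require Import all_boot all_order all_algebra.
From mathcomp Require Import boolp classical_sets reals.
From mathcomp Require Import zify ring lra.

Import Order.TTheory GRing.Theory Num.Theory.
Local Open Scope ring_scope.

Set Implicit Arguments.
Unset Strict Implicit.
Unset Printing Implicit Defensive.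

(** * Distances in a tree *)

(** The obstacle to the exchange is a term that grows when [x i] steps towards [z i]. In a tree,
    growth forces the points involved onto one path, so the two arguments of [bar g] approach each
    other and convexity suffices, unless they are already equal. Moving only the most distant
    coordinates leaves that tie between opposite colors alone; the argument is then odd, and [bar g]
    is linear there because it interpolates the even values.

    The distance drops by a full unit per step because the current point is already optimal for the
    other color. This allows the minimizer to be pulled first towards the current point in the
    coordinates of that color at maximal distance, so that they cannot block the next move.

    In the cut, a two-variable term pays [slope_left] per unit of change, and the kink
    [slope_right - slope_left] for an increase that the other coordinate does not compensate. This
    requires the two moves to act independently on the distance, which fails only for coinciding
    points; these get a gadget of their own. *)

Section TreeMetric.
Variable T : tree.
Implicit Types u v w p : T.
Local Notation d := (@dist T).
Local Notation adj := (@adj T).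
Local Open Scope nat_scope.

Lemma dist_spec u v :
  walk u v (d u v) /\ forall l, walk u v l -> d u v <= l.
Proof.
have [q [qp ql]] := tree_connected u v.
have ex : exists l, `[< walk u v l >].
  by exists (size q); apply/asboolP; exists q.
rewrite /dist; apply: (@xgetPex _ 0 [set l | walk u v l /\
  forall l', walk u v l' -> l <= l']%classic).
case: (ex_minnP ex) => l /asboolP lw lmin.
by exists l; split=> // l' /asboolP /lmin.
Qed.

Lemma dist_walk u v : walk u v (d u v).
Proof. by case: (dist_spec u v). Qed.

Lemma dist_le_walk u v l : walk u v l -> d u v <= l.
Proof. by case: (dist_spec u v) => _; apply. Qed.

Lemma walk_cat u v w l l' : walk u v l -> walk v w l' -> walk u w (l + l').
Proof.
move=> [p [pp pl ps]] [q [qp ql qs]]; exists (p ++ q); split.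
- by rewrite cat_path pp pl.
- by rewrite last_cat pl.
- by rewrite size_cat ps qs.
Qed.

Lemma walk_sym u v l : walk u v l -> walk v u l.
Proof.
move=> [p [pp pl ps]]; exists (rev (belast u p)); split.
- rewrite -pl rev_path; under eq_path do rewrite adj_sym; exact: pp.
- by case: p pp pl ps => //= a p _ _ _; rewrite rev_cons last_rcons.
- by rewrite size_rev size_belast.
Qed.

Lemma walk_odd u v l : walk u v l -> odd l = (black u (+) black v).
Proof.
move=> [p [pp <- <-]]; elim: p u pp => [|a p IH] u /=; first by rewrite addbb.
case/andP => ua /IH ->; have := black_proper ua.
by case: (black u); case: (black a); case: (black _).
Qed.

Lemma dist_odd u v : odd (d u v) = (black u (+) black v).
Proof. exact: walk_odd (dist_walk u v). Qed.

Lemma distuu u : d u u = 0.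
Proof. by apply/eqP; rewrite -leqn0; apply: dist_le_walk; exists [::]. Qed.

Lemma dist_eq0 u v : d u v = 0 -> u = v.
Proof. by move=> e; have [[|a p] [_ /= h]] := dist_walk u v; rewrite e. Qed.

Lemma distC u v : d u v = d v u.
Proof.
by apply/eqP; rewrite eqn_leq !dist_le_walk //; apply/walk_sym/dist_walk.
Qed.

Lemma dist_triangle v u w : d u w <= d u v + d v w.
Proof. by apply/dist_le_walk/walk_cat; apply: dist_walk. Qed.

Lemma dist_adj1 u v : adj u v -> d u v = 1.
Proof.
move=> uv; have le1 : d u v <= 1 by apply: dist_le_walk; exists [:: v]; rewrite /= uv.
by have := dist_odd u v; have := black_proper uv; case: (d u v) le1 => [|[]] //=;
  case: (black u); case: (black v).
Qed.

(** Adjacent vertices have opposite colors, so parity excludes equal distances to [v], and the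
    triangle inequality leaves a change of exactly one. *)
Lemma dist_nbr u p v : adj u p -> d p v = (d u v).+1 \/ d u v = (d p v).+1.
Proof.
move=> up; have d1 := dist_adj1 up.
have := dist_triangle u p v; have := dist_triangle p u v.
rewrite (distC p u) d1 => h1 h2.
have : d u v <> d p v.
  move=> e; have := dist_odd u v; rewrite e dist_odd.
  by have := black_proper up; case: (black u); case: (black v); case: (black p).
by move=> h3; lia.
Qed.

Lemma dist_step u v : u <> v -> exists p, adj u p /\ d u v = (d p v).+1.
Proof.
move=> uv; have [[|a q] [qp ql qs]] := dist_walk u v; first by [].
move: qp ql => /= /andP[ua aq] ql; exists a; split=> //.
have le : d a v <= size q by apply: dist_le_walk; exists q.
case: (dist_nbr v ua) => // h; move: qs => /=; lia.
Qed.

(** If a shortest walk from [p] to [v] met [u], its tail would join [u] to [v] in at most [d p v]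
    steps. *)
Lemma closer_walk u p v : d u v = (d p v).+1 ->
  exists q, [/\ path adj p q, last p q = v & u \notin p :: q].
Proof.
move=> e; have [q [qp ql qs]] := dist_walk p v; exists q; split => //.
apply/negP => /splitPl uq; case: uq qp ql qs => q1 q2 e1.
rewrite cat_path last_cat e1 size_cat => /andP[_ q2p] q2l qs.
have : d u v <= @size T q2 by apply: dist_le_walk; exists q2.
by move=> h; lia.
Qed.

(** This is where acyclicity enters. Shortest walks from two such neighbors to [v] avoid [u]; joined
    and shortened to a simple path from [p] to [p'], they close up through [u] to a cycle. *)
Lemma closer_unique u p p' v : adj u p -> adj u p' ->
  d u v = (d p v).+1 -> d u v = (d p' v).+1 -> p = p'.
Proof.
move=> up up' e e'; apply/eqP; case: eqVneq => // npp'.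
have [q [qp ql qn]] := closer_walk e.
have [q' [qp' ql' qn']] := closer_walk e'.
set r := rev (belast p' q').
have rp : path adj v r.
  by rewrite /r -ql' rev_path; under eq_path do rewrite adj_sym.
have rl : last v r = p'.
  rewrite /r; case: (q') ql' => //= a s _; by rewrite rev_cons last_rcons.
have rsub : {subset v :: r <= p' :: q'}.
  move=> a; rewrite inE mem_rev -[p' :: q']/(p' :: q') => /orP[/eqP ->|/mem_belast //].
  by rewrite -ql' mem_last.
have qrp : path adj p (q ++ r) by rewrite cat_path qp ql.
have qrl : last p (q ++ r) = p' by rewrite last_cat ql.
have qrn : u \notin p :: (q ++ r).
  rewrite inE mem_cat; move: qn; rewrite inE !negb_or => /andP[-> ->] /=.
  by apply/negP => ur; move: qn'; rewrite rsub // inE ur orbT.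
case/shortenP: qrp qrl => s sp su ssub sl.
have sn : u \notin p :: s.
  move: qrn; rewrite !inE !negb_or => /andP[-> h] /=.
  by apply/negP => /ssub; rewrite (negbTE h).
have snil : s <> [::] by move=> s0; move: sl npp'; rewrite s0 /= => ->; rewrite eqxx.
case: (@tree_acyclic T (u :: p :: s)).
  by case: s snil {sp su ssub sl sn}.
rewrite /ucycle; apply/andP; split; last by rewrite cons_uniq sn su.
by rewrite /= up /= rcons_path sp sl adj_sym.
Qed.

(* A step from [u] that leaves [v] and approaches [w] shows that [u] lies on
   the path from [v] to [w]. *)
Lemma dist_through u p v w : adj u p ->
  d p v = (d u v).+1 -> d u w = (d p w).+1 -> d v w = d v u + d u w.
Proof.
move=> up; have [k e] : exists k, d u w = k by exists (d u w).
elim: k u p up e => [|k IH] u p up ek pv uw; first lia.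
have [epw|npw] := eqVneq p w.
  by rewrite -epw (dist_adj1 up) distC pv distC addn1.
have [p' [pp' e']] := dist_step (elimN eqP npw).
have pp : adj p u by rewrite adj_sym.
have far : d p' v = (d p v).+1.
  case: (dist_nbr v pp') => // h.
  have eq : p' = u by apply: (@closer_unique p _ _ v).
  by move: e' uw; rewrite eq; lia.
have := IH p p' pp' _ far e'; rewrite !(distC v) pv => ->; lia.
Qed.

(** The default value gives [step u u = u]. The body has the same form as the white case of
    [round1], so rounding is literally a step. *)
Definition step u v : T :=
  xget u [set p | adj u p /\ d u v = (1 + d p v)%N]%classic.

Lemma step_spec u v : u <> v -> adj u (step u v) /\ d u v = (d (step u v) v).+1.
Proof. by move=> uv; have [] := @xgetPex _ u [set p | adj u p /\ d u v = (1 + d p v)%N]%classic (dist_step uv). Qed.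

Lemma step_eq u p v : adj u p -> d u v = (d p v).+1 -> step u v = p.
Proof.
move=> up e; have uv : u <> v by move=> uv; move: e; rewrite uv distuu.
by have [h1 h2] := step_spec uv; apply: (closer_unique h1 up h2 e).
Qed.

Lemma dist_stepl u v : d (step u v) v = (d u v).-1.
Proof.
have [->|/eqP uv] := eqVneq u v; last by have [_ ->] := step_spec uv.
rewrite /step; set A := [set p | _]%classic.
case: (xgetP v A) => [p _ [_]|_]; by rewrite ?distuu.
Qed.

(* Points of two neighborhoods at distance at least 2 move independently. *)
Lemma dist_shift u p w w' : adj u p -> adj w w' -> 2 <= d u w ->
  d p w' + d u w = d p w + d u w'.
Proof.
move=> up ww' d2; have d1 := dist_adj1 ww'.
have uw' : d u w <= d u w' + 1 by rewrite -d1 (distC w); apply: dist_triangle.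
case: (dist_nbr w up) => h1; case: (dist_nbr w' up) => h2; try lia.
- by have := dist_through up h1 h2; rewrite d1 distC; lia.
- by have := dist_through up h2 h1; rewrite distC d1 distC; lia.
Qed.

Section Moves.
Variables x1 z1 x2 z2 : T.
Let x1' := step x1 z1.
Let z1' := step z1 x1.
Let x2' := step x2 z2.
Let z2' := step z2 x2.

(** A step of [x1] away from [v] puts [x1] on the path from [v] to [z1], so the opposite step of
    [z1] goes towards [v]. *)
Lemma step_away v : x1 <> z1 -> d x1' v <= d x1 v \/
  [/\ d x1' v = (d x1 v).+1, d z1 v = d x1 v + d x1 z1 & d z1' v = (d z1 v).-1].
Proof.
move=> ne; have [a1 e1] := step_spec ne.
case: (dist_nbr v a1) => h; last by left; rewrite /x1'; lia.
right; have t := dist_through a1 h e1.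
have t' : d z1 v = d x1 v + d x1 z1 by rewrite distC t (distC v).
have [b1 f1] := step_spec (fun e => ne (esym e)).
have := dist_triangle x1 z1' v; have := dist_nbr v b1; rewrite -/z1'.
have : d z1' x1 = (d z1 x1).-1 by rewrite /z1' dist_stepl.
rewrite (distC z1 x1) -/z1'; move: f1; rewrite (distC z1 x1) -/z1' -/x1'; split => //; lia.
Qed.

(** Two moves can increase the distance only if the points lie in the order [z1], [x1], [x2], [z2]
    on one path; then the opposite moves shorten the distance of [z1] and [z2] by two. *)
Lemma dist_steps2 : x1 <> z1 -> x2 <> z2 -> d x1' x2' <= d x1 x2 \/
  [/\ d x1' x2' = (d x1 x2).+2, d z1 z2 = d x1 x2 + d x1 z1 + d x2 z2 &
      (d z1' z2').+2 <= d z1 z2].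
Proof.
move=> n1 n2; have [a1 e1] := step_spec n1; have [a2 e2] := step_spec n2.
have [b1 f1] := step_spec (fun e => n1 (esym e)).
have [b2 f2] := step_spec (fun e => n2 (esym e)).
move: a1 e1 a2 e2 b1 f1 b2 f2.
rewrite -/x1' -/x2' -/z1' -/z2' => a1 e1 a2 e2 b1 f1 b2 f2.
have [le|gt] := leqP (d x1' x2') (d x1 x2); [by left | right].
have s1 := dist_nbr x2' a1; have s2 := dist_nbr x1 a2.
rewrite (distC x2' x1) (distC x2 x1) in s2.
have s3 := dist_nbr x2 a1; have s4 := dist_nbr x1' a2.
rewrite (distC x2' x1') (distC x2 x1') in s4.
(* Each single move changes a distance by exactly one, so growth means growth by two, in whichever
   order the moves are made. *)
have k : [/\ d x1' x2' = (d x1 x2').+1, d x1 x2' = (d x1 x2).+1 &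
             d x1' x2 = (d x1 x2).+1] by split; lia.
case: k => k1 k2 k3.
have t1 := dist_through a1 k1 e1; have t2 := dist_through a1 k3 e1.
rewrite (distC _ z1) (distC _ x1) in t1; rewrite (distC _ z1) (distC _ x1) in t2.
have k4 : d x2' z1 = (d x2 z1).+1 by rewrite !(distC _ z1) t1 t2 k2.
have t3 := dist_through a2 k4 e2.
have u1 := dist_triangle x1 z1' z2'; have u2 := dist_triangle x2 x1 z2'.
move: f1 f2 u1 u2; rewrite (distC z1 x1) (distC z2 x2) (distC x2 z2').
by move=> *; split; lia.
Qed.
End Moves.

End TreeMetric.

(** * The exchange inequality and descent *)

Section EvenConvex.
Variable R : realType.

(** What the exchange uses of [bar g]: besides being monotone and convex, it is linear across every
    odd point. *)
Record even_convex (G : nat -> R) : Prop := {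
  ec_mono : forall n, G n <= G n.+1;
  ec_convex : forall n, 2 * G n.+1 <= G n + G n.+2;
  ec_linear : forall n, ~~ odd n -> 2 * G n.+1 = G n + G n.+2 }.

Lemma bar_even (g : int -> R) (n : nat) : ~~ odd n -> bar g n%:Z = g n%:Z.
Proof. by rewrite /bar dvdzE /= dvdn2 => ->. Qed.

Lemma bar_odd (g : int -> R) (n : nat) :
  ~~ odd n -> bar g n.+1%:Z = (g n%:Z + g n.+2%:Z) / 2.
Proof.
move=> n2; rewrite /bar dvdzE /= dvdn2 /= n2 /=.
have -> : n.+1%:Z - 1 = n%:Z by rewrite -[n.+1]addn1 PoszD addrK.
by have -> : n.+1%:Z + 1 = n.+2%:Z by rewrite -[n.+2]addn1 PoszD.
Qed.

(** Three consecutive second differences, added with weights 1, 2, 1. *)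
Lemma convexZ2 (g : int -> R) : convexZ g -> forall t : int,
  2 * g (t + 2) <= g t + g (t + 4).
Proof.
move=> cg t.
have := cg (t + 1); have := cg (t + 1 + 1); have := cg (t + 1 + 1 + 1).
have e2 : t + 1 + 1 = t + 2 by rewrite -addrA.
have e4 : t + 1 + 1 + 1 + 1 = t + 4 by rewrite -!addrA.
rewrite !addrK e4 -e2 => *; lra.
Qed.

Lemma bar_even_convex (g : int -> R) :
  nondecreasingZ g -> convexZ g -> even_convex (fun n : nat => bar g n%:Z).
Proof.
move=> mg cg.
have m (t : int) : g t <= g (t + 1) by have := mg (t + 1); rewrite addrK.
have m2 (n : nat) : g n%:Z <= g n.+2%:Z.
  apply: le_trans (m _) _; apply: le_trans (m _) _.
  by rewrite -[n.+2]addn2 PoszD -addrA.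
split=> n; have [o|e] := boolP (odd n).
- case: n o => // n /= e; rewrite bar_odd // bar_even ?negbK //=; have := m2 n; lra.
- by rewrite bar_odd // bar_even //; have := m2 n; lra.
- case: n o => // n /= e; have e2 : ~~ odd n.+2 by rewrite /= negbK.
  rewrite (bar_odd g e) (bar_even g e2) (bar_odd g e2).
  by have := convexZ2 cg n%:Z; rewrite -!PoszD addn2 addn4; lra.
- by rewrite bar_odd // !bar_even ?negbK //=; lra.
- by [].
- by move=> _; rewrite bar_odd // !bar_even ?negbK //=; lra.
Qed.

Variable G : nat -> R.
Hypothesis Gc : even_convex G.

Lemma ec_le a b : (a <= b)%N -> G a <= G b.
Proof.
elim: b => [|b IH]; first by rewrite leqn0 => /eqP ->.
rewrite leq_eqVlt => /orP[/eqP -> //|/IH h]; exact: le_trans h (ec_mono Gc b).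
Qed.

Lemma ec_slope a b : (a <= b)%N -> G a.+1 - G a <= G b.+1 - G b.
Proof.
elim: b => [|b IH]; first by rewrite leqn0 => /eqP ->.
rewrite leq_eqVlt => /orP[/eqP -> //|/IH h]; have := ec_convex Gc b; lra.
Qed.

Lemma ec_incr a b k : (a <= b)%N -> G (a + k)%N - G a <= G (b + k)%N - G b.
Proof.
move=> ab; elim: k => [|k IH]; first by rewrite !addn0; lra.
have := @ec_slope (a + k) (b + k); rewrite leq_add2r ab !addnS => /(_ isT); lra.
Qed.

(** Weak majorization: a pair with no larger sum and no larger maximum has no larger value under a
    nondecreasing convex function. *)
Lemma ec_major a b a' b' : (a' + b' <= a + b)%N ->
  (a' <= maxn a b)%N -> (b' <= maxn a b)%N -> G a' + G b' <= G a + G b.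
Proof.
wlog ab : a b / (a <= b)%N.
  move=> h; have [/h //|ba] := orP (leq_total a b).
  by rewrite maxnC (addnC a) (addrC (G a)); apply: h.
wlog ab' : a' b' / (a' <= b')%N.
  move=> h s h1 h2; have [/h|ba] := orP (leq_total a' b'); first by apply.
  by rewrite addrC; apply: h => //; rewrite addnC.
rewrite (maxn_idPr ab) => s h1 h2.
have [h|h] := leqP a' a; first by apply: lerD; apply: ec_le.
have := @ec_incr a b' (a' - a) ltac:(lia); rewrite subnKC ?(ltnW h) //.
have := @ec_le (b' + (a' - a)) b ltac:(lia); lra.
Qed.

(* The last case is the exchange at an odd point, where [G] is linear. *)
Lemma ec_exchange a b a' b' :
  [\/ (a' <= a)%N /\ (b' <= b)%N,
      exists k, [/\ (a' = a + k)%N, (b' + k <= b)%N & (a + k <= b)%N],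
      exists k, [/\ (b' = b + k)%N, (a' + k <= a)%N & (b + k <= a)%N] |
      [/\ odd a, a = b & a' = a.+1 /\ b'.+1 = a \/ b' = a.+1 /\ a'.+1 = a]] ->
  G a' + G b' <= G a + G b.
Proof.
case=> [[h1 h2]|[k [h1 h2 h3]]|[k [h1 h2 h3]]|[o e [[h1 h2]|[h1 h2]]]].
- by apply: lerD; apply: ec_le.
- by apply: ec_major; lia.
- by apply: ec_major; lia.
- subst; have := ec_linear Gc (n := b'); move: o => /= o; rewrite o => /(_ isT); lra.
- subst; have := ec_linear Gc (n := a'); move: o => /= o; rewrite o => /(_ isT); lra.
Qed.

End EvenConvex.

(** * The exchange inequality, term by term *)

Section Exchange.
Variables (R : realType) (T : tree).
Local Notation d := (@dist T).

(** The condition on a coordinate that stays while [x1], [z1] move. The colors in the case of a tie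
    make [d x1 x2] odd, which is where [bar g] is linear. *)
Definition lags (x1 z1 x2 z2 : T) :=
  (d x2 z2 < d x1 z1)%N \/ (d x2 z2 = d x1 z1 /\ black x1 != black x2).

Section Terms.
Variables (G : nat -> R).
Hypothesis Gc : even_convex G.
Variables x1 z1 x2 z2 : T.
Let x1' := step x1 z1.
Let z1' := step z1 x1.
Let x2' := step x2 z2.
Let z2' := step z2 x2.

(** If the step of [x1] leaves [x2], then [d z1 x2 = d x1 x2 + d x1 z1], and [lags] with the
    triangle inequality gives [d x1 x2 <= d z1 z2]: the smaller argument grows and the larger one
    shrinks. Equality is the odd tie. The step of [z1] is symmetric. *)
Lemma exchange_dist1 : x1 <> z1 -> lags x1 z1 x2 z2 ->
  G (d x1' x2) + G (d z1' z2) <= G (d x1 x2) + G (d z1 z2).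
Proof.
move=> ne lag; apply: ec_exchange => //.
have ne' : z1 <> x1 by move=> e; apply: ne.
have [a1 e1] := step_spec ne; have [b1 f1] := step_spec ne'.
rewrite -/x1' -/z1' in a1 e1 b1 f1.
have ca := dist_nbr x2 a1; have cb := dist_nbr z2 b1.
have oa := dist_odd x1 x2.
have := step_away x2 ne; have := step_away z2 ne'.
rewrite -/x1' -/z1' !(distC z1 x1) => -[hb|[hb1 hb2 hb3]] [ha|[ha1 ha2 ha3]].
- by constructor 1.
- have t := dist_triangle z2 z1 x2; rewrite (distC z2 x2) in t.
  case: lag => [lt|[eq col]].
    by constructor 2; exists 1; split; lia.
  have ao : odd (d x1 x2) by rewrite oa; move: col; case: black; case: black.
  have [ab|ab] := eqVneq (d x1 x2) (d z1 z2).
    by constructor 4; split=> //; left; lia.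
  by constructor 2; exists 1; split; lia.
- have t := dist_triangle x2 x1 z2.
  case: lag => [lt|[eq col]].
    by constructor 3; exists 1; split; lia.
  have ao : odd (d x1 x2) by rewrite oa; move: col; case: black; case: black.
  have [ab|ab] := eqVneq (d x1 x2) (d z1 z2).
    by constructor 4; split=> //; right; lia.
  by constructor 3; exists 1; split; lia.
(* If both steps moved away, [d x2 z2] would be the sum of [d x1 z1], [d x1 x2] and [d z1 z2]. This
   contradicts [lags], since equality with [d x1 z1] forces [x1 = x2]. *)
- have n0 : d x1 z1 <> 0 by move=> /dist_eq0.
  have k : d z1 x2 = (d z1' x2).+1 by lia.
  have t := dist_through b1 hb1 k; rewrite (distC z2 x2) (distC z2 z1) in t.
  have : d x1 x2 = 0 -> black x1 = black x2 by move=> /dist_eq0 ->.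
  case: lag => [lt|[eq col]]; first lia.
  by move=> h; have := h ltac:(lia); move/eqP; rewrite (negbTE col).
Qed.

Lemma exchange_dist2 : x1 <> z1 -> x2 <> z2 ->
  G (d x1' x2') + G (d z1' z2') <= G (d x1 x2) + G (d z1 z2).
Proof.
move=> n1 n2; apply: ec_exchange => //.
have n1' : z1 <> x1 by move=> e; apply: n1.
have n2' : z2 <> x2 by move=> e; apply: n2.
have p1 : d x1 z1 <> 0 by move=> /dist_eq0.
have p2 : d x2 z2 <> 0 by move=> /dist_eq0.
have := dist_steps2 n1 n2; have := dist_steps2 n1' n2'.
rewrite -/x1' -/z1' -/x2' -/z2' !(distC z1 x1) !(distC z2 x2).
move=> -[hb|[hb1 hb2 hb3]] [ha|[ha1 ha2 ha3]]; [constructor 1|constructor 2|constructor 3|].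
- by [].
- by exists 2; split; lia.
- by exists 2; split; lia.
- lia.
Qed.

Variables c1 c2 : T.

(** Equal colors of [c1] and [c2] make the sum odd exactly when [x1] and [x2] differ in color, so
    the case of a tie is again the linear one. *)
Lemma exchange_sum1 : black c1 = black c2 -> x1 <> z1 -> lags x1 z1 x2 z2 ->
  G (d x1' c1 + d x2 c2)%N + G (d z1' c1 + d z2 c2)%N
  <= G (d x1 c1 + d x2 c2)%N + G (d z1 c1 + d z2 c2)%N.
Proof.
move=> col ne lag; apply: ec_exchange => //.
have ne' : z1 <> x1 by move=> e; apply: ne.
have [a1 e1] := step_spec ne; have [b1 f1] := step_spec ne'.
rewrite -/x1' -/z1' in a1 e1 b1 f1.
have ca := dist_nbr c1 a1; have cb := dist_nbr c1 b1.
have n0 : d x1 z1 <> 0 by move=> /dist_eq0.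
have oa : black x1 != black x2 -> odd (d x1 c1 + d x2 c2).
  by rewrite oddD !dist_odd col; case: black; case: black; case: black.
have := step_away c1 ne; have := step_away c1 ne'.
rewrite -/x1' -/z1' !(distC z1 x1) => -[hb|[hb1 hb2 hb3]] [ha|[ha1 ha2 ha3]].
- by constructor 1; split; lia.
- have t := dist_triangle z2 x2 c2.
  have [ab|ab] := eqVneq (d x1 c1 + d x2 c2)%N (d z1 c1 + d z2 c2)%N.
    case: lag => [lt|[eq bw]]; first lia.
    by constructor 4; split; [exact: oa|lia|left; lia].
  by constructor 2; exists 1; case: lag => [lt|[eq bw]]; split; lia.
- have t := dist_triangle x2 z2 c2; rewrite (distC z2 x2) in t.
  have [ab|ab] := eqVneq (d x1 c1 + d x2 c2)%N (d z1 c1 + d z2 c2)%N.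
    case: lag => [lt|[eq bw]]; first lia.
    by constructor 4; split; [exact: oa|lia|right; lia].
  by constructor 3; exists 1; case: lag => [lt|[eq bw]]; split; lia.
- lia.
Qed.

Lemma exchange_sum2 : x1 <> z1 -> x2 <> z2 ->
  G (d x1' c1 + d x2' c2)%N + G (d z1' c1 + d z2' c2)%N
  <= G (d x1 c1 + d x2 c2)%N + G (d z1 c1 + d z2 c2)%N.
Proof.
move=> n1 n2; apply: ec_exchange => //.
have n1' : z1 <> x1 by move=> e; apply: n1.
have n2' : z2 <> x2 by move=> e; apply: n2.
have p1 : d x1 z1 <> 0 by move=> /dist_eq0.
have p2 : d x2 z2 <> 0 by move=> /dist_eq0.
have [a1 e1] := step_spec n1; have [b1 f1] := step_spec n1'.
have [a2 e2] := step_spec n2; have [b2 f2] := step_spec n2'.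
rewrite -/x1' -/z1' -/x2' -/z2' in a1 e1 b1 f1 a2 e2 b2 f2.
have ca := dist_nbr c1 a1; have cb := dist_nbr c1 b1.
have cc := dist_nbr c2 a2; have cd := dist_nbr c2 b2.
have := step_away c1 n1; have := step_away c1 n1'.
have := step_away c2 n2; have := step_away c2 n2'.
rewrite -/x1' -/z1' -/x2' -/z2' !(distC z1 x1) !(distC z2 x2).
have [A|A] := leqP (d x1' c1 + d x2' c2)%N (d x1 c1 + d x2 c2)%N.
  have [B|B] := leqP (d z1' c1 + d z2' c2)%N (d z1 c1 + d z2 c2)%N.
    by move=> *; constructor 1; split; lia.
  by move=> [h1|[h1 k1 l1]] [h2|[h2 k2 l2]] [h3|[h3 k3 l3]] [h4|[h4 k4 l4]];
      try lia; constructor 3; exists 2; split; lia.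
by move=> [h1|[h1 k1 l1]] [h2|[h2 k2 l2]] [h3|[h3 k3 l3]] [h4|[h4 k4 l4]];
    try lia; constructor 2; exists 2; split; lia.
Qed.

End Terms.

Lemma geodesic_dist (u v : T) p : path (@adj T) u p -> last u p = v ->
  size p = d u v -> forall t, (t <= size p)%N ->
  d (nth u (u :: p) t) v = (size p - t)%N.
Proof.
elim: p u => [|a p IH] u /=; first by move=> _ _ e [|t].
case/andP => ua pp pl ps [|t] //.
rewrite ltnS subSS => tp.
have le : (d a v <= size p)%N by apply: dist_le_walk; exists p.
have e : size p = d a v by have := dist_nbr v ua; lia.
by rewrite -(IH a pp pl e t tp) /= (set_nth_default a).
Qed.

(** Along the geodesic from [x] to [z] the slopes of [f] increase, so the first slope is at most the
    last one. *)
Lemma exchange_convexT (f : T -> R) (x z : T) : convexT f -> x <> z ->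
  f (step x z) + f (step z x) <= f x + f z.
Proof.
move=> cf ne; have [p [pp pl ps]] := dist_walk x z.
have gd := geodesic_dist pp pl ps.
have szp : (0 < size p)%N.
  by rewrite ps lt0n; apply/eqP => /dist_eq0.
set v := nth x (x :: p) in gd.
have up : uniq (x :: p).
  apply/(uniqP x) => s t; rewrite !inE /= !ltnS => hs ht e.
  by have := gd s hs; rewrite /v e gd //; move: hs ht => /= *; lia.
have nbr t : (t < size p)%N -> adj (v t) (v t.+1).
  by move=> h; have /(pathP x) := pp; apply.
have slope t : (t < size p)%N -> f (v 1) - f (v 0) <= f (v t.+1) - f (v t).
  elim: t => [//|t IH] h; have := IH (ltnW h).
  have c : 0 <= f (v t.+2) - 2 * f (v t.+1) + f (v t) := cf x p pp up t h.
  by lra.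
have v0 : v 0 = x by [].
have vl : v (size p) = z by rewrite /v -pl; rewrite -[size p]/((size (x :: p)).-1) nth_last.
have s1 : step x z = v 1.
  apply: step_eq; first by rewrite -[x in adj x _]v0; apply: nbr.
  by rewrite gd // -ps; lia.
have s2 : step z x = v (size p).-1.
  have ad : adj (v (size p).-1) z by rewrite -vl -{2}(prednK szp); apply: nbr; lia.
  apply: step_eq; first by rewrite adj_sym.
  have := dist_triangle (v (size p).-1) x z; rewrite gd ?leq_pred //.
  have w : (d x (v (size p).-1) <= (size p).-1)%N.
    have tk : forall t, (t <= size p)%N -> (d x (v t) <= t)%N.
      elim=> [|t IH] h; first by rewrite v0 distuu.
      have := dist_triangle (v t) x (v t.+1).
      by rewrite (dist_adj1 (nbr t h)); have := IH (ltnW h); lia.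
    by apply: tk; rewrite leq_pred.
  by rewrite !(distC _ x) -ps; move: w szp; lia.
rewrite s1 s2; have := slope (size p).-1; rewrite prednK // leqnn => /(_ isT).
by rewrite v0 vl; lra.
Qed.

Definition move_toward n (A : pred 'I_n) (x z : 'I_n -> T) : 'I_n -> T :=
  fun i => if A i then step (x i) (z i) else x i.

Lemma relax_exchange n (P : sep2 R T n) (A : pred 'I_n) (x z : 'I_n -> T) :
  sep2_convex P -> (forall i, A i -> x i <> z i) ->
  (forall i j, A i -> ~~ A j -> lags (x i) (z i) (x j) (z j)) ->
  sep2_relax P (move_toward A x z) + sep2_relax P (move_toward A z x)
  <= sep2_relax P x + sep2_relax P z.
Proof.
move=> Pc Ane Alag; rewrite /sep2_relax /sep2_sum.
set f1 := (X in X + _ + _ + _ <= _); set g1 := (X in _ + X + _ + _ <= _).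
set h1 := (X in _ + X + _ <= _); set f2 := (X in _ + (X + _ + _) <= _).
set g2 := (X in _ + (_ + X + _) <= _); set h2 := (X in _ + (_ + X) <= _).
set f3 := (X in _ <= X + _ + _ + _); set g3 := (X in _ <= _ + X + _ + _).
set h3 := (X in _ <= _ + X + _); set f4 := (X in _ <= _ + (X + _ + _)).
set g4 := (X in _ <= _ + (_ + X + _)); set h4 := (X in _ <= _ + (_ + X)).
have F : f1 + f2 <= f3 + f4.
  rewrite -!big_split /=; apply: ler_sum => i iF; rewrite /move_toward.
  case: (boolP (A i)) => // Ai; apply: exchange_convexT; last exact: Ane.
  exact: sf_convex.
have Gle : g1 + g2 <= g3 + g4.
  rewrite -!big_split /=; apply: ler_sum => -[i j] /= ijG; rewrite /move_toward.
  have [mg cg] := sg_convex Pc ijG; have gc := bar_even_convex mg cg.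
  case: (boolP (A i)) => Ai; case: (boolP (A j)) => Aj //.
  - by apply: (exchange_dist2 gc); apply: Ane.
  - by apply: (exchange_dist1 gc); [apply: Ane|apply: Alag].
  - have := @exchange_dist1 _ gc (x j) (z j) (x i) (z i) (Ane j Aj) (Alag j i Aj Ai).
    by rewrite !(distC (x j)) !(distC (z j)) (distC (step (x j) _)) (distC (step (z j) _)).
have Hle : h1 + h2 <= h3 + h4.
  rewrite -!big_split /=; apply: ler_sum => -[i j] /= ijH; rewrite /move_toward.
  have [mh ch] := sh_convex Pc ijH; have hc := bar_even_convex mh ch.
  have col := same_color Pc ijH.
  case: (boolP (A i)) => Ai; case: (boolP (A j)) => Aj //.
  - by apply: (exchange_sum2 hc); apply: Ane.
  - by apply: (exchange_sum1 hc) => //; [apply: Ane|apply: Alag].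
  - have := @exchange_sum1 _ hc (x j) (z j) (x i) (z i) (sw P j) (sz P i) (esym col)
      (Ane j Aj) (Alag j i Aj Ai).
    by rewrite !(addnC (dist _ (sw P j))).
lra.
Qed.

(** * Moves of one color and the decrease of the distance to the minimizers *)

Definition nbhd n (e : bool) (x y : 'I_n -> T) : Prop :=
  forall i, y i = x i \/ (black (x i) = e /\ adj (x i) (y i)).

Section Descent.
Variables (n : nat) (P : sep2 R T n).
Hypothesis Pc : sep2_convex P.
Local Notation F := (sep2_relax P).

Lemma exchange_opt (A : pred 'I_n) (y z : 'I_n -> T) :
  (forall i, A i -> y i <> z i) ->
  (forall i j, A i -> ~~ A j -> lags (y i) (z i) (y j) (z j)) ->
  opt F z -> F y <= F (move_toward A y z) -> opt F (move_toward A z y).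
Proof.
move=> h1 h2 zo le t; have := relax_exchange Pc h1 h2; have := zo t; lra.
Qed.

(** The exchange acts on the coordinates where [y] is at distance exactly [l] from [z]. Since
    [D < l], they all have color [e]. The exchanged [y] is still a move of [x], hence no better than
    [y], so the exchanged [z] is again a minimizer. *)
Lemma nbhd_closer (e : bool) (x y z : 'I_n -> T) (D l : nat) :
  nbhd e x y -> (forall y', nbhd e x y' -> F y <= F y') -> opt F z ->
  (forall i, d (x i) (z i) <= D.+1)%N ->
  (forall i, black (x i) = ~~ e -> d (x i) (z i) <= D)%N ->
  (D < l)%N -> (forall i, d (y i) (z i) <= l)%N ->
  exists z', [/\ opt F z', forall i, (d (x i) (z' i) <= D.+1)%N,
    forall i, black (x i) = ~~ e -> (d (x i) (z' i) <= D)%N &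
    forall i, (d (y i) (z' i) <= l.-1)%N].
Proof.
move=> yn yopt zo xz xz' Dl yz.
pose A i := (l <= d (y i) (z i))%N.
have Al i : A i -> d (y i) (z i) = l by rewrite /A; have := yz i; lia.
have Ane i : A i -> y i <> z i by move=> /Al + e0; rewrite e0 distuu; lia.
have Ae i : A i -> black (x i) = e.
  move=> Ai; case: (yn i) => [yx|[]] //; have [//|/eqP xe] := boolP (black (x i) == e).
    by move/eqP.
  have c : black (x i) = ~~ e by case: black xe; case: (e).
  by have := xz' i c; rewrite -yx (Al i Ai); lia.
exists (move_toward A z y); split.
- apply: exchange_opt => //.
    move=> i j Ai; rewrite /A -ltnNge => lt; left; by rewrite (Al i Ai).
  (* A coordinate that has not moved steps to a neighbor of [x i]. One that has moved is farther
     from [z i] than [x i] is, because [x i] is within [D.+1 <= l]; its step leads back to [x i]. *)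
  apply: yopt => i; rewrite /move_toward; case: (boolP (A i)) => // Ai.
  have [s1 s2] := step_spec (Ane i Ai); case: (yn i) => [yx|[bx ad]].
    by right; split; [exact: Ae|rewrite -[x i]yx].
  left; apply: step_eq; first by rewrite adj_sym.
  by have := dist_nbr (z i) ad; have := xz i; rewrite (Al i Ai); lia.
- move=> i; rewrite /move_toward; case: (boolP (A i)) => // Ai.
  have [s1 s2] := step_spec (fun h => Ane i Ai (esym h)).
  have Ali := Al i Ai; case: (yn i) => [yx|[bx ad]].
    by have := xz i; rewrite -yx !(distC (y i)); lia.
  have xz1 := xz i; have dn := dist_nbr (z i) ad.
  case: (dist_nbr (x i) s1); rewrite !(distC _ (x i)) => far; last lia.
  have far' : d (step (z i) (y i)) (x i) = (d (z i) (x i)).+1 by rewrite !(distC _ (x i)).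
  have := dist_through s1 far' s2; rewrite (dist_adj1 ad) (distC (z i) (y i)); lia.
- move=> i c; rewrite /move_toward; case: (boolP (A i)) => Ai; last exact: xz'.
  by move: c; rewrite (Ae i Ai); case: (e).
- move=> i; rewrite /move_toward; case: (boolP (A i)) => Ai.
    by rewrite distC dist_stepl distC (Al i Ai).
  by move: Ai; rewrite /A; lia.
Qed.

Lemma descent (e : bool) (x y z : 'I_n -> T) (D : nat) :
  (forall y', nbhd (~~ e) x y' -> F x <= F y') ->
  nbhd e x y -> (forall y', nbhd e x y' -> F y <= F y') ->
  opt F z -> (forall i, d (x i) (z i) <= D.+1)%N ->
  exists2 z', opt F z' & forall i, (d (y i) (z' i) <= D)%N.
Proof.
move=> xopt yn yopt zo xz.
(* The optimality of [x] for the color [~~ e] is used to pull [z] towards [x] in the coordinates of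
   that color at distance [D.+1]. Coordinates of color [e] at the same distance may stay: they are
   the admissible ties. *)
pose A i := (black (x i) == ~~ e) && (d (x i) (z i) == D.+1).
have Ane i : A i -> x i <> z i by case/andP => _ /eqP + e0; rewrite e0 distuu.
have [z1 [z1o xz1 xz1']] : exists z1, [/\ opt F z1,
    forall i, (d (x i) (z1 i) <= D.+1)%N &
    forall i, black (x i) = ~~ e -> (d (x i) (z1 i) <= D)%N].
  exists (move_toward A z x); split.
  - apply: exchange_opt => //.
      move=> i j /andP[/eqP ci /eqP di]; rewrite /A negb_and => /orP[cj|dj].
        have := xz j; rewrite leq_eqVlt => /orP[/eqP h|h]; last by left; rewrite di.
        by right; split; [rewrite di h|rewrite ci eq_sym].
      by left; have := xz j; rewrite leq_eqVlt (negbTE dj) di.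
    apply: xopt => i; rewrite /move_toward; case: (boolP (A i)) => [Ai|]; last by left.
    right; split; last by case: (step_spec (Ane i Ai)).
    by case/andP: Ai => /eqP.
  - move=> i; rewrite /move_toward; case: (boolP (A i)) => // Ai.
    by rewrite distC dist_stepl distC; have := xz i; lia.
  - move=> i c; rewrite /move_toward; case: (boolP (A i)) => Ai.
      by rewrite distC dist_stepl distC; have := xz i; lia.
    by move: Ai; rewrite /A c eqxx /= => /eqP; have := xz i; rewrite /A; lia.
have yz1 i : (d (y i) (z1 i) <= D.+2)%N.
  have := xz1 i; case: (yn i) => [->|[_ ad]]; first lia.
  by have := dist_nbr (z1 i) ad; lia.
(* Moving from [x] to [y] may have cost one unit, so two rounds are needed, with [l] equal to [D.+2]
   and then [D.+1]. *)
have [z2 [z2o xz2 xz2' yz2]] := nbhd_closer yn yopt z1o xz1 xz1' (leqnSn D.+1) yz1.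
have [z3 [z3o _ _ yz3]] := nbhd_closer yn yopt z2o xz2 xz2' (ltnSn D) yz2.
by exists z3.
Qed.

(** [descent] applies with [y := x], so minimizers exist ever closer to [x], until one coincides
    with it. *)
Lemma local_opt (x z : 'I_n -> T) : (forall e y, nbhd e x y -> F x <= F y) ->
  opt F z -> opt F x.
Proof.
move=> xopt zo.
have [D hD] : exists D, forall i, (d (x i) (z i) <= D)%N.
  by exists (dist_max x z) => i; rewrite /dist_max; apply: (leq_bigmax (F := fun i => d (x i) (z i))).
elim: D z zo hD => [|D IH] z zo hD.
  suff -> : x = z by [].
  by apply: funext => i; apply: dist_eq0; have := hD i; rewrite leqn0 => /eqP.
have xx : nbhd true x x by move=> i; left.
have [z' zo' h'] := descent (xopt _) xx (xopt true) zo hD.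
exact: IH zo' h'.
Qed.

End Descent.

End Exchange.

(** * Rounding *)

Section MonotoneMinimum.
Variables (R : realType) (X : Type) (I : finType) (m : X -> I -> nat) (F : X -> R).

Definition attains_min (S : X -> Prop) :=
  exists2 s, S s & forall t, S t -> F s <= F t.

Lemma attains_min_union (J : eqType) (js : seq J) (S : J -> X -> Prop) :
  (forall j t, j \in js -> S j t -> attains_min (S j)) ->
  forall t, (exists2 j, j \in js & S j t) ->
  attains_min (fun t => exists2 j, j \in js & S j t).
Proof.
elim: js => [|j js IH] Smin t [i]; rewrite ?in_nil // => iJ Sit.
have IH' := IH (fun j' t h => Smin j' t (mem_behead (s := j :: js) h)).
case: (pselect (exists u, S j u)) => [[u Su]|none].
  have [s Ss smin] := Smin j u (mem_head _ _) Su.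
  case: (pselect (exists v, exists2 j, j \in js & S j v)) => [[v Sv]|none'].
    have [s' [j' j'J Ss'] s'min] := IH' v Sv.
    case: (leP (F s) (F s')) => h.
      exists s; first by exists j; rewrite ?mem_head.
      move=> w [i']; rewrite inE => /orP[/eqP -> /smin //|i'J Sw].
      by apply: le_trans h _; apply: s'min; exists i'.
    exists s'; first by exists j' => //; rewrite inE j'J orbT.
    move=> w [i']; rewrite inE => /orP[/eqP -> Sw|i'J Sw]; last by apply: s'min; exists i'.
    by apply: le_trans (ltW h) _; apply: smin.
  exists s; first by exists j; rewrite ?mem_head.
  move=> w [i']; rewrite inE => /orP[/eqP -> /smin //|i'J Sw].
  by case: none'; exists w, i'.
move: iJ; rewrite inE => /orP[/eqP ij|iJ]; first by case: none; exists t; rewrite -ij.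
have [|s [j' j'J Ss] smin] := IH' t; first by exists i.
exists s; first by exists j' => //; rewrite inE j'J orbT.
move=> w [i']; rewrite inE => /orP[/eqP -> Sw|i'J Sw]; last by apply: smin; exists i'.
by case: none; exists w.
Qed.

(* As in Dickson's lemma: a point with a smaller value than [s] must beat [s]
   in some coordinate, hence lies in one of finitely many slices on which one
   more coordinate is fixed. *)
Lemma monotone_attains_min (S : X -> Prop) t0 :
  (forall s t, S s -> S t -> (forall i, m s i <= m t i)%N -> F s <= F t) ->
  S t0 -> attains_min S.
Proof.
have [k] := ubnP #|[set: I]|.
(* The induction is on the number of coordinates that are not yet constant on [S]; [[set: I]] is
   generalized to the set of these. *)
have : forall s t i, S s -> S t -> i \notin [set: I] -> m s i = m t i.
  by move=> s t i _ _; rewrite inE.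
elim: k [set: I] S t0 => [//|k IH] A S s Sout kA mono Ss.
pose js := [seq (i, c) | i <- enum A, c <- iota 0 (m s i)].
pose Sl (j : I * nat) t := S t /\ m t j.1 = j.2.
have Slmin (j : I * nat) t : j \in js -> Sl j t -> attains_min (Sl j).
  move=> /allpairsPdep[i [c [iA _ ->]]] Slt.
  rewrite mem_enum in iA.
  apply: (IH (A :\ i) (Sl (i, c)) t _ _ _ Slt) => //.
  - move=> u v l [Su e1] [Sv e2]; rewrite !inE negb_and negbK => /orP[/eqP ->|h].
      by rewrite e1 e2.
    exact: Sout.
  - by move: kA; rewrite (cardsD1 i A) iA ltnS.
  - by move=> u v [Su _] [Sv _]; apply: mono.
have better t : S t -> F t < F s -> exists2 j, j \in js & Sl j t.
  move=> St lt; have [i [iA mi]] : exists i, i \in A /\ (m t i < m s i)%N.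
    apply: contrapT => h; move: lt; rewrite ltNge => /negP; apply.
    apply: mono => // i; rewrite leqNgt; apply/negP => mi.
    have [iA|iA] := boolP (i \in A); first by apply: h; exists i.
    by move: mi; rewrite (Sout t s i St Ss iA) ltnn.
  exists (i, m t i) => //; apply/allpairsPdep; exists i, (m t i).
  by rewrite mem_enum mem_iota.
case: (pselect (exists2 t, S t & F t < F s)) => [[t St lt]|none].
  have [u [j jJ [Su _]] umin] := attains_min_union Slmin (better t St lt).
  exists u => // v Sv; case: (ltP (F v) (F s)) => h; first exact/umin/better.
  apply: le_trans h; apply: le_trans (ltW lt); exact/umin/better.
exists s => // t St; rewrite leNgt; apply/negP => lt; apply: none; by exists t.
Qed.

End MonotoneMinimum.

(** * Rounding towards a black vertex and the factor two *)

Section Rounding.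
Variables (R : realType) (T : tree).
Local Notation d := (@dist T).

Lemma round1E (y v : T) : round1 y v = if black v then v else step v y.
Proof. by []. Qed.

Section Point.
Variable y : T.
Hypothesis yB : black y.
Let r := round1 y.

Lemma white_neq u : ~~ black u -> u <> y.
Proof. by move=> wu e; move: wu; rewrite e yB. Qed.

Lemma black_round1 u : black (r u).
Proof.
rewrite /r round1E; case: ifPn => // wu.
have [ad _] := step_spec (white_neq wu); have := black_proper ad.
by rewrite (negbTE wu); case: black.
Qed.

Lemma dist_round1 u v : (d (r u) (r v) <= d u v + odd (d u v))%N.
Proof.
have st a c : ~~ black a -> (d (step a y) c <= (d a c).+1)%N.
  move=> wa; have [ad _] := step_spec (white_neq wa); have := dist_nbr c ad; lia.
have o := dist_odd u v; rewrite /r !round1E.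
case: ifPn o => wu; case: ifPn => wv /= ->; rewrite ?addn0 ?addn1 //.
- by rewrite distC (distC u) st.
- by rewrite st.
(* Both points step towards the same [y]; if their distance grew, [d y y] would be the positive sum
   of [d u v], [d u y] and [d v y]. *)
have [|[_ e _]] := dist_steps2 (white_neq wu) (white_neq wv); first by [].
move: e; rewrite distuu.
have : d u y <> 0 by move=> /dist_eq0; apply: white_neq.
lia.
Qed.

Lemma round1_black z : black z -> r z = z.
Proof. by rewrite /r round1E => ->. Qed.

End Point.

(** For odd [a], [2 * bar g a] is the sum of the values at [a - 1] and [a + 1]. Monotonicity bounds
    [g b] by the second, and the first is nonnegative. *)
Lemma bar_double (g : int -> R) (a b : nat) : (forall t, 0 <= g t) ->
  nondecreasingZ g -> (b <= a + odd a)%N -> g b%:Z <= 2 * bar g a%:Z.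
Proof.
move=> g0 mg ba.
have m (s t : nat) : (s <= t)%N -> g s%:Z <= g t%:Z.
  elim: t => [|t IH]; first by rewrite leqn0 => /eqP ->.
  rewrite leq_eqVlt => /orP[/eqP -> //|/IH h]; apply: le_trans h _.
  by have := mg t.+1%:Z; rewrite (_ : t.+1%:Z - 1 = t%:Z) //; lia.
have [o|e] := boolP (odd a); last first.
  rewrite bar_even //; have := m b a; rewrite (negbTE e) addn0 in ba.
  by move=> /(_ ba); have := g0 a%:Z; lra.
case: a o ba => // a /= ea; rewrite ea addn1 => ba; rewrite bar_odd //.
by have := m b a.+2 ba; have := g0 a%:Z; lra.
Qed.

(** Distances between black vertices are even, where [bar g] and [g] agree. *)
Lemma multifac_relax_black n (P : multifac R T n) q : multifac_convex P ->
  in_Bn q -> multifac_relax P q = multifac_fun P q.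
Proof.
move=> Pc qB; congr (_ + _); apply: eq_bigr => i _; apply: eq_bigr => j _.
  by rewrite bar_even // dist_odd qB (site_black Pc).
by rewrite bar_even // dist_odd !qB.
Qed.

Lemma multifac_attains_min n (P : multifac R T n) (y : T) : black y -> multifac_convex P ->
  exists2 q, in_Bn q & forall p, in_Bn p -> multifac_fun P q <= multifac_fun P p.
Proof.
move=> yB Pc.
pose m (x : 'I_n -> T) (k : ('I_n * 'I_(nsites P)) + ('I_n * 'I_n)) := match k with
  | inl ij => d (x ij.1) (site P ij.2) | inr ij => d (x ij.1) (x ij.2) end.
apply: (@monotone_attains_min R _ _ m _ (@in_Bn T n) (fun=> y)) => // s t _ _ st.
have mono g (a b : nat) : nondecreasingZ g -> (a <= b)%N -> (g a%:Z : R) <= g b%:Z.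
  move=> mg; elim: b => [|b IH]; first by rewrite leqn0 => /eqP ->.
  rewrite leq_eqVlt => /orP[/eqP -> //|/IH h]; apply: le_trans h _.
  by have := mg b.+1%:Z; rewrite (_ : b.+1%:Z - 1 = b%:Z) //; lia.
apply: lerD; apply: ler_sum => i _; apply: ler_sum => j _; apply: mono.
- by have [] := mf_convex Pc i j.
- exact: (st (inl (i, j))).
- by have [] := mg_convex Pc i j.
- exact: (st (inr (i, j))).
Qed.

Lemma rounding_approx2 n (P : multifac R T n) xs (y : T) : multifac_convex P ->
  opt (multifac_relax P) xs -> black y ->
  approx2 (multifac_fun P) (round_to y xs).
Proof.
move=> Pc xopt yB; split; first by move=> i; apply: black_round1.
have [q qB qmin] := multifac_attains_min yB Pc; exists q; split => //.
rewrite -(multifac_relax_black Pc qB); apply: le_trans (_ : _ <= 2 * multifac_relax P xs) _.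
  rewrite mulrDr !mulr_sumr; apply: lerD; apply: ler_sum => i _; rewrite mulr_sumr;
    apply: ler_sum => j _; apply: bar_double.
  - by have [] := mf_convex Pc i j.
  - by have [] := mf_convex Pc i j.
  - rewrite /round_to -{1}(round1_black y (site_black Pc j)); exact: dist_round1.
  - by have [] := mg_convex Pc i j.
  - by have [] := mg_convex Pc i j.
  - exact: dist_round1.
by have := xopt q; lra.
Qed.

End Rounding.

(** * Maximum flows, minimum cuts and residual reachability *)

Section Flows.
Variable R : realType.
Implicit Types (N : network R) (phi psi : nat -> R) (Y : pred nat).

(** The flow leaving [Y] minus the flow entering it. Written edge by edge it is linear in [phi] and
    additive over the nodes of [Y], and it can be compared with the cut value termwise. *)
Definition net_flow N phi Y : R :=
  \sum_(e < edges N) phi e * ((Y (etail N e))%:R - (Y (ehead N e))%:R).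

Definition cut_value N Y : R :=
  \sum_(e < edges N) (Y (etail N e) && ~~ Y (ehead N e))%:R * ecap N e.

Lemma net_flow1 N phi v :
  outflow N phi v - inflow N phi v = net_flow N phi (pred1 v).
Proof.
rewrite /outflow /inflow big_mkcond [X in _ - X]big_mkcond -sumrB.
apply: eq_bigr => e _ /=.
by case: eqP; case: eqP => *; rewrite /= ?mulr1 ?mulr0 ?subr0 ?sub0r ?subrr ?mulrN ?mulr1 ?mulr0.
Qed.

Lemma net_flow_sum N phi Y : network_ok N ->
  \sum_(v < nodes N | Y v) net_flow N phi (pred1 (v : nat)) = net_flow N phi Y.
Proof.
move=> [_ _ _ ok]; rewrite /net_flow exchange_big /=; apply: eq_bigr => e _.
have [tl hd _] := ok e (ltn_ord e).
have ind (u : nat) : (u < nodes N)%N ->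
    \sum_(v < nodes N | Y v) (u == v)%:R = (Y u)%:R :> R.
  move=> uN; rewrite big_mkcond (bigD1 (Ordinal uN)) //= eqxx big1 => [|v nv].
    by rewrite addr0; case: (Y u).
  by case: ifP => // _; case: eqP => // uv; case/eqP: nv; apply: val_inj.
by rewrite -mulr_sumr sumrB !ind.
Qed.

Lemma net_flowD N phi psi a Y :
  net_flow N (fun e => phi e + a * psi e) Y = net_flow N phi Y + a * net_flow N psi Y.
Proof.
by rewrite /net_flow mulr_sumr -big_split; apply: eq_bigr => e _ /=; ring.
Qed.

Lemma net_flow_delta N e Y : (e < edges N)%N ->
  net_flow N (fun f => (f == e)%:R) Y = (Y (etail N e))%:R - (Y (ehead N e))%:R.
Proof.
move=> eN; rewrite /net_flow (bigD1 (Ordinal eN)) //= eqxx mul1r big1 ?addr0 // => f nf.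
by case: eqP => [fe|]; rewrite ?mul0r //; case/eqP: nf; apply: val_inj.
Qed.

Lemma flow_value_net N phi Y : network_ok N -> flow N phi ->
  Y (source N) -> ~~ Y (sink N) -> flow_value N phi = net_flow N phi Y.
Proof.
move=> ok [_ cons] Ys Yt; rewrite -net_flow_sum //; have [sN tN st _] := ok.
rewrite (bigD1 (Ordinal sN)) //= -net_flow1 big1 ?addr0 // => v /andP[Yv vs].
rewrite -net_flow1 cons ?subrr //; apply/negP => /eqP e.
  by move: Yt; rewrite -e Yv.
Qed.

Lemma cut_gap N phi Y : flow N phi -> forall e : 'I_(edges N),
  0 <= (Y (etail N e) && ~~ Y (ehead N e))%:R * ecap N e
       - phi e * ((Y (etail N e))%:R - (Y (ehead N e))%:R).
Proof.
move=> [cap _] e; have /andP[p0 pc] := cap e (ltn_ord e).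
by case: (Y (etail N e)); case: (Y (ehead N e)) => /=; lra.
Qed.

Lemma flow_value_le_cut N phi Y : network_ok N -> flow N phi ->
  Y (source N) -> ~~ Y (sink N) -> flow_value N phi <= cut_value N Y.
Proof.
move=> ok fl Ys Yt; rewrite (flow_value_net ok fl Ys Yt) -subr_ge0 -sumrB.
by apply: sumr_ge0 => e _; apply: cut_gap.
Qed.

Lemma flow_value_eq_cut N phi Y : network_ok N -> flow N phi ->
  Y (source N) -> ~~ Y (sink N) ->
  (forall e, (e < edges N)%N -> Y (etail N e) -> ~~ Y (ehead N e) -> ecap N e <= phi e) ->
  (forall e, (e < edges N)%N -> Y (ehead N e) -> ~~ Y (etail N e) -> phi e <= 0) ->
  flow_value N phi = cut_value N Y.
Proof.
move=> ok fl Ys Yt sat0 sat1; rewrite (flow_value_net ok fl Ys Yt).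
apply: eq_bigr => e _; have eN := ltn_ord e.
have [cap _] := fl; have /andP[p0 pc] := cap e eN.
move: (sat0 e eN) (sat1 e eN); case: (Y (etail N e)); case: (Y (ehead N e)) => /= h1 h2.
- lra.
- by have := h1 isT isT; lra.
- by have := h2 isT isT; lra.
- lra.
Qed.

(** Complementary slackness: the termwise gaps between cut value and net flow are nonnegative, so
    they all vanish when their sum is at most zero. *)
Lemma tight_cut N phi Y : network_ok N -> flow N phi ->
  Y (source N) -> ~~ Y (sink N) -> cut_value N Y <= flow_value N phi ->
  forall e, (e < edges N)%N ->
    (Y (etail N e) -> ~~ Y (ehead N e) -> ecap N e <= phi e) /\
    (Y (ehead N e) -> ~~ Y (etail N e) -> phi e <= 0).
Proof.
move=> ok fl Ys Yt; rewrite (flow_value_net ok fl Ys Yt) -subr_le0 -sumrB => le e eN.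
have gap := cut_gap Y fl.
have := le; rewrite (bigD1 (Ordinal eN)) //=.
have := @sumr_ge0 _ _ (index_enum _) (fun f => f != Ordinal eN) _ (fun f _ => gap f).
move=> h1 h2; have := gap (Ordinal eN) => /= h3.
have [cap _] := fl; have /andP[p0 pc] := cap e eN.
by split; move: h1 h2 h3; case: (Y (etail N e)); case: (Y (ehead N e)) => //= *; lra.
Qed.

(** * Residual reachability and the minimal minimum cut *)

Inductive reach N phi : nat -> Prop :=
| reach_source : reach N phi (source N)
| reach_forward e : (e < edges N)%N -> reach N phi (etail N e) ->
    phi e < ecap N e -> reach N phi (ehead N e)
| reach_backward e : (e < edges N)%N -> reach N phi (ehead N e) ->
    0 < phi e -> reach N phi (etail N e).

Definition cap_ok N phi := forall e, (e < edges N)%N -> 0 <= phi e <= ecap N e.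

(* Averaging an augmentation with the flow itself keeps some residual capacity
   on every residual edge; [t] is small enough to push on [e] as well. *)
Lemma augment_edge N phi phi' e (s : bool) eps : cap_ok N phi -> cap_ok N phi' ->
  0 < eps -> (e < edges N)%N ->
  (if s then phi e < ecap N e else 0 < phi e) ->
  exists2 t, 0 < t <= 2^-1 & cap_ok N (fun f =>
    phi f + t * (phi' f + (-1) * phi f) + (-1) ^+ (~~ s) * (t * eps) * (f == e)%:R).
Proof.
move=> ok ok' e0 eN res.
pose r := if s then ecap N e - phi e else phi e.
have r0 : 0 < r by rewrite /r; case: (s) res; lra.
(* With [t <= 1/2] the mixture [(1 - t) phi + t phi'] keeps at least [(1 - t) * r >= r / 2] of the
   residual capacity on [e], while the push [t * eps] is at most [r / 2]. *)
pose t := Num.min 2^-1 (r / (2 * eps)).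
have te : t * eps <= r / 2.
  apply: le_trans (_ : r / (2 * eps) * eps <= _).
    by rewrite ler_pM2r // /t ge_min lexx orbT.
  by rewrite le_eqVlt; apply/orP; left; apply/eqP; field; rewrite gt_eqF.
have t0 : 0 < t by rewrite /t lt_min divr_gt0 ?mulr_gt0 ?invr_gt0 //; lra.
have t1 : t <= 2^-1 by rewrite /t ge_min lexx.
have te0 : 0 < t * eps by rewrite mulr_gt0.
exists t; first by rewrite t0.
move=> f fN; have /andP[p0 pc] := ok f fN; have /andP[q0 qc] := ok' f fN.
have k : phi f + t * (phi' f + (-1) * phi f) = (1 - t) * phi f + t * phi' f by ring.
rewrite k; have a1 : 0 <= t * phi' f by rewrite mulr_ge0 // ltW.
have a2 : t * phi' f <= t * ecap N f by rewrite ler_pM2l.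
have t2 : 0 < 1 - t by lra.
have a3 : 0 <= (1 - t) * phi f by rewrite mulr_ge0 // ltW.
have a4 : (1 - t) * phi f <= (1 - t) * ecap N f by rewrite ler_pM2l.
case: eqP => [fe|_]; last first.
  by rewrite mulr0 addr0; apply/andP; split; [|have : (1 - t) * ecap N f + t * ecap N f = ecap N f by ring]; lra.
rewrite mulr1; subst f.
have rr : r / 2 <= (1 - t) * r.
  by rewrite mulrC ler_pM2r //; lra.
move: rr te r0; rewrite /r; case: (s) => /= rr te r0; rewrite ?expr0 ?expr1 ?mul1r.
  have : (1 - t) * (ecap N e - phi e) = (1 - t) * ecap N e - (1 - t) * phi e by ring.
  have : (1 - t) * ecap N e + t * ecap N e = ecap N e by ring.
  by move=> *; apply/andP; split; lra.
have : (1 - t) * ecap N e + t * ecap N e = ecap N e by ring.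
by move=> *; rewrite mulN1r; apply/andP; split; lra.
Qed.

(** Pushes a little flow from the source to [v], by induction on the derivation of reachability.
    Thanks to the averaging in [augment_edge], no simple augmenting path has to be extracted: a
    derivation may use an edge repeatedly. *)
Lemma augment N phi v : network_ok N -> cap_ok N phi -> reach N phi v ->
  exists eps phi', [/\ 0 < eps, cap_ok N phi' &
    forall u, net_flow N phi' (pred1 u) =
      net_flow N phi (pred1 u) + eps * ((source N == u)%:R - (v == u)%:R)].
Proof.
move=> ok cok; elim=> {v} [|e eN _ [eps [phi' [e0 ok' div]]] res
                           |e eN _ [eps [phi' [e0 ok' div]]] res].
- by exists 1, phi; split=> // u; rewrite subrr mulr0 addr0.
- have [t /andP[t0 _] tok] := @augment_edge N phi phi' e true eps cok ok' e0 eN res.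
  exists (t * eps); eexists; split; [by rewrite mulr_gt0|exact: tok|move=> u].
  by rewrite !net_flowD net_flow_delta // div /=; ring.
- have [t /andP[t0 _] tok] := @augment_edge N phi phi' e false eps cok ok' e0 eN res.
  exists (t * eps); eexists; split; [by rewrite mulr_gt0|exact: tok|move=> u].
  by rewrite !net_flowD net_flow_delta // div /=; ring.
Qed.

Lemma max_flow_sink N phi : network_ok N -> max_flow N phi -> ~ reach N phi (sink N).
Proof.
move=> ok [[cok cons] mx] rt; have [_ _ st _] := ok.
have [eps [phi' [e0 ok' div]]] := augment ok cok rt.
have val : flow_value N phi' = flow_value N phi + eps.
  by rewrite /flow_value !net_flow1 div eqxx eq_sym (negbTE st) subr0 mulr1.
have : flow_value N phi' <= flow_value N phi.
  apply: mx; split=> // v vN vs vt; apply/eqP; rewrite eq_sym -subr_eq0 net_flow1 div.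
  rewrite ![_ == v]eq_sym (negbTE vs) (negbTE vt) subrr mulr0 addr0 -net_flow1.
  by rewrite cons ?subrr.
by rewrite val; lra.
Qed.

Lemma reach_node N phi v : network_ok N -> reach N phi v -> (v < nodes N)%N.
Proof.
by move=> [sN _ _ ok]; elim=> {v} [|e eN _ _ _|e eN _ _ _] //; have [] := ok e eN.
Qed.

Section MaxFlow.
Variables (N : network R) (phi : nat -> R).
Hypotheses (ok : network_ok N) (mf : max_flow N phi).
Let X : pred nat := fun v => `[< reach N phi v >].

Lemma min_cut_source : X (source N).
Proof. by apply/asboolP; apply: reach_source. Qed.

Lemma min_cut_sink : ~~ X (sink N).
Proof. by apply/asboolPn; apply: max_flow_sink. Qed.

Lemma min_cut_value : flow_value N phi = cut_value N X.
Proof.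
have [fl _] := mf; apply: flow_value_eq_cut => //.
- exact: min_cut_source.
- exact: min_cut_sink.
- move=> e eN /asboolP rt /asboolPn nr; rewrite leNgt; apply/negP => lt.
  by apply: nr; apply: reach_forward lt.
- move=> e eN /asboolP rt /asboolPn nr; rewrite leNgt; apply/negP => lt.
  by apply: nr; apply: reach_backward lt.
Qed.

Lemma min_cut_le Y : Y (source N) -> ~~ Y (sink N) -> cut_value N X <= cut_value N Y.
Proof. by have [fl _] := mf; rewrite -min_cut_value; apply: flow_value_le_cut. Qed.

(** By complementary slackness no residual edge leaves a minimum cut [Y], so every node reachable
    from the source lies in [Y]. *)
Lemma min_cut_minimal Y v : Y (source N) -> ~~ Y (sink N) ->
  cut_value N Y <= cut_value N X -> reach N phi v -> Y v.
Proof.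
have [fl _] := mf; rewrite -min_cut_value => Ys Yt le.
have tight := tight_cut ok fl Ys Yt le.
elim=> {v} [//|e eN _ Yv res|e eN _ Yv res]; have [h1 h2] := tight e eN;
  by apply: contraLR res => nY; rewrite -leNgt ?h1 ?h2.
Qed.

End MaxFlow.

(* A network whose maximum flows exhibit the nodes reachable in the residual
   graph of [phi]: residual edges get the huge capacity [big], and every endpoint
   of an edge is joined to a new sink by an edge of capacity 1. *)
Record residual_network N phi (big : R) N2 : Prop := {
  rn_nodes : nodes N2 = (nodes N).+1;
  rn_edges : edges N2 = (4 * edges N)%N;
  rn_source : source N2 = source N;
  rn_sink : sink N2 = nodes N;
  rn_big : (2 * edges N)%:R < big;
  rn_tail_out : forall e, (e < edges N)%N -> [/\ etail N2 e = etail N e,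
    ehead N2 e = nodes N & ecap N2 e = 1];
  rn_head_out : forall e, (e < edges N)%N -> [/\ etail N2 (edges N + e) = ehead N e,
    ehead N2 (edges N + e) = nodes N & ecap N2 (edges N + e) = 1];
  rn_forward : forall e, (e < edges N)%N ->
    [/\ etail N2 (2 * edges N + e) = etail N e,
    ehead N2 (2 * edges N + e) = ehead N e &
    ecap N2 (2 * edges N + e) = if phi e < ecap N e then big else 0];
  rn_backward : forall e, (e < edges N)%N ->
    [/\ etail N2 (3 * edges N + e) = ehead N e,
    ehead N2 (3 * edges N + e) = etail N e &
    ecap N2 (3 * edges N + e) = if 0 < phi e then big else 0] }.

Section ResidualNetwork.
Variables (N : network R) (phi : nat -> R) (big : R) (N2 : network R).
Hypotheses (ok : network_ok N) (rn : residual_network N phi big N2).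
Local Notation m := (edges N).

Lemma residual_edge f : (f < 4 * m)%N -> exists2 e, (e < m)%N &
  [\/ f = e, f = (m + e)%N, f = (2 * m + e)%N | f = (3 * m + e)%N].
Proof.
move=> f4; have [h|h] := ltnP f m; first by exists f => //; constructor 1.
have [h2|h2] := ltnP f (2 * m).
  by exists (f - m)%N; [lia|constructor 2; lia].
have [h3|h3] := ltnP f (3 * m).
  by exists (f - 2 * m)%N; [lia|constructor 3; lia].
by exists (f - 3 * m)%N; [lia|constructor 4; lia].
Qed.

Lemma big_gt0 : 0 < big.
Proof. by apply: le_lt_trans (rn_big rn); rewrite ler0n. Qed.

Lemma residual_network_ok : network_ok N2.
Proof.
have [sN tN st eok] := ok; have b0 := ltW big_gt0.
split; rewrite ?(rn_nodes rn) ?(rn_source rn) ?(rn_sink rn) ?(rn_edges rn) //.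
- exact: ltnW.
- by rewrite neq_ltn sN.
move=> f /residual_edge[e em hf]; have [tl hd _] := eok e em.
case: hf => ->; [have [-> -> ->] := rn_tail_out rn em|have [-> -> ->] := rn_head_out rn em
  |have [-> -> ->] := rn_forward rn em|have [-> -> ->] := rn_backward rn em];
  split; rewrite ?ltnS ?ler01 //; try exact: ltnW; by case: ifP.
Qed.

Variable psi : nat -> R.
Hypothesis mf : max_flow N2 psi.

Lemma cut_term_ge0 Y (f : 'I_(edges N2)) :
  0 <= (Y (etail N2 f) && ~~ Y (ehead N2 f))%:R * ecap N2 f.
Proof.
have [_ _ _ h] := residual_network_ok; have [_ _ c] := h f (ltn_ord f).
by rewrite mulr_ge0.
Qed.

(** The cut that separates only the new sink crosses just the [2 * m] unit edges. A minimum cut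
    therefore costs less than [big], so no edge of capacity [big] crosses it. *)
Lemma residual_cut_small :
  cut_value N2 (fun v => `[< reach N2 psi v >]) < big.
Proof.
have ok2 := residual_network_ok; have [_ _ _ eok] := ok.
apply: le_lt_trans (rn_big rn).
apply: le_trans (min_cut_le ok2 mf (Y := fun v => v != nodes N) _ _) _.
- by rewrite (rn_source rn); have [sN _ _ _] := ok; rewrite neq_ltn sN.
- by rewrite (rn_sink rn) negbK.
have -> : (2 * m)%:R = \sum_(f < edges N2) (f < 2 * m)%N%:R :> R.
  rewrite (rn_edges rn) -natr_sum; congr _%:R.
  rewrite -{1}[(2 * m)%N]card_ord -sum1_card (big_ord_widen (4 * m) (fun=> 1%N)) ?leq_mul2r ?orbT //.
  by rewrite big_mkcond; apply: eq_bigr => i _; case: ifP.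
apply: ler_sum => f _; have := ltn_ord f; rewrite {2}(rn_edges rn) => /residual_edge[e em hf].
have [tl hd _] := eok e em.
case: hf => ->; [have [-> -> ->] := rn_tail_out rn em|have [-> -> ->] := rn_head_out rn em
  |have [-> -> _] := rn_forward rn em|have [-> -> _] := rn_backward rn em].
- rewrite mulr1 ler_nat; case: ltnP => h; last lia; by case: (_ && _).
- rewrite mulr1 ler_nat; case: ltnP => h; last lia; by case: (_ && _).
- by rewrite (ltn_eqF hd) (ltn_eqF tl) /= mul0r ler0n.
- by rewrite (ltn_eqF hd) (ltn_eqF tl) /= mul0r ler0n.
Qed.

Lemma reach_residual v : reach N phi v -> reach N2 psi v.
Proof.
have ok2 := residual_network_ok.
have big_edge f : (f < edges N2)%N -> ecap N2 f = big ->
    reach N2 psi (etail N2 f) -> reach N2 psi (ehead N2 f).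
  move=> fN cb rt; apply: contrapT => nr; have := residual_cut_small.
  rewrite /cut_value (bigD1 (Ordinal fN)) //= (asboolT rt) (asboolF nr) /= mul1r cb.
  apply/negP; rewrite -leNgt lerDl; apply: sumr_ge0 => g _.
  exact: (cut_term_ge0 (fun v => `[< reach N2 psi v >])).
elim=> {v} [|e em _ IH res|e em _ IH res].
- by rewrite -(rn_source rn); apply: reach_source.
- have [t h c] := rn_forward rn em; rewrite res in c.
  by rewrite -h; apply: big_edge; rewrite ?t // (rn_edges rn); lia.
- have [t h c] := rn_backward rn em; rewrite res in c.
  by rewrite -h; apply: big_edge; rewrite ?t // (rn_edges rn); lia.
Qed.

(** The flow value is computed across two cuts, the reachable set [X] and the set [Y] of all nodes
    but the new sink. Every edge contributes at least as much to [Y] as to [X], so equal sums force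
    equal terms; a unit edge with unreached tail counts only for [Y]. *)
Lemma unreached_flow0 f : (f < 2 * m)%N -> ~ reach N phi (etail N2 f) -> psi f = 0.
Proof.
have ok2 := residual_network_ok; have [sN _ _ eok] := ok; have [fl _] := mf.
pose X : pred nat := fun v => `[< reach N phi v >].
pose Y : pred nat := fun v => v != nodes N.
have XY v : X v -> Y v.
  move=> /asboolP /reach_node h; rewrite /Y; apply/negP => /eqP e.
  by have := h ok; rewrite e ltnn.
have Xs : X (source N2) by rewrite (rn_source rn); apply/asboolP; apply: reach_source.
have Ys : Y (source N2) by apply: XY.
have Yt : ~~ Y (sink N2) by rewrite (rn_sink rn) /Y negbK.
have Xt : ~~ X (sink N2) by apply: contra Yt; apply: XY.
have := flow_value_net ok2 fl Ys Yt; rewrite (flow_value_net ok2 fl Xs Xt) => /esym/eqP.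
rewrite -subr_eq0 -sumrB => /eqP sum0.
have [cap _] := fl.
have term (g : 'I_(edges N2)) : 0 <= psi g * ((Y (etail N2 g))%:R - (Y (ehead N2 g))%:R)
      - psi g * ((X (etail N2 g))%:R - (X (ehead N2 g))%:R).
  have gN := ltn_ord g; have /andP[p0 pc] := cap g gN.
  move: gN; rewrite {2}(rn_edges rn) => /residual_edge[e em hf].
  have [tl hd _] := eok e em; have n0 : X (nodes N) = false.
    by apply/negP => /XY; rewrite /Y eqxx.
  case: hf p0 pc => ->; [have [-> -> _] := rn_tail_out rn em|have [-> -> _] := rn_head_out rn em
    |have [-> -> ->] := rn_forward rn em|have [-> -> ->] := rn_backward rn em].
  - by move=> p0 _; rewrite n0 /Y eqxx (ltn_eqF tl) /=; case: (X _) => /=; lra.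
  - by move=> p0 _; rewrite n0 /Y eqxx (ltn_eqF hd) /=; case: (X _) => /=; lra.
  - rewrite /Y (ltn_eqF tl) (ltn_eqF hd) /=; case: ifP => res p0 pc.
      case: (boolP (X (etail N e))) => [/asboolP r|_]; case: (boolP (X (ehead N e))) => [_|/asboolPn nr] /=; try lra.
      by case: nr; apply: reach_forward res.
    have -> : psi (2 * m + e)%N = 0 by lra.
    by rewrite !mul0r subrr.
  - rewrite /Y (ltn_eqF tl) (ltn_eqF hd) /=; case: ifP => res p0 pc.
      case: (boolP (X (ehead N e))) => [/asboolP r|_]; case: (boolP (X (etail N e))) => [_|/asboolPn nr] /=; try lra.
      by case: nr; apply: reach_backward res.
    have -> : psi (3 * m + e)%N = 0 by lra.
    by rewrite !mul0r subrr.
move=> f2 nr; have fN : (f < edges N2)%N by rewrite (rn_edges rn); lia.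
have tz := (psumr_eq0P (fun g _ => term g)) sum0 (Ordinal fN) isT.
have XF : X (etail N2 f) = false by apply/asboolPn.
have hd : ehead N2 f = nodes N.
  have [fm|fm] := ltnP f m; first by have [] := rn_tail_out rn fm.
  have em : (f - m < m)%N by lia.
  by have [_] := rn_head_out rn em; rewrite subnKC.
have tl : Y (etail N2 f).
  have [fm|fm] := ltnP f m.
    by have [-> _ _] := rn_tail_out rn fm; have [h _ _] := eok f fm; rewrite /Y neq_ltn h.
  have em : (f - m < m)%N by lia.
  have [+ _ _] := rn_head_out rn em; rewrite subnKC // => ->.
  by have [_ h _] := eok _ em; rewrite /Y neq_ltn h.
move: tz => /=; rewrite hd XF tl /Y eqxx /=.
have -> : X (nodes N) = false by apply/negP => /XY; rewrite /Y eqxx.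
by move=> /=; lra.
Qed.

(** An unsaturated unit edge at a reachable node would make the sink reachable in the residual graph
    of [psi]. So the sign of the flow on the unit edges reveals the reachable nodes. *)
Lemma residual_flow f : (f < 2 * m)%N -> 0 < psi f <-> reach N phi (etail N2 f).
Proof.
move=> f2; have fN : (f < edges N2)%N by rewrite (rn_edges rn); lia.
split=> [p0|r].
  by apply: contrapT => nr; move: p0; rewrite unreached_flow0 ?ltxx.
have cap1 : ecap N2 f = 1 /\ ehead N2 f = sink N2.
  rewrite (rn_sink rn); have [fm|fm] := ltnP f m; first by have [] := rn_tail_out rn fm.
  have em : (f - m < m)%N by lia.
  by have [_] := rn_head_out rn em; rewrite subnKC.
have [c1 hs] := cap1; have sat : ecap N2 f <= psi f.
  rewrite leNgt; apply/negP => lt; apply: (max_flow_sink residual_network_ok mf).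
  by rewrite -hs; apply: reach_forward lt => //; apply: reach_residual.
by apply: lt_le_trans sat; rewrite c1 ltr01.
Qed.

End ResidualNetwork.

End Flows.

(** * The network of a descent step *)

Section SeqCount.
Variable A : eqType.
Implicit Types (p q : pred A) (s : seq A).

Lemma foldl_last (B : Type) p (f : A -> B) s t0 :
  foldl (fun t a => if p a then f a else t) t0 s = last t0 (map f (filter p s)).
Proof. by elim: s t0 => //= a s IH t0; case: ifP => /= _; rewrite IH. Qed.

Lemma count_le1 p s : uniq s -> {in s &, forall a b, p a -> p b -> a = b} ->
  (count p s <= 1)%N.
Proof.
rewrite -size_filter => us pu; have := filter_uniq p us.
case E: (filter p s) => [|a [|b t]] //; rewrite /= inE negb_or => /andP[/andP[ab _] _].
have ha : a \in filter p s by rewrite E mem_head.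
have hb : b \in filter p s by rewrite E !inE eqxx orbT.
move: ha hb; rewrite !mem_filter => /andP[pa sa] /andP[pb sb].
by case/eqP: ab; apply: pu.
Qed.

Lemma count_xor p q s :
  (count (fun a => p a (+) q a) s + 2 * count (predI p q) s = count p s + count q s)%N.
Proof. by elim: s => //= a s IH; case: (p a); case: (q a) => /=; lia. Qed.

Lemma count_split p q s :
  (count p s = count (fun a => p a && ~~ q a) s + count (fun a => p a && q a) s)%N.
Proof. by elim: s => //= a s ->; case: (p a); case: (q a) => /=; lia. Qed.

End SeqCount.

(** * One-sided slopes of the even interpolation *)

Section Slopes.
Variables (R : realType) (g : int -> R).
Hypotheses (mg : nondecreasingZ g) (cg : convexZ g).
Let G (n : nat) := bar g n%:Z.

(** Slopes of [bar g] on the two sides of [S]. The flag tells that both coordinates are movable,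
    which makes [S] even; around an odd [S] the two slopes agree. Truncated subtraction makes the
    left slope at [S = 0] vanish. *)
Definition slope_right (even : bool) (S : nat) : R :=
  if even then 2^-1 * (g (S + 2)%N%:Z - g S%:Z)
  else 2^-1 * (g (S + 1)%N%:Z - g (S - 1)%N%:Z).

Definition slope_left (even : bool) (S : nat) : R :=
  if even then 2^-1 * (g S%:Z - g (S - 2)%N%:Z)
  else 2^-1 * (g (S + 1)%N%:Z - g (S - 1)%N%:Z).

Lemma natZ_mono (a b : nat) : (a <= b)%N -> g a%:Z <= g b%:Z.
Proof.
elim: b => [|b IH]; first by rewrite leqn0 => /eqP ->.
rewrite leq_eqVlt => /orP[/eqP -> //|/IH h]; apply: le_trans h _.
by have := mg b.+1%:Z; rewrite -[b.+1]addn1 PoszD addrK.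
Qed.

Lemma slope_left_ge0 even S : 0 <= slope_left even S.
Proof.
by rewrite /slope_left; case: even; rewrite mulr_ge0 ?invr_ge0 ?subr_ge0 ?natZ_mono //; lia.
Qed.

Lemma slope_convex even S : slope_left even S <= slope_right even S.
Proof.
rewrite /slope_left /slope_right; case: even => //.
case: S => [|[|S]]; rewrite ?sub0n ?subrr ?addn2.
- by have := @natZ_mono 0 2 isT; lra.
- have := cg 1; rewrite (_ : 1 + 1 = 2%N%:Z) // (_ : 1 - 1 = 0%N%:Z) //.
  by have := @natZ_mono 2 3 isT; rewrite subn2 /= => *; lra.
- have := convexZ2 cg S%:Z; rewrite -!PoszD !addn2 addn4 subn2 /=; lra.
Qed.

(* [G] is linear on both sides of an even point up to distance 2, and around an
   odd point up to distance 1; at [S = 0] only the right side matters. *)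
Lemma slope_shift even S S' k m : (S' + m = S + k)%N ->
  (if even then ~~ odd S /\ (k + m <= 2)%N else (odd S /\ (k + m <= 1)%N) \/ k = 0 /\ m = 0)%N ->
  G S' = G S + slope_left even S * (k%:R - m%:R)
         + (slope_right even S - slope_left even S) * (k - m)%N%:R.
Proof.
rewrite /slope_left /slope_right; case: even => e; last first.
  case=> [[o km]|[k0 m0]]; last first.
    by have -> : S' = S by [lia]; rewrite k0 m0 !subrr !mulr0 !addr0.
  case: S e o => // S e /= o; rewrite addn1 subn1 /= subrr mul0r addr0 /G bar_odd //.
  case: k m e km => [|[|k]] [|[|m]] e km; try lia.
  - have -> : S' = S.+1 by lia.
    by rewrite bar_odd //= subrr mulr0 addr0.
  - have -> : S' = S by lia.
    by rewrite bar_even //=; lra.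
  - have -> : S' = S.+2 by lia.
    by rewrite bar_even ?negbK //=; lra.
case=> o km; rewrite /G (bar_even g o).
case: k m e km => [|[|[|k]]] [|[|[|m]]] e km; try lia;
  rewrite ?sub0n ?subn0 ?subnn ?mulr0 ?addr0.
- have -> : S' = S by lia.
  by rewrite bar_even //= !subrr !mulr0 ?addr0.
- case: S e o => [|[|S]] //= e; rewrite ?negbK => o; first lia.
  have -> : S' = S.+1 by lia.
  by rewrite bar_odd // subn2 /=; lra.
- case: S e o => [|[|S]] //= e; rewrite ?negbK => o; first lia.
  have -> : S' = S by lia.
  by rewrite bar_even // subn2 /=; lra.
- have -> : S' = S.+1 by lia.
  by rewrite bar_odd // addn2 /=; lra.
- have -> : S' = S by lia.
  by rewrite bar_even // subrr !mulr0 ?addr0.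
- have -> : S' = S.+2 by lia.
  by rewrite bar_even ?negbK // addn2 /=; lra.
Qed.

End Slopes.

Section Cuts.
Variable R : realType.
Implicit Types (es : seq (nat * nat * R)) (X : pred nat).

Definition edge_cut X (ed : nat * nat * R) : R := (X ed.1.1 && ~~ X ed.1.2)%:R * ed.2.

Definition cutL es X : R := \sum_(ed <- es) edge_cut X ed.

Lemma cutL_cat es es' X : cutL (es ++ es') X = cutL es X + cutL es' X.
Proof. exact: big_cat. Qed.

Lemma cutL_flatten ess X : cutL (flatten ess) X = \sum_(es <- ess) cutL es X.
Proof. exact: big_flatten. Qed.

End Cuts.

(** * Cut gadgets for the terms *)

Section Network.
Variables (R : realType) (T : tree) (nb : T -> seq T).
Hypothesis nbP : adjacency_lists nb.
Variables (e : bool) (x : nat -> T).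
Local Notation d := (@dist T).
Implicit Types X : pred nat.

(* Only the points of color [e] are free to move. Nodes 0 and 1 are the source
   and the sink, and [node i a] stands for moving [x i] to its [a]-th neighbor. *)
Definition movable i := black (x i) == e.
Definition deg i := if movable i then size (nb (x i)) else 0%N.
Definition node i a := (2 + \sum_(j < i) deg j + a)%N.
Definition lab i a := nth (x i) (nb (x i)) a.
Definition labels i := iota 0 (deg i).
Definition closer i c a := (d (lab i a) c < d (x i) c)%N.
(** At most one label leads towards [c]. If there is none, the value is the sink 1, which is never
    on the source side, so the node lies in a cut exactly when [near] is positive. *)
Definition closer_node i c :=
  foldl (fun t a => if closer i c a then node i a else t) 1%N (labels i).

Definition decode (X : pred nat) i : T :=
  if [seq a <- labels i | X (node i a)] is [:: a] then lab i a else x i.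
Definition legal (X : pred nat) i := (count (fun a => X (node i a)) (labels i) <= 1)%N.

Lemma labels_deg i a : a \in labels i -> movable i /\ (a < size (nb (x i)))%N.
Proof. by rewrite mem_iota /= /deg; case: ifP. Qed.

Lemma lab_adj i a : a \in labels i -> adj (x i) (lab i a).
Proof. by move/labels_deg => [_ h]; have [_ <-] := nbP (x i); apply: mem_nth. Qed.

Lemma lab_inj i : {in labels i &, injective (lab i)}.
Proof.
move=> a b /labels_deg[_ ha] /labels_deg[_ hb] /eqP.
by have [u _] := nbP (x i); rewrite nth_uniq // => /eqP.
Qed.

Lemma closer_inj i c : {in labels i &, forall a b, closer i c a -> closer i c b -> a = b}.
Proof.
move=> a b ha hb ca cb; apply: (lab_inj ha hb).
have aa := lab_adj ha; have ab := lab_adj hb.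
apply: (closer_unique (v := c) aa ab).
  by move: ca; rewrite /closer; have := dist_nbr c aa; lia.
by move: cb; rewrite /closer; have := dist_nbr c ab; lia.
Qed.

Lemma decodeP X i : (decode X i = x i) \/ (exists2 a, a \in labels i & decode X i = lab i a).
Proof.
rewrite /decode; case E: [seq a <- _ | _] => [|a [|]]; [by left| |by left].
right; exists a => //; have : a \in [seq a <- labels i | X (node i a)] by rewrite E mem_head.
by rewrite mem_filter => /andP[].
Qed.

Definition near X i c := count (fun a => X (node i a) && closer i c a) (labels i).
Definition far X i c := count (fun a => X (node i a) && ~~ closer i c a) (labels i).

Lemma near_le X i c : (near X i c <= count (closer i c) (labels i) <= 1)%N.
Proof.
apply/andP; split; first by apply: sub_count => a /= /andP[].
by apply: count_le1 (iota_uniq _ _) _; apply: closer_inj.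
Qed.

Lemma legalE X i c : legal X i = (far X i c + near X i c <= 1)%N.
Proof. by rewrite /legal (count_split _ (closer i c)). Qed.

Lemma closer_node_in X i c : ~~ X 1%N -> X (closer_node i c) = (0 < near X i c)%N.
Proof.
move=> X1; rewrite /closer_node foldl_last.
have -> : near X i c = count (fun a => X (node i a)) (filter (closer i c) (labels i)).
  by rewrite count_filter.
have /andP[_] := near_le X i c; rewrite -size_filter.
by case: (filter _ _) => [|a [|]] //= _; [rewrite (negbTE X1)|rewrite addn0; case: (X _)].
Qed.

(** [k] and [m] are the increase and the decrease of the distance to [c]. When several labels are
    selected, both vanish because [decode] stays; then [near <= 1] yields [near <= far], so the
    selection still pays for itself. *)
Lemma decode_dist X i c : exists k m,
  [/\ d (decode X i) c + m = d (x i) c + k,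
      (k + near X i c <= far X i c + m)%N,
      (k + m <= 1)%N, (k <= far X i c)%N /\ (m <= near X i c)%N &
      (far X i c + near X i c != 1 -> k = 0 /\ m = 0) /\
      (far X i c + near X i c <= 1 -> k = far X i c /\ m = near X i c)]%N.
Proof.
have sz : (far X i c + near X i c)%N = size [seq a <- labels i | X (node i a)].
  by rewrite size_filter (count_split _ (closer i c)).
have nle : (near X i c <= 1)%N by have /andP[h1 h2] := near_le X i c; apply: leq_trans h1 h2.
rewrite sz /decode; case E: [seq a <- _ | _] sz => [|a [|b s]] /= sz.
- by exists 0, 0; split; rewrite ?addn0 //; lia.
- have : a \in [seq a <- labels i | X (node i a)] by rewrite E mem_head.
  rewrite mem_filter => /andP[Xa ia]; have dn := dist_nbr c (lab_adj ia).
  have nE : near X i c = (closer i c a : nat).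
    rewrite /near; transitivity (count (closer i c) [seq a <- labels i | X (node i a)]).
      by rewrite count_filter; apply: eq_count => b /=; rewrite andbC.
    by rewrite E /= addn0.
  exists (far X i c), (near X i c).
  by move: sz nE; rewrite /closer; case: ltnP => /= h sz nE; split; lia.
- by exists 0, 0; split; rewrite ?addn0 //; lia.
Qed.

(** Not approaching [c] forfeits the reward [q], and moving away costs [q]. The kink [r] is paid for
    moving away unless [t], the closer node of the partner, is selected too, because then the two
    changes cancel. *)
Definition half_edges i c (t : nat) (q r : R) : seq (nat * nat * R) :=
  flatten [seq if closer i c a then [:: (0%N, node i a, q)]
               else [:: (node i a, 1%N, q); (node i a, t, r)] | a <- labels i].

Lemma half_edges_cut X i c t q r : X 0%N -> ~~ X 1%N ->
  cutL (half_edges i c t q r) X + q * (near X i c)%:R =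
  q * (count (closer i c) (labels i))%:R + (q + (~~ X t)%:R * r) * (far X i c)%:R.
Proof.
move=> X0 /negbTE X1; rewrite cutL_flatten big_map /near /far.
have E a : cutL (if closer i c a then [:: (0%N, node i a, q)]
      else [:: (node i a, 1%N, q); (node i a, t, r)]) X =
    if closer i c a then (~~ X (node i a))%:R * q else (X (node i a))%:R * (q + (~~ X t)%:R * r).
  case: ifP => _; rewrite /cutL !big_cons big_nil /edge_cut /= ?X0 ?X1 ?addr0 ?andbT //=.
  by rewrite -mulnb natrM; ring.
rewrite (eq_bigr _ (fun a _ => E a)).
elim: (labels i) => [|a s IH]; first by rewrite big_nil /= !mulr0 !addr0.
rewrite big_cons /= !natrD !mulrDr; move: IH.
case: (closer i c a); case: (X (node i a)) => /= IH;
  rewrite ?mul0r ?mul1r ?mulr0 ?mulr1 ?add0r; lra.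
Qed.

Section Pair.
Variable g : int -> R.
Hypotheses (mg : nondecreasingZ g) (cg : convexZ g).

Definition pair_edges i j ci cj (S : nat) : seq (nat * nat * R) :=
  let ev := movable i && movable j in
  let q := slope_left g ev S in let r := slope_right g ev S - q in
  half_edges i ci (closer_node j cj) q r ++ half_edges j cj (closer_node i ci) q r.

Definition pair_const i j ci cj (S : nat) : R :=
  slope_left g (movable i && movable j) S *
    (count (closer i ci) (labels i) + count (closer j cj) (labels j))%:R - bar g S%:Z.

(** The equation for [S'] says that the two moves change the argument independently. It covers both
    the sums of distances to fixed vertices and the distance between two moving points. *)
Lemma pair_edges_cut X i j ci cj S S' : X 0%N -> ~~ X 1%N ->
  (movable i && movable j -> ~~ odd S) -> (movable i (+) movable j -> odd S) ->
  (S' + d (x i) ci + d (x j) cj = S + d (decode X i) ci + d (decode X j) cj)%N ->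
  pair_const i j ci cj S + bar g S'%:Z <= cutL (pair_edges i j ci cj S) X /\
  (legal X i -> legal X j ->
   cutL (pair_edges i j ci cj S) X = pair_const i j ci cj S + bar g S'%:Z).
Proof.
move=> X0 X1 ev od eS; rewrite cutL_cat /pair_const.
have := half_edges_cut i ci (closer_node j cj) (slope_left g (movable i && movable j) S)
  (slope_right g (movable i && movable j) S - slope_left g (movable i && movable j) S) X0 X1.
have := half_edges_cut j cj (closer_node i ci) (slope_left g (movable i && movable j) S)
  (slope_right g (movable i && movable j) S - slope_left g (movable i && movable j) S) X0 X1.
rewrite !closer_node_in // ?lt0n ?negbK.
have [k1 [m1 [e1 b1 l1 [u1 v1] [w1 z1]]]] := decode_dist X i ci.
have [k2 [m2 [e2 b2 l2 [u2 v2] [w2 z2]]]] := decode_dist X j cj.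
have /andP[_ c1] := near_le X i ci; have /andP[_ c2] := near_le X j cj.
have eS' : (S' + (m1 + m2) = S + (k1 + k2))%N by lia.
have nofree l c : ~~ movable l -> far X l c = 0%N /\ near X l c = 0%N.
  by rewrite /far /near /labels /deg => /negbTE ->.
have cond : (if movable i && movable j then ~~ odd S /\ (k1 + k2 + (m1 + m2) <= 2)%N
    else (odd S /\ (k1 + k2 + (m1 + m2) <= 1)%N) \/ (k1 + k2 = 0 /\ m1 + m2 = 0)%N).
  move: ev od; case: (boolP (movable i)) => fi; case: (boolP (movable j)) => fj /= ev od.
  - by split; [exact: ev|lia].
  - by left; have [? ?] := nofree j cj fj; split; [exact: od|lia].
  - by left; have [? ?] := nofree i ci fi; split; [exact: od|lia].
  - by right; have [? ?] := nofree i ci fi; have [? ?] := nofree j cj fj; lia.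
rewrite (slope_shift g eS' cond).
set q := slope_left _ _ _; set p := slope_right _ _ _.
have q0 : 0 <= q by apply: slope_left_ge0.
have r0 : 0 <= p - q by rewrite subr_ge0; apply: slope_convex.
clear cond nofree eS' eS ev od e1 e2.
set A1 := count _ _; set A2 := count _ _.
set F1 := far X i ci in b1 u1 w1 z1 *; set F2 := far X j cj in b2 u2 w2 z2 *.
set N1 := near X i ci in b1 v1 w1 z1 c1 *; set N2 := near X j cj in b2 v2 w2 z2 c2 *.
move=> h2 h1.
(* The kink is due on the positive part of the total change; the cut charges it for the moves away
   that the partner does not compensate. The two amounts agree for legal selections. *)
have i1 : (k1 + k2 - (m1 + m2) <= (N2 == 0) * F1 + (N1 == 0) * F2)%N.
  by case: eqP => ?; case: eqP => ?; rewrite ?mul1n ?mul0n; lia.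
have i1r : (k1 + k2 - (m1 + m2))%N%:R <= (N2 == 0)%N%:R * F1%:R + (N1 == 0)%N%:R * F2%:R :> R.
  by rewrite -!natrM -natrD ler_nat.
have i2r : k1%:R + k2%:R + N1%:R + N2%:R <= F1%:R + F2%:R + m1%:R + m2%:R :> R.
  by rewrite -!natrD ler_nat; lia.
have p1 := mulr_ge0 r0 (_ : 0 <= (N2 == 0)%N%:R * F1%:R + (N1 == 0)%N%:R * F2%:R
   - (k1 + k2 - (m1 + m2))%N%:R); rewrite subr_ge0 in p1; have {}p1 := p1 i1r.
have p2 := mulr_ge0 q0 (_ : 0 <= F1%:R + F2%:R + m1%:R + m2%:R - (k1%:R + k2%:R + N1%:R + N2%:R)).
rewrite subr_ge0 in p2; have {}p2 := p2 i2r.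
rewrite !natrD; split.
  move: p1 p2 h1 h2; rewrite ?mulrBr ?mulrDr ?mulrBl ?mulrDl; lra.
rewrite (legalE X i ci) -/F1 -/N1 (legalE X j cj) -/F2 -/N2 => le1 le2.
have [ek1 em1] := z1 le1; have [ek2 em2] := z2 le2.
have i3 : ((N2 == 0) * F1 + (N1 == 0) * F2 = k1 + k2 - (m1 + m2))%N.
  rewrite ek1 em1 ek2 em2; move: le1 le2; clear.
  by case: F1 => [|[|?]]; case: N1 => [|[|?]]; case: F2 => [|[|?]]; case: N2 => [|[|?]].
have i3r : (N2 == 0)%N%:R * F1%:R + (N1 == 0)%N%:R * F2%:R = (k1 + k2 - (m1 + m2))%N%:R :> R.
  by rewrite -!natrM -natrD i3.
move: h1 h2; rewrite -i3r ek1 em1 ek2 em2.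
rewrite ?mulrBr ?mulrDr ?mulrBl ?mulrDl; lra.
Qed.

End Pair.

(** The direction of the edge follows the sign of the change, which keeps capacities nonnegative. *)
Definition f_edges i (f : T -> R) : seq (nat * nat * R) :=
  [seq if f (x i) <= f (lab i a) then (node i a, 1%N, f (lab i a) - f (x i))
       else (0%N, node i a, f (x i) - f (lab i a)) | a <- labels i].

Lemma convexT_nbr (f : T -> R) i : convexT f ->
  {in labels i &, forall a b, a != b -> 2 * f (x i) <= f (lab i a) + f (lab i b)}.
Proof.
move=> cf a b ha hb ab; have aa := lab_adj ha; have bb := lab_adj hb.
have p : path (@adj T) (lab i a) [:: x i; lab i b] by rewrite /= adj_sym aa bb.
have u : uniq [:: lab i a; x i; lab i b].
  rewrite /= !inE negb_or !andbT; apply/andP; split; last first.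
    by apply/eqP => E; move: bb; rewrite -E adj_irr.
  apply/andP; split; first by apply/eqP => E; move: aa; rewrite -E adj_irr.
  by apply: contra ab => /eqP /lab_inj -> //.
have := cf _ _ p u 0%N isT; rewrite /=; lra.
Qed.

(** At most one entry can be negative, and any other entry compensates it. Hence selecting several
    neighbors never beats staying for a convex function on the tree. *)
Lemma sum_pairs_ge0 (s : seq nat) (F : nat -> R) : uniq s -> (1 < size s)%N ->
  {in s &, forall a b, a != b -> 0 <= F a + F b} -> 0 <= \sum_(a <- s) F a.
Proof.
move=> us ss pos; have [/allP h|] := boolP (all (fun a => 0 <= F a) s).
  by rewrite big_seq; apply: sumr_ge0 => a /h.
rewrite -has_predC => /hasP[c cs /=]; rewrite -ltNge => c0.
rewrite (perm_big _ (perm_to_rem cs)) big_cons.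
have: size (rem c s) = (size s).-1 by rewrite size_rem.
have ur := rem_uniq c us.
have sub b : b \in rem c s -> b != c /\ b \in s.
  by rewrite mem_rem_uniq // inE => /andP[].
case: (rem c s) ur sub => [|b t] ur sub /= st; first by move: ss st; lia.
rewrite big_cons; have [bc bs] := sub b (mem_head _ _).
have := pos c b cs bs; rewrite eq_sym bc => /(_ isT) h.
have : 0 <= \sum_(a <- t) F a.
  rewrite big_seq; apply: sumr_ge0 => a at'.
  have [ac asx] := sub a (mem_behead (s := b :: t) at').
  have := pos c a cs asx; rewrite eq_sym ac => /(_ isT); lra.
lra.
Qed.

Variable n : nat.
(** A bound for all cuts, with equality only for legal ones. This is enough: a minimum cut is
    decoded through the bound, while the points it competes with are encoded by legal cuts. *)
Definition represents (es : seq (nat * nat * R)) (F : pred nat -> R) :=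
  exists K, forall X, X 0%N -> ~~ X 1%N -> K + F X <= cutL es X /\
    ((forall i, (i < n)%N -> legal X i) -> cutL es X = K + F X).

Lemma represents_cat es es' F F' : represents es F -> represents es' F' ->
  represents (es ++ es') (fun X => F X + F' X).
Proof.
move=> [K h] [K' h']; exists (K + K') => X X0 X1; rewrite cutL_cat.
have [h1 h2] := h X X0 X1; have [h1' h2'] := h' X X0 X1.
by split; [lra|move=> L; rewrite h2 // h2' //; lra].
Qed.

Lemma represents_flatten (I : eqType) (s : seq I) E (F : I -> pred nat -> R) :
  (forall t, t \in s -> represents (E t) (F t)) ->
  represents (flatten [seq E t | t <- s]) (fun X => \sum_(t <- s) F t X).
Proof.
elim: s => [|t s IH] h.
  by exists 0 => X _ _; rewrite /cutL !big_nil addr0.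
have r1 := h t (mem_head _ _).
have [|K hK] := represents_cat r1 (IH _).
  by move=> u us; apply: h; rewrite inE us orbT.
by exists K => X; rewrite big_cons; apply: hK.
Qed.

Lemma f_edges_cut i f : (i < n)%N -> convexT f ->
  represents (f_edges i f) (fun X => f (decode X i)).
Proof.
move=> ilt cf; pose neg a := (~~ (f (x i) <= f (lab i a)))%:R * (f (x i) - f (lab i a)).
(* The sum of the [neg a] is the cost of the cut that selects no label and stands for staying at
   [x i]. *)
exists (\sum_(a <- labels i) neg a - f (x i)) => X X0 /negbTE X1.
have E : cutL (f_edges i f) X = \sum_(a <- labels i) neg a +
    \sum_(a <- [seq a <- labels i | X (node i a)]) (f (lab i a) - f (x i)).
  rewrite /cutL big_map big_filter [X in _ + X]big_mkcond -big_split /=.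
  apply: eq_bigr => a _; rewrite /neg; case: ifP => _; rewrite /edge_cut /= ?X0 ?X1 /=.
    by case: ifP; rewrite /= ?mul0r ?mul1r ?add0r.
  by case: ifP; rewrite /= ?mul0r ?mul1r ?addr0; lra.
rewrite E /decode; set s := filter _ _.
have us : uniq s by apply: filter_uniq; apply: iota_uniq.
have pos : (1 < size s)%N -> 0 <= \sum_(a <- s) (f (lab i a) - f (x i)).
  move=> s2; apply: sum_pairs_ge0 => // a b; rewrite !mem_filter => /andP[_ ha] /andP[_ hb] ab.
  by have := convexT_nbr cf ha hb ab; lra.
split=> [|L].
  case: (s) pos => [|a [|b t]] pos; rewrite ?big_nil ?big_cons ?big_nil; try lra.
  by have := pos isT; rewrite !big_cons; lra.
have : (size s <= 1)%N by rewrite size_filter; apply: L.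
by case: (s) => [|a [|b t]] // _; rewrite ?big_cons ?big_nil; lra.
Qed.

(** The gadget for [x i = x j], where the moves are not independent: two equal moves keep the
    distance 0, two different ones give 2. For legal selections the distance is the size of the
    symmetric difference, which edges in both directions count; on 0, 1, 2 [bar g] is linear. *)
Definition star_edges i j (p : R) : seq (nat * nat * R) :=
  flatten [seq [:: (node i a, node j a, p); (node j a, node i a, p)] | a <- labels i].

Lemma star_edges_cut i j p X : x i = x j -> 0 <= p ->
  p * (d (decode X i) (decode X j))%:R <= cutL (star_edges i j p) X /\
  (legal X i -> legal X j ->
   cutL (star_edges i j p) X = p * (d (decode X i) (decode X j))%:R).
Proof.
move=> xij p0; have lij : labels j = labels i by rewrite /labels /deg /movable xij.
have bij a : lab j a = lab i a by rewrite /lab xij.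
pose Xi a := X (node i a); pose Xj a := X (node j a).
have E : cutL (star_edges i j p) X = p * (count (fun a => Xi a (+) Xj a) (labels i))%:R.
  rewrite cutL_flatten big_map; elim: (labels i) => [|a s IH]; first by rewrite big_nil mulr0.
  rewrite big_cons IH /= natrD mulrDr; congr (_ + _).
  rewrite /cutL !big_cons big_nil /edge_cut /= /Xi /Xj.
  by case: (X (node i a)); case: (X (node j a)) => /=; ring.
have key : (d (decode X i) (decode X j) <= count (fun a => Xi a (+) Xj a) (labels i))%N /\
   (legal X i -> legal X j ->
    count (fun a => Xi a (+) Xj a) (labels i) = d (decode X i) (decode X j)).
  have cx := count_xor Xi Xj (labels i).
  have ci : (count (predI Xi Xj) (labels i) <= count Xi (labels i))%N.
    by apply: sub_count => a /andP[].
  have cj : (count (predI Xi Xj) (labels i) <= count Xj (labels i))%N.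
    by apply: sub_count => a /andP[].
  rewrite /legal lij -/Xi -/Xj -!size_filter in cx ci cj *.
  rewrite /decode lij -/Xi -/Xj -xij.
  have mi a : a \in filter Xi (labels i) -> a \in labels i /\ Xi a.
    by rewrite mem_filter => /andP[].
  have mj a : a \in filter Xj (labels i) -> a \in labels i /\ Xj a.
    by rewrite mem_filter => /andP[].
  have both a b : filter Xi (labels i) = [:: a] -> filter Xj (labels i) = [:: b] ->
      size (filter (predI Xi Xj) (labels i)) = (a == b).
    move=> Ea Eb; have -> : filter (predI Xi Xj) (labels i) = filter Xj [:: a].
      by rewrite -Ea -filter_predI; apply: eq_filter => c /=; rewrite andbC.
    have [_ xb] := mj b ltac:(by rewrite Eb mem_head).
    have [la _] := mi a ltac:(by rewrite Ea mem_head).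
    have : (a \in filter Xj (labels i)) = (a == b) by rewrite Eb inE.
    by rewrite mem_filter la andbT /= => ->; case: (a == b).
  case Ea: (filter Xi (labels i)) cx ci both mi => [|a [|a' s]] cx ci both mi;
  case Eb: (filter Xj (labels i)) cj mj cx ci both => [|b [|b' t]] cj mj cx ci both;
  move: cx ci cj => /= cx ci cj.
  - by rewrite distuu; split => //; lia.
  - have [lb _] := mj b (mem_head _ _).
    by rewrite bij (dist_adj1 (lab_adj lb)); split => *; lia.
  - by rewrite distuu; split => *; lia.
  - have [la _] := mi a (mem_head _ _).
    by rewrite distC (dist_adj1 (lab_adj la)); split => *; lia.
  - have [la _] := mi a (mem_head _ _); have [lb _] := mj b (mem_head _ _).
    rewrite bij; have := both a b erefl erefl; case: eqP => [->|/eqP ab] /= h.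
      by rewrite distuu; split => *; lia.
    have -> : d (lab i a) (lab i b) = 2.
      have := dist_nbr (lab i b) (lab_adj la); rewrite (dist_adj1 (lab_adj lb)).
      case => // -[/esym /dist_eq0 /(lab_inj la lb)] E'; by rewrite E' eqxx in ab.
    by split => *; lia.
  - have [la _] := mi a (mem_head _ _).
    by rewrite distC (dist_adj1 (lab_adj la)); split => *; lia.
  - by rewrite distuu; split => *; lia.
  - have [lb _] := mj b (mem_head _ _).
    by rewrite bij (dist_adj1 (lab_adj lb)); split => *; lia.
  - by rewrite distuu; split => *; lia.
rewrite E; have [k1 k2] := key; split; first by apply: ler_wpM2l => //; rewrite ler_nat.
by move=> Li Lj; rewrite k2.
Qed.

Section GH.
Variable g : int -> R.
Hypotheses (mg : nondecreasingZ g) (cg : convexZ g).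

Definition g_edges i j : seq (nat * nat * R) :=
  if d (x i) (x j) == 0%N then star_edges i j (2^-1 * (g 2%N%:Z - g 0%N%:Z))
  else pair_edges g i j (x j) (x i) (d (x i) (x j)).

Lemma g_edges_cut i j : (i < n)%N -> (j < n)%N ->
  represents (g_edges i j) (fun X => bar g (d (decode X i) (decode X j))%:Z).
Proof.
move=> ilt jlt; rewrite /g_edges; case: eqP => [/dist_eq0 xij|d0].
  set p := 2^-1 * _; have p0 : 0 <= p by rewrite mulr_ge0 ?invr_ge0 ?subr_ge0 ?natZ_mono.
  exists (- g 0%N%:Z) => X X0 X1; have [h1 h2] := star_edges_cut X xij p0.
  have lin : bar g (d (decode X i) (decode X j))%:Z =
      g 0%N%:Z + p * (d (decode X i) (decode X j))%:R.
    have : (d (decode X i) (decode X j) <= 2)%N.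
      have di : (d (decode X i) (x i) <= 1)%N.
        by case: (decodeP X i) => [->|[a ia ->]]; rewrite ?distuu // distC (dist_adj1 (lab_adj ia)).
      have dj : (d (decode X j) (x j) <= 1)%N.
        by case: (decodeP X j) => [->|[a ia ->]]; rewrite ?distuu // distC (dist_adj1 (lab_adj ia)).
      have := dist_triangle (x i) (decode X i) (decode X j); rewrite {2}xij (distC (x j)); lia.
    case: (d _ _) => [|[|[|]]] // _.
    - by rewrite bar_even // mulr0 addr0.
    - by rewrite bar_odd // /p mulr1; lra.
    - by rewrite bar_even // /p; lra.
  rewrite lin; split; first by lra.
  by move=> L; rewrite h2; [lra|exact: L..].
exists (pair_const g i j (x j) (x i) (d (x i) (x j))) => X X0 X1.
have o := dist_odd (x i) (x j).
have ev : movable i && movable j -> ~~ odd (d (x i) (x j)).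
  by rewrite o /movable => /andP[/eqP -> /eqP ->]; rewrite addbb.
have od : movable i (+) movable j -> odd (d (x i) (x j)).
  by rewrite o /movable; case: (black _); case: (black _); case: (e).
have eS : (d (decode X i) (decode X j) + d (x i) (x j) + d (x j) (x i) =
    d (x i) (x j) + d (decode X i) (x j) + d (decode X j) (x i))%N.
  case: (decodeP X j) => [->|[b jb ej]]; first by rewrite !(distC _ (x j)); lia.
  case: (decodeP X i) => [->|[a ia ei]]; first by rewrite !(distC _ (x i)); lia.
  have [fi _] := labels_deg ia; have [fj _] := labels_deg jb.
  (* Both points move only if they have the same color, so their nonzero distance is even, and
     [dist_shift] applies. *)
  have d2 : (2 <= d (x i) (x j))%N.
    by move: d0 (ev ltac:(by rewrite fi fj)); case: (d _ _) => [|[]].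
  rewrite ej ei; have := dist_shift (lab_adj ia) (lab_adj jb) d2.
  by rewrite (distC (lab j b) (x i)) (distC (x j) (x i)); lia.
have [h1 h2] := pair_edges_cut mg cg X0 X1 ev od eS.
by split => // L; apply: h2; apply: L.
Qed.

Definition h_edges i j (z w : T) : seq (nat * nat * R) :=
  pair_edges g i j z w (d (x i) z + d (x j) w).

Lemma h_edges_cut i j z w : (i < n)%N -> (j < n)%N -> black z = black w ->
  represents (h_edges i j z w) (fun X => bar g (d (decode X i) z + d (decode X j) w)%N%:Z).
Proof.
move=> ilt jlt zw.
exists (pair_const g i j z w (d (x i) z + d (x j) w)) => X X0 X1.
have o : odd (d (x i) z + d (x j) w) = (black (x i) (+) black (x j)).
  by rewrite oddD !dist_odd zw; case: (black _); case: (black _); case: (black _).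
have ev : movable i && movable j -> ~~ odd (d (x i) z + d (x j) w).
  by rewrite o /movable => /andP[/eqP -> /eqP ->]; rewrite addbb.
have od : movable i (+) movable j -> odd (d (x i) z + d (x j) w).
  by rewrite o /movable; case: (black _); case: (black _); case: (e).
have eS : (d (decode X i) z + d (decode X j) w + d (x i) z + d (x j) w =
    d (x i) z + d (x j) w + d (decode X i) z + d (decode X j) w)%N by lia.
have [h1 h2] := pair_edges_cut mg cg X0 X1 ev od eS.
by split => // L; apply: h2; apply: L.
Qed.

End GH.

(** * The whole network and its minimal minimum cut *)

Variable P : sep2 R T n.
Hypothesis Pc : sep2_convex P.
Local Notation F := (sep2_relax P).

Definition to_fun (y : nat -> T) : 'I_n -> T := fun i => y i.

Definition net_edges : seq (nat * nat * R) :=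
  flatten [seq f_edges i (sf P i) | i : 'I_n <- enum (idxF P)] ++
  flatten [seq g_edges (sg P ij.1 ij.2) ij.1 ij.2 | ij <- enum (idxG P)] ++
  flatten [seq h_edges (sh P ij.1 ij.2) ij.1 ij.2 (sz P ij.1) (sw P ij.2)
          | ij <- enum (idxH P)].

Lemma net_edges_represents :
  represents net_edges (fun X => F (to_fun (decode X))).
Proof.
have [K hK] : represents net_edges (fun X =>
    \sum_(i <- enum (idxF P)) sf P i (decode X i) +
    (\sum_(ij <- enum (idxG P)) bar (sg P ij.1 ij.2) (d (decode X ij.1) (decode X ij.2))%:Z +
     \sum_(ij <- enum (idxH P)) bar (sh P ij.1 ij.2)
        (d (decode X ij.1) (sz P ij.1) + d (decode X ij.2) (sw P ij.2))%N%:Z)).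
  apply: represents_cat; last apply: represents_cat; apply: represents_flatten.
  - move=> i; rewrite mem_enum => iF; apply: (f_edges_cut (ltn_ord i)).
    exact: sf_convex.
  - move=> [i j]; rewrite mem_enum => ijG; have [mg cg] := sg_convex Pc ijG.
    exact: (g_edges_cut mg cg (ltn_ord i) (ltn_ord j)).
  - move=> [i j]; rewrite mem_enum => ijH; have [mh ch] := sh_convex Pc ijH.
    exact: (h_edges_cut mh ch (ltn_ord i) (ltn_ord j) (same_color Pc ijH)).
exists K => X X0 X1; have := hK X X0 X1.
by rewrite !big_enum /= /sep2_relax /sep2_sum -!addrA.
Qed.

Definition nnodes := node n 0.

Lemma node_le i j : (i < j)%N -> (node i (deg i) <= node j 0)%N.
Proof.
move=> ij; rewrite /node addn0 -addnA leq_add2l.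
have -> : (\sum_(l < i) deg l + deg i = \sum_(l < i.+1) deg l)%N by rewrite big_ord_recr.
by rewrite -!(big_mkord xpredT deg) [leqRHS](big_cat_nat (n := i.+1)) //= leq_addr.
Qed.

Lemma node_inj i j a b : (a < deg i)%N -> (b < deg j)%N -> node i a = node j b ->
  i = j /\ a = b.
Proof.
move=> ia jb eq; have [ij|ji|ij] := ltngtP i j.
- by have := node_le ij; move: eq; rewrite /node; lia.
- by have := node_le ji; move: eq; rewrite /node; lia.
- by subst j; split=> //; move: eq; rewrite /node; lia.
Qed.

Lemma node_lt i a : (i < n)%N -> (a < deg i)%N -> (node i a < nnodes)%N.
Proof. by move=> /node_le + ia; rewrite /nnodes /node; lia. Qed.

Definition encode (y : 'I_n -> T) : pred nat := fun v =>
  (v == 0%N) || `[< exists (i : 'I_n) a, [/\ (a < deg i)%N, v = node i a & y i = lab i a] >].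

Lemma encode0 y : encode y 0%N. Proof. by []. Qed.

Lemma encode1 y : ~~ encode y 1%N.
Proof. by rewrite /encode /=; apply/asboolPn => -[i [a [_ + _]]]. Qed.

Lemma encode_node y (i : 'I_n) a : (a < deg i)%N ->
  encode y (node i a) = (y i == lab i a).
Proof.
move=> ia; rewrite /encode /=; apply/asboolP/eqP => [[j [b [jb]]]|yi].
  by move=> /(node_inj ia jb)[/val_inj <- <-].
by exists i, a.
Qed.

Lemma labels_lt i a : (a \in labels i) = (a < deg i)%N.
Proof. by rewrite mem_iota. Qed.

Lemma encode_filter y (i : 'I_n) : [seq a <- labels i | encode y (node i a)] =
  [seq a <- labels i | y i == lab i a].
Proof. by apply: eq_in_filter => a; rewrite labels_lt; apply: encode_node. Qed.

Lemma encode_legal y (i : 'I_n) : legal (encode y) i.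
Proof.
rewrite /legal -size_filter encode_filter size_filter.
apply: count_le1 (iota_uniq _ _) _ => a b ha hb /eqP -> /eqP.
exact: (lab_inj ha hb).
Qed.

Lemma encodeK y (i : 'I_n) : nbhd e (to_fun x) y -> decode (encode y) i = y i.
Proof.
move=> yn; rewrite /decode encode_filter.
have := encode_legal y i; rewrite /legal -size_filter encode_filter.
case E: (filter _ _) => [|a [|]] // _; last first.
  have : a \in [seq a <- labels i | y i == lab i a] by rewrite E mem_head.
  by rewrite mem_filter => /andP[/eqP ->].
case: (yn i) => [-> //|[bx ad]]; exfalso.
have {}bx : black (x i) = e := bx.
have yin : y i \in nb (x i) by have [_ ->] := nbP (x i).
have : index (y i) (nb (x i)) \in [seq a <- labels i | y i == lab i a].
  by rewrite mem_filter /lab nth_index // eqxx labels_lt /deg /movable bx eqxx index_mem.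
by rewrite E.
Qed.

Lemma decode_nbhd X : nbhd e (to_fun x) (to_fun (decode X)).
Proof.
move=> i; rewrite /to_fun; case: (decodeP X i) => [->|[a ia ->]]; [by left|right].
have [/eqP fi _] := labels_deg ia; split=> //; exact: (lab_adj ia).
Qed.

Lemma decode_ext X X' i : (forall a, (a < deg i)%N -> X (node i a) = X' (node i a)) ->
  decode X i = decode X' i.
Proof.
move=> h; rewrite /decode; set s := filter _ _; set s' := filter _ _.
by have -> : s = s' by apply: eq_in_filter => a; rewrite labels_lt; apply: h.
Qed.

Lemma net_edges_ok ed : ed \in net_edges ->
  [/\ (ed.1.1 < nnodes)%N, (ed.1.2 < nnodes)%N & 0 <= ed.2].
Proof.
have n1 : (1 < nnodes)%N by rewrite /nnodes /node.
have n0 : (0 < nnodes)%N by apply: ltnW.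
have lt i a : (i < n)%N -> a \in labels i -> (node i a < nnodes)%N.
  by rewrite labels_lt; apply: node_lt.
have ct i c : (i < n)%N -> (closer_node i c < nnodes)%N.
  move=> ilt; rewrite /closer_node foldl_last.
  have : all (fun v => v < nnodes)%N
      [seq node i a | a <- [seq a <- labels i | closer i c a]].
    rewrite all_map; apply/allP => a; rewrite mem_filter => /andP[_ ia]; exact: lt.
  move: (map _ _) => s /allP h; have := mem_last 1%N s.
  by rewrite inE => /orP[/eqP -> //|/h].
have hf i c t q r : (i < n)%N -> (t < nnodes)%N -> 0 <= q -> 0 <= r ->
    ed \in half_edges i c t q r ->
    [/\ (ed.1.1 < nnodes)%N, (ed.1.2 < nnodes)%N & 0 <= ed.2].
  move=> ilt tlt q0 r0 /flatten_mapP[a ia]; case: ifP => _; rewrite !inE.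
    by move/eqP ->; split=> //; apply: lt.
  by move=> /orP[] /eqP ->; split=> //; apply: lt.
have pr g i j ci cj S : nondecreasingZ g -> convexZ g -> (i < n)%N -> (j < n)%N ->
    ed \in pair_edges g i j ci cj S ->
    [/\ (ed.1.1 < nnodes)%N, (ed.1.2 < nnodes)%N & 0 <= ed.2].
  move=> mg cg ilt jlt; have q0 := slope_left_ge0 mg (movable i && movable j) S.
  have r0 := slope_convex mg cg (movable i && movable j) S; rewrite -subr_ge0 in r0.
  by rewrite mem_cat => /orP[]; apply: hf => //; apply: ct.
rewrite !mem_cat => /or3P[/flatten_mapP[i]|/flatten_mapP[[i j]]|/flatten_mapP[[i j]]].
- move=> _ /mapP[a ia ->]; case: lerP => h /=; split=> //; try exact: lt.
    by rewrite subr_ge0.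
  by rewrite subr_ge0 ltW.
- rewrite mem_enum => ijG; have [mg cg] := sg_convex Pc ijG; rewrite /g_edges.
  case: eqP => [dij|_]; last exact: pr.
  have xij := dist_eq0 dij; move=> /flatten_mapP[a ia].
  have ja : a \in labels j by move: ia; rewrite /labels /deg /movable /= xij.
  rewrite !inE => /orP[] /eqP -> /=; split; rewrite ?lt //;
    by rewrite mulr_ge0 ?invr_ge0 ?subr_ge0 ?natZ_mono.
- rewrite mem_enum => ijH; have [mh ch] := sh_convex Pc ijH; exact: pr.
Qed.

Section Solution.
Variables (N : network R) (phi : nat -> R).
Hypotheses (Nnodes : nodes N = nnodes) (Nedges : edges N = size net_edges)
  (Nsource : source N = 0%N) (Nsink : sink N = 1%N).
Hypothesis Nedge : forall f, (f < size net_edges)%N ->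
  (etail N f, ehead N f, ecap N f) = nth (0%N, 0%N, 0) net_edges f.

Lemma phase_network_ok : network_ok N.
Proof.
have n1 : (1 < nnodes)%N by rewrite /nnodes /node.
split; rewrite ?Nnodes ?Nsource ?Nsink ?(ltnW n1) // => f; rewrite Nedges => fN.
have := net_edges_ok (mem_nth (0%N, 0%N, 0) fN); rewrite -Nedge //.
Qed.

Lemma phase_cut X : cut_value N X = cutL net_edges X.
Proof.
rewrite /cutL (big_nth (0%N, 0%N, 0)) big_mkord /cut_value Nedges.
by apply: eq_bigr => f _; rewrite -Nedge.
Qed.

Hypothesis mf : max_flow N phi.
Variable X : pred nat.
Hypothesis XP : forall v, (1 < v)%N -> (v < nnodes)%N -> X v <-> reach N phi v.
Let y := to_fun (decode X).

Lemma phase_decode (i : 'I_n) :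
  decode X i = decode (fun v => `[< reach N phi v >]) i.
Proof.
apply: decode_ext => a ia; have v1 : (1 < node i a)%N by rewrite /node; lia.
by apply/idP/asboolP => /(XP v1 (node_lt (ltn_ord i) ia)).
Qed.

Lemma phase_minimizes y' : nbhd e (to_fun x) y' -> F y <= F y'.
Proof.
move=> yn; have [K hK] := net_edges_represents; have ok := phase_network_ok.
have s0 := min_cut_source N phi; have t0 := min_cut_sink ok mf.
rewrite Nsource in s0; rewrite Nsink in t0.
have -> : y = to_fun (decode (fun v => `[< reach N phi v >])).
  by apply: funext => i; apply: phase_decode.
have [h1 _] := hK (fun v => `[< reach N phi v >]) s0 t0; have [_ h2] := hK _ (encode0 y') (encode1 y').
have {}h2 := h2 (fun i ilt => encode_legal y' (Ordinal ilt)).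
have yE : to_fun (decode (encode y')) = y' by apply: funext => i; apply: encodeK.
have := min_cut_le ok mf (Y := encode y'); rewrite Nsource Nsink !phase_cut.
move=> /(_ (encode0 y') (encode1 y')); rewrite h2 yE; lra.
Qed.

(** The cut consisting of the source alone decodes to [x]. If [x] is as good as [y], this cut is
    minimum, so by minimality no label node is reachable. *)
Lemma phase_strict : F (to_fun x) <= F y -> y = to_fun x.
Proof.
move=> le; have [K hK] := net_edges_represents; have ok := phase_network_ok.
have s0 := min_cut_source N phi; have t0 := min_cut_sink ok mf.
rewrite Nsource in s0; rewrite Nsink in t0.
have yE : y = to_fun (decode (fun v => `[< reach N phi v >])).
  by apply: funext => i; apply: phase_decode.
have [h1 _] := hK (fun v => `[< reach N phi v >]) s0 t0.
have fil (i : nat) : [seq a <- labels i | pred1 0%N (node i a)] = [::].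
  by rewrite (eq_filter (a2 := pred0)) ?filter_pred0 // => a; rewrite /node.
have [_ h2] := hK (pred1 0%N) isT isT.
have {}h2 := h2 (fun i _ => ltac:(by rewrite /legal -size_filter fil)).
have xE : to_fun (decode (pred1 0%N)) = to_fun x.
  by apply: funext => i; rewrite /to_fun /decode fil.
have sub v : reach N phi v -> v = 0%N.
  move=> rv; apply/eqP; apply: (min_cut_minimal ok mf (Y := pred1 0%N)) rv;
    rewrite ?Nsource ?Nsink //.
  by rewrite !phase_cut h2 xE; move: le; rewrite yE; lra.
rewrite -xE; apply: funext => i; rewrite /y /to_fun; apply: decode_ext => a ia.
have v1 : (1 < node i a)%N by rewrite /node; lia.
have -> : pred1 0%N (node i a) = false by move: v1; rewrite /=; case: (node i a).
by apply/negP => /(XP v1 (node_lt (ltn_ord i) ia)) /sub v0; move: v1; rewrite v0.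
Qed.

End Solution.

Section Sizes.
Variable k : nat.
Hypothesis degk : forall v, (size (nb v) <= k)%N.

Lemma deg_le i : (deg i <= k)%N.
Proof. by rewrite /deg; case: ifP. Qed.

Lemma nnodes_le : (nnodes <= 2 + n * k)%N.
Proof.
rewrite /nnodes /node addn0 leq_add2l.
have -> : (n * k = \sum_(i < n) k)%N by rewrite sum_nat_const card_ord.
by apply: leq_sum => i _; apply: deg_le.
Qed.

Lemma size_flatten_le (I : eqType) (s : seq I) (E : I -> seq (nat * nat * R)) c :
  (forall t, size (E t) <= c)%N -> (size (flatten [seq E t | t <- s]) <= size s * c)%N.
Proof.
move=> h; elim: s => //= t s IH; rewrite size_cat mulSn leq_add //.
Qed.

Lemma size_net_edges : (size net_edges <= 4 * (k * nterms P))%N.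
Proof.
have hf i c t q r : (size (half_edges i c t q r : seq (nat * nat * R)) <= 2 * k)%N.
  apply: leq_trans (size_flatten_le _ (c := 2) _) _; first by move=> a; case: ifP.
  by rewrite size_iota mulnC leq_mul2l deg_le orbT.
have pr g i j ci cj S :
    (size (pair_edges g i j ci cj S : seq (nat * nat * R)) <= 4 * k)%N.
  by rewrite size_cat; have := hf; move=> h; rewrite (leq_trans (leq_add (h _ _ _ _ _) (h _ _ _ _ _))) //; lia.
rewrite /net_edges !size_cat /nterms !cardE.
have h1 : (size (flatten [seq f_edges i (sf P i) | i : 'I_n <- enum (idxF P)])
    <= size (enum (idxF P)) * (4 * k))%N.
  apply: size_flatten_le => i; rewrite size_map size_iota.
  apply: leq_trans (deg_le i) _; exact: leq_pmull.
have h2 : (size (flatten [seq g_edges (sg P ij.1 ij.2) ij.1 ij.2 | ij <- enum (idxG P)])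
    <= size (enum (idxG P)) * (4 * k))%N.
  apply: size_flatten_le => ij; rewrite /g_edges; case: eqP => _; last exact: pr.
  apply: leq_trans (size_flatten_le _ (c := 2) _) _ => //.
  by rewrite size_iota mulnC; apply: leq_mul => //; apply: deg_le.
have h3 : (size (flatten [seq h_edges (sh P ij.1 ij.2) ij.1 ij.2 (sz P ij.1) (sw P ij.2)
          | ij <- enum (idxH P)]) <= size (enum (idxH P)) * (4 * k))%N.
  by apply: size_flatten_le => ij; apply: pr.
move: h1 h2 h3; set a := size (enum _); set b := size (enum _); set c := size (enum _).
by move=> h1 h2 h3; apply: leq_trans (leq_add h1 (leq_add h2 h3)) _; lia.
Qed.

End Sizes.

End Network.

(** * Reasoning about programs *)

Definition same_ty (s s' : ty) : bool :=
  match s, s' with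
  | TNat, TNat | TVtx, TVtx | TReal, TReal => true
  | _, _ => false
  end.

(** A syntactic frame condition at the level of whole arrays. For concrete code it is decided by
    computation. *)
Fixpoint writes (c : cmd) (s : ty) (a : nat) : bool :=
  match c with
  | Skip => false
  | @Assign s' a' _ _ => same_ty s' s && (a == a')
  | Seq c1 c2 => writes c1 s a || writes c2 s a
  | If _ c1 c2 => writes c1 s a || writes c2 s a
  | While _ c1 => writes c1 s a
  | MaxFlow _ _ _ _ _ _ _ aF => same_ty TReal s && (a == aF)
  end.

Fixpoint untouched (c : cmd) (s : ty) (ex : exp s) : bool :=
  match ex with
  | @Get s a i => ~~ writes c s a && untouched c i
  | NLit _ => true
  | NAdd u v => untouched c u && untouched c v
  | NSub u v => untouched c u && untouched c v
  | Deg u => untouched c u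
  | Dist u v => untouched c u && untouched c v
  | Nbr u v => untouched c u && untouched c v
  | RLit _ => true
  | RAdd u v => untouched c u && untouched c v
  | RSub u v => untouched c u && untouched c v
  | RScale _ u => untouched c u
  | FVal u v => untouched c u && untouched c v
  | GVal u v w => [&& untouched c u, untouched c v & untouched c w]
  | HVal u v w => [&& untouched c u, untouched c v & untouched c w]
  end.

Definition var (a : nat) : exp TNat := Get TNat a (NLit 0).
Definition vvar (a : nat) : exp TVtx := Get TVtx a (NLit 0).
Definition rvar (a : nat) : exp TReal := Get TReal a (NLit 0).
Definition set_var (s : ty) (a : nat) (ex : exp s) : cmd := Assign a (NLit 0) ex.

Definition For (ctr : nat) (bound : exp TNat) (body : cmd) : cmd :=
  Seq (set_var ctr (NLit 0))
    (While (NLt (var ctr) bound)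
       (Seq body (set_var ctr (NAdd (var ctr) (NLit 1))))).

(** An iteration costs the body [B], the test [b + 3], the counter update 6 and one unit for the
    loop; initialization costs 3 and the failing test [b + 4]. The constants are rounded up. *)
Definition for_cost (n B b : nat) : nat := (n * (B + b + 11) + b + 8)%N.

Section Logic.
Variables (R : realType) (V : Type) (O : oracles R V).
Implicit Types (st : state R V) (c : cmd).

Definition unchanged c st st' : Prop :=
  forall s a, ~~ writes c s a -> Defs.get st' s a = Defs.get st s a.

Lemma upd_other (A : Type) (mem : nat -> nat -> A) a i v a' :
  a' != a -> upd mem a i v a' = mem a'.
Proof. by rewrite /upd => /negbTE ->. Qed.

Lemma exec_unchanged c st st' t : exec O c st st' t -> unchanged c st st'.
Proof.
elim=> {c st st' t} //.
- move=> st s a i ex s' a' /=; case: s ex => ex; case: s' => //= h; exact: upd_other.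
- move=> c1 c2 st1 st2 st3 t1 t2 _ h1 _ h2 s a /=; rewrite negb_or => /andP[w1 w2].
  by rewrite h2 // h1.
- move=> b c1 c2 st st' t _ h s a /=; rewrite negb_or => /andP[w1 w2].
  by apply: h; case: eval_test.
- by move=> b c st1 st2 st3 t1 t2 _ _ h1 _ h2 s a /= w; rewrite h2 // h1.
- move=> en em es et aT aH aC aF st n' m' N s a; case: s => //= w.
  by rewrite (negbTE w).
Qed.

Lemma unchanged_trans c st1 st2 st3 :
  unchanged c st1 st2 -> unchanged c st2 st3 -> unchanged c st1 st3.
Proof. by move=> h1 h2 s a w; rewrite h2 // h1. Qed.

Lemma eval_untouched c st st' s (ex : exp s) :
  untouched c ex -> unchanged c st st' -> eval O st' ex = eval O st ex.
Proof.
move=> + un; elim: ex => //=.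
- by move=> s' a i IH /andP[w /IH ->]; rewrite un.
- by move=> u IHu v IHv /andP[/IHu -> /IHv ->].
- by move=> u IHu v IHv /andP[/IHu -> /IHv ->].
- by move=> u IHu /IHu ->.
- by move=> u IHu v IHv /andP[/IHu -> /IHv ->].
- by move=> u IHu v IHv /andP[/IHu -> /IHv ->].
- by move=> u IHu v IHv /andP[/IHu -> /IHv ->].
- by move=> u IHu v IHv /andP[/IHu -> /IHv ->].
- by move=> q u IHu /IHu ->.
- by move=> u IHu v IHv /andP[/IHu -> /IHv ->].
- by move=> u IHu v IHv w IHw /and3P[/IHu -> /IHv -> /IHw ->].
- by move=> u IHu v IHv w IHw /and3P[/IHu -> /IHv -> /IHw ->].
Qed.

(** A total-correctness triple with a time budget. *)
Definition run c st (B : nat) (Q : state R V -> Prop) : Prop :=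
  exists st' t, [/\ exec O c st st' t, (t <= B)%N & Q st'].

Lemma run_unchanged c st B Q : run c st B Q ->
  run c st B (fun st' => Q st' /\ unchanged c st st').
Proof.
by move=> [st' [t [h1 h2 h3]]]; exists st', t; split=> //; split=> //; apply: exec_unchanged h1.
Qed.

Lemma run_weaken c st B B' (Q Q' : state R V -> Prop) : run c st B Q -> (B <= B')%N ->
  (forall st', Q st' -> Q' st') -> run c st B' Q'.
Proof.
move=> [st' [t [h1 h2 h3]]] le h; exists st', t; split; [by []|exact: leq_trans le|exact: h].
Qed.

Lemma run_skip st B (Q : state R V -> Prop) : Q st -> run Skip st B Q.
Proof. by move=> h; exists st, 0%N; split=> //; apply: ExecSkip. Qed.

Lemma run_assign st B s a (i : exp TNat) (ex : exp s) (Q : state R V -> Prop) :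
  (exp_cost i + exp_cost ex < B)%N ->
  Q (set_cell st a (eval O st i) (eval O st ex)) -> run (Assign a i ex) st B Q.
Proof. by move=> h1 h2; do 2 eexists; split; [exact: ExecAssign|exact: h1|exact: h2]. Qed.

Lemma run_seq B1 B2 c1 c2 st B (Q : state R V -> Prop) :
  run c1 st B1 (fun st1 => run c2 st1 B2 Q) -> (B1 + B2 <= B)%N ->
  run (Seq c1 c2) st B Q.
Proof.
move=> [st1 [t1 [h1 l1 [st2 [t2 [h2 l2 q]]]]]] le.
exists st2, (t1 + t2)%N; split=> //; first exact: ExecSeq h1 h2.
exact: leq_trans (leq_add l1 l2) le.
Qed.

Lemma run_seqF B1 B2 c1 c2 st B (Q1 Q : state R V -> Prop) :
  run c1 st B1 Q1 -> (forall st1, Q1 st1 -> unchanged c1 st st1 -> run c2 st1 B2 Q) ->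
  (B1 + B2 <= B)%N -> run (Seq c1 c2) st B Q.
Proof.
move=> h1 h2 le; apply: run_seq le; apply: (run_weaken (run_unchanged h1)) => // st1 [].
exact: h2.
Qed.

Lemma run_assign_seq st B s a (i : exp TNat) (ex : exp s) c2 (Q : state R V -> Prop) :
  (exp_cost i + exp_cost ex < B)%N ->
  run c2 (set_cell st a (eval O st i) (eval O st ex)) (B - (exp_cost i + exp_cost ex).+1) Q ->
  run (Seq (Assign a i ex) c2) st B Q.
Proof.
move=> le h; apply: (run_seq (B1 := (exp_cost i + exp_cost ex).+1)
  (B2 := (B - (exp_cost i + exp_cost ex).+1)%N)); last by rewrite subnKC.
exact: run_assign.
Qed.

Lemma run_if B' b c1 c2 st B (Q : state R V -> Prop) :
  run (if eval_test O st b then c1 else c2) st B' Q ->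
  (test_cost b + B' < B)%N -> run (If b c1 c2) st B Q.
Proof.
move=> [st' [t [h1 l1 q]]] le; exists st', (test_cost b + t).+1; split=> //.
  exact: ExecIf.
by apply: leq_trans le; rewrite ltnS leq_add2l.
Qed.

(** The obligation on the body concerns the state after the counter update, which belongs to the
    loop and not to the body. *)
Lemma run_for B N ctr bound body st (Inv : nat -> state R V -> Prop) :
  ~~ writes body TNat ctr ->
  (forall st', unchanged (For ctr bound body) st st' -> eval O st' bound = N) ->
  Inv 0%N (set_cell (s := TNat) st ctr 0%N 0%N) ->
  (forall i st', (i < N)%N -> nat_mem st' ctr 0%N = i ->
     unchanged (For ctr bound body) st st' -> Inv i st' ->
     run body st' B (fun st'' => Inv i.+1 (set_cell (s := TNat) st'' ctr 0%N i.+1))) ->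
  run (For ctr bound body) st (for_cost N B (exp_cost bound)) (Inv N).
Proof.
move=> nw bnd inv0 step; rewrite /for_cost.
set test := NLt (var ctr) bound; set loop := While test (Seq body (set_var ctr (NAdd (var ctr) (NLit 1)))).
have un0 : unchanged (For ctr bound body) st (set_cell (s := TNat) st ctr 0%N 0%N).
  move=> s a; rewrite /= negb_or => /andP[w _]; case: s w => //= w.
  by apply: upd_other; move: w.
suff main k st' : forall i, (i + k = N)%N -> nat_mem st' ctr 0%N = i ->
    unchanged (For ctr bound body) st st' -> Inv i st' ->
    run loop st' (k * (B + exp_cost bound + 11) + (exp_cost bound + 4)) (Inv N).
  apply: (run_seq (B1 := 3) (B2 := (N * (B + exp_cost bound + 11) + (exp_cost bound + 4))%N));
    last lia.
  apply: run_assign => //=; apply: (main N _ 0%N) => //=.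
  by rewrite /upd !eqxx.
elim: k st' => [|k IH] st' i iN ci un inv.
  exists st', (test_cost test).+1; split; [|rewrite /=; lia|by rewrite -iN addn0].
  by apply: ExecWhileStop; rewrite /= bnd // ci -iN addn0 ltnn.
have iltN : (i < N)%N by lia.
have [st2 [t2 [h2 l2 q2]]] := run_unchanged (step i st' iltN ci un inv).
case: q2 => q2 un2; set st3 := set_cell _ _ _ _ in q2.
have c2 : nat_mem st2 ctr 0%N = i by rewrite -ci; have := un2 TNat ctr nw => /= ->.
have h3 : exec O (Seq body (set_var ctr (NAdd (var ctr) (NLit 1)))) st' st3 (t2 + 6)%N.
  apply: ExecSeq h2 _; have := @ExecAssign R V O st2 TNat ctr (NLit 0) (NAdd (var ctr) (NLit 1)).
  by rewrite /= c2 addn1.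
have un3 : unchanged (For ctr bound body) st st3.
  apply: unchanged_trans un _ => s a /=; rewrite !negb_or => /andP[w1 /andP[w2 _]].
  have := un2 s a w2; case: s w1 {w2} => //= w1 <-; exact: upd_other.
have c3 : nat_mem st3 ctr 0%N = i.+1 by rewrite /= /upd !eqxx.
have [st4 [t4 [h4 l4 q4]]] := IH st3 i.+1 ltac:(lia) c3 un3 q2.
exists st4, (test_cost test + (t2 + 6) + t4).+1; split=> //; last first.
  by move: l4; rewrite mulSn /=; lia.
by apply: ExecWhileLoop h3 h4; rewrite /= bnd // ci.
Qed.

End Logic.

(* Array [aN] holds the number of edges listed so far in the arrays [aT], [aH],
   [aC] of tails, heads and capacities. *)
Section Emit.
Variables (R : realType) (V : Type) (O : oracles R V) (aN aT aH aC : nat).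
Implicit Types st : state R V.

Definition edge_list st : seq (nat * nat * R) :=
  [seq (nat_mem st aT f, nat_mem st aH f, real_mem st aC f)
  | f <- iota 0 (nat_mem st aN 0)].

Definition emit (t h : exp TNat) (r : exp TReal) : cmd :=
  Seq (Assign aT (var aN) t) (Seq (Assign aH (var aN) h)
  (Seq (Assign aC (var aN) r) (set_var aN (NAdd (var aN) (NLit 1))))).

(** The arrays that [emit] writes do not depend on its arguments, so this instance represents all of
    them in frame conditions. *)
Let touched := emit (NLit 0) (NLit 0) (RLit 0).

Lemma edge_list_eq st st' : nat_mem st' aN = nat_mem st aN ->
  nat_mem st' aT = nat_mem st aT -> nat_mem st' aH = nat_mem st aH ->
  real_mem st' aC = real_mem st aC -> edge_list st' = edge_list st.
Proof. by rewrite /edge_list => -> -> -> ->. Qed.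

Lemma run_emit (t h : exp TNat) (r : exp TReal) st B :
  aT != aH -> aT != aN -> aH != aN ->
  untouched touched t -> untouched touched h -> untouched touched r ->
  (exp_cost t + exp_cost h + exp_cost r + 15 <= B)%N ->
  run O (emit t h r) st B (fun st' =>
    edge_list st' = rcons (edge_list st) (eval O st t, eval O st h, eval O st r)).
Proof.
move=> TH TN HN ut uh ur le; set m := nat_mem st aN 0%N.
have ne a b : a != b -> (b == a) = false by rewrite eq_sym => /negbTE.
apply: (run_seq (B1 := (exp_cost t).+3) (B2 := (exp_cost h + exp_cost r + 12)%N)); last by lia.
apply: run_assign => /=; first lia.
set st1 := State _ _ _.
have un1 : unchanged touched st st1.
  move=> s a /=; rewrite !negb_or => /andP[w _].
  by case: s w => //= w; apply: upd_other.
have N1 : nat_mem st1 aN 0%N = m by rewrite /= /upd (ne _ _ _ TN).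
apply: (run_seq (B1 := (exp_cost h).+3) (B2 := (exp_cost r + 9)%N)); last by lia.
apply: run_assign; rewrite /=; first lia.
rewrite -/st1 (eval_untouched O uh un1) [X in upd _ _ X](N1 : upd _ _ _ _ _ _ = _).
set st2 := State _ _ _.
have un2 : unchanged touched st st2.
  apply: unchanged_trans un1 _ => s a /=; rewrite !negb_or => /and3P[_ w _].
  by case: s w => //= w; apply: upd_other.
have N2 : nat_mem st2 aN 0%N = m by rewrite /= /upd (ne _ _ _ TN) (ne _ _ _ HN).
apply: (run_seq (B1 := (exp_cost r).+3) (B2 := 6)); last by lia.
apply: run_assign; rewrite /=; first lia.
rewrite -/st2 (eval_untouched O ur un2).
apply: run_assign => //=.
rewrite /edge_list /= /upd !eqxx /=.
rewrite ?(ne _ _ _ TH) ?(ne _ _ _ TN) ?(ne _ _ _ HN) ?(negbTE TN) ?(negbTE HN) ?(negbTE TH) /=.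
rewrite -/m addn1 -cats1 -[m.+1]addn1 iotaD add0n map_cat /= !eqxx /=; congr (_ ++ _).
apply/eq_in_map => f; rewrite mem_iota /= => fm.
by rewrite (ltn_eqF fm).
Qed.

Lemma run_for_emit B N ctr bound body st (E : nat -> seq (nat * nat * R)) :
  ~~ writes body TNat ctr -> ctr != aN -> ctr != aT -> ctr != aH ->
  (forall st', unchanged (For ctr bound body) st st' -> eval O st' bound = N) ->
  (forall i st', (i < N)%N -> nat_mem st' ctr 0%N = i ->
     unchanged (For ctr bound body) st st' ->
     run O body st' B (fun st'' => edge_list st'' = edge_list st' ++ E i)) ->
  run O (For ctr bound body) st (for_cost N B (exp_cost bound)) (fun st' =>
    edge_list st' = edge_list st ++ flatten [seq E i | i <- iota 0 N]).
Proof.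
move=> nw n1 n2 n3 bnd step.
have ctrE st' v : edge_list (set_cell (s := TNat) st' ctr 0%N v) = edge_list st'.
  by apply: edge_list_eq => //=; apply: upd_other; rewrite eq_sym.
apply: (run_for (Inv := fun i st' =>
    edge_list st' = edge_list st ++ flatten [seq E j | j <- iota 0 i])) => //.
  by rewrite ctrE cats0.
move=> i st' iN ci un inv; apply: (run_weaken (step i st' iN ci un)) => // st'' e.
rewrite ctrE e inv -catA; congr (_ ++ _).
by rewrite -[i.+1]addn1 iotaD map_cat flatten_cat /= cats0.
Qed.

End Emit.

(** * The algorithm *)

(* Array numbers of the scratch memory, first of naturals, then of vertices and
   of reals.  [xV], [zV] and [wV] are input arrays, as are arrays 0 to 5 of
   naturals. *)
Local Notation phaseN := 6%N.
Local Notation changedN := 7%N.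
Local Notation degN := 8%N.
Local Notation offN := 9%N.
Local Notation movN := 10%N.
Local Notation nodesN := 11%N.
Local Notation edgesN := 12%N.
Local Notation tailN := 13%N.
Local Notation headN := 14%N.
Local Notation outer := 15%N.
Local Notation inner := 16%N.
Local Notation iN := 17%N.
Local Notation jN := 18%N.
Local Notation distN := 19%N.
Local Notation nearN := 20%N.
Local Notation nearN' := 21%N.
Local Notation baseN := 22%N.
Local Notation boundN := 23%N.
Local Notation targetN := 24%N.
Local Notation baseN' := 25%N.
Local Notation edgesN2 := 26%N.
Local Notation tailN2 := 27%N.
Local Notation headN2 := 28%N.
Local Notation markN := 29%N.
Local Notation countN := 30%N.
Local Notation lastN := 31%N.
Local Notation xV := 0%N.
Local Notation zV := 1%N.
Local Notation wV := 2%N.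
Local Notation toV := 3%N.
Local Notation toV' := 4%N.
Local Notation pointV := 5%N.
Local Notation goalV := 6%N.
Local Notation capR := 0%N.
Local Notation flowR := 1%N.
Local Notation slopeR := 2%N.
Local Notation kinkR := 3%N.
Local Notation capR2 := 4%N.
Local Notation flowR2 := 5%N.
Local Notation bigR := 6%N.

Definition emit1 := emit edgesN tailN headN capR.
Definition emit2 := emit edgesN2 tailN2 headN2 capR2.

Definition load (b : bool) : cmd :=
  let i := if b then jN else iN in
  let c := if b then toV' else toV in
  Seq (set_var pointV (Get TVtx xV (var i)))
  (Seq (set_var goalV (vvar c))
  (Seq (set_var baseN (Get TNat offN (var i)))
       (set_var boundN (Get TNat degN (var i))))).

Definition closer_test : test :=
  NLt (Dist (Nbr (vvar pointV) (var inner)) (vvar goalV)) (Dist (vvar pointV) (vvar goalV)).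

Definition label_node : exp TNat := NAdd (var baseN) (var inner).

Definition near_code (b : bool) : cmd :=
  let dest := if b then nearN' else nearN in
  Seq (set_var dest (NLit 1))
    (For inner (var boundN) (If closer_test (set_var dest label_node) Skip)).

Definition half_code : cmd :=
  For inner (var boundN)
    (If closer_test (emit1 (NLit 0) label_node (rvar slopeR))
       (Seq (emit1 label_node (NLit 1) (rvar slopeR))
            (emit1 label_node (var targetN) (rvar kinkR)))).

Definition one_half : rat := 1 / 2.

(** The subtraction of the machine truncates in the same way as [slope_left], so small [S] need no
    extra case. *)
Definition slopes_code (val : exp TNat -> exp TReal) : cmd :=
  let S := var distN in
  let right_even := RScale one_half (RSub (val (NAdd S (NLit 2))) (val S)) in
  let left_even := RScale one_half (RSub (val S) (val (NSub S (NLit 2)))) in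
  let both_odd := RScale one_half (RSub (val (NAdd S (NLit 1))) (val (NSub S (NLit 1)))) in
  If (NLt (NLit 1) (NAdd (Get TNat movN (var iN)) (Get TNat movN (var jN))))
    (Seq (set_var slopeR left_even) (set_var kinkR (RSub right_even (rvar slopeR))))
    (Seq (set_var slopeR both_odd) (set_var kinkR (RSub both_odd (rvar slopeR)))).

(** Each half needs the closer node of the other coordinate as its target, so both nodes are
    computed before any edge is listed. *)
Definition pair_code (val : exp TNat -> exp TReal) : cmd :=
  Seq (slopes_code val)
  (Seq (load true) (Seq (near_code true)
  (Seq (load false) (Seq (near_code false)
  (Seq (set_var targetN (var nearN')) (Seq half_code
  (Seq (load true) (Seq (set_var targetN (var nearN)) half_code)))))))).

Definition f_code : cmd :=
  let here := FVal (var iN) (vvar pointV) in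
  let there := FVal (var iN) (Nbr (vvar pointV) (var inner)) in
  Seq (load false)
    (For inner (var boundN)
      (If (RLe here there) (emit1 label_node (NLit 1) (RSub there here))
                           (emit1 (NLit 0) label_node (RSub here there)))).

Definition gval := GVal (var iN) (var jN).
Definition hval := HVal (var iN) (var jN).

Definition star_code : cmd :=
  let other := NAdd (var baseN') (var inner) in
  Seq (set_var slopeR (RScale one_half (RSub (gval (NLit 2)) (gval (NLit 0)))))
  (Seq (load false)
  (Seq (set_var baseN' (Get TNat offN (var jN)))
  (For inner (var boundN)
    (Seq (emit1 label_node other (rvar slopeR)) (emit1 other label_node (rvar slopeR)))))).

Definition g_code : cmd :=
  Seq (set_var toV (Get TVtx xV (var jN)))
  (Seq (set_var toV' (Get TVtx xV (var iN)))
  (Seq (set_var distN (Dist (Get TVtx xV (var iN)) (Get TVtx xV (var jN))))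
    (If (NLt (NLit 0) (var distN)) (pair_code gval) star_code))).

Definition h_code : cmd :=
  Seq (set_var toV (Get TVtx zV (var iN)))
  (Seq (set_var toV' (Get TVtx wV (var jN)))
  (Seq (set_var distN (NAdd (Dist (Get TVtx xV (var iN)) (vvar toV))
                            (Dist (Get TVtx xV (var jN)) (vvar toV'))))
    (pair_code hval))).

Definition edges_code : cmd :=
  Seq (set_var edgesN (NLit 0))
  (Seq (For outer (Get TNat 0 (NLit 1))
     (Seq (set_var iN (Get TNat 1 (var outer))) f_code))
  (Seq (For outer (Get TNat 0 (NLit 2))
     (Seq (set_var iN (Get TNat 2 (var outer)))
     (Seq (set_var jN (Get TNat 3 (var outer))) g_code)))
  (For outer (Get TNat 0 (NLit 3))
     (Seq (set_var iN (Get TNat 4 (var outer)))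
     (Seq (set_var jN (Get TNat 5 (var outer))) h_code))))).

(** * Correctness and cost of listing the edges *)

Section EdgesCode.
Variables (R : realType) (T : tree) (nb : T -> seq T) (k : nat).
Hypothesis degk : forall v, (size (nb v) <= k)%N.
Variables (n : nat) (P : sep2 R T n) (solve : network R -> nat -> R)
  (MF : nat -> nat -> nat).
Variables (e : bool) (x : nat -> T).
Local Notation O := (sep2_oracles nb P solve MF).
Local Notation node := (node nb e x).
Local Notation deg := (deg nb e x).
Local Notation lab := (lab nb x).
Local Notation closer := (closer nb x).
Local Notation closer_node := (closer_node nb e x).
Local Notation half_edges := (half_edges nb e x).
Local Notation movable := (movable e x).
Implicit Types st : state R T.
Local Notation edge_list1 := (edge_list edgesN tailN headN capR).

Record ready st : Prop := {
  ready_x : vtx_mem st xV = x;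
  ready_z : forall i : 'I_n, vtx_mem st zV i = sz P i;
  ready_w : forall i : 'I_n, vtx_mem st wV i = sw P i;
  ready_deg : forall i : 'I_n, nat_mem st degN i = deg i;
  ready_off : forall i : 'I_n, nat_mem st offN i = node i 0;
  ready_mov : forall i : 'I_n, nat_mem st movN i = movable i }.

Definition keeps c := [&& ~~ writes c TVtx xV, ~~ writes c TVtx zV, ~~ writes c TVtx wV,
  ~~ writes c TNat degN, ~~ writes c TNat offN & ~~ writes c TNat movN].

Lemma ready_unchanged c st st' : keeps c -> unchanged c st st' -> ready st -> ready st'.
Proof.
case/and5P=> h1 h2 h3 h4 /andP[h5 h6] un [r1 r2 r3 r4 r5 r6]; split.
- by have := un TVtx xV h1 => /= ->.
- by have := un TVtx zV h2 => /= ->.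
- by have := un TVtx wV h3 => /= ->.
- by have := un TNat degN h4 => /= ->.
- by have := un TNat offN h5 => /= ->.
- by have := un TNat movN h6 => /= ->.
Qed.

Record loaded i c st : Prop := {
  loaded_point : vtx_mem st pointV 0 = x i;
  loaded_goal : vtx_mem st goalV 0 = c;
  loaded_base : nat_mem st baseN 0 = node i 0;
  loaded_bound : nat_mem st boundN 0 = deg i }.

Lemma run_load (b : bool) (i : 'I_n) c st : ready st ->
  nat_mem st (if b then jN else iN) 0 = i -> vtx_mem st (if b then toV' else toV) 0 = c ->
  run O (load b) st 30 (loaded i c).
Proof.
move=> rd ei ec.
apply: run_assign_seq; first by case: b {ei ec}.
apply: run_assign_seq; first by case: b {ei ec}.
apply: run_assign_seq; first by case: b {ei ec}.
apply: run_assign; first by case: b {ei ec}.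
case: b ei ec => /= ei ec; split => /=; rewrite /upd /= ?ei.
all: by [rewrite (ready_x rd)| exact: ec | apply: ready_off | apply: ready_deg].
Qed.

Lemma loaded_unchanged c' i c st st' :
  [&& ~~ writes c' TVtx pointV, ~~ writes c' TVtx goalV, ~~ writes c' TNat baseN &
      ~~ writes c' TNat boundN] ->
  unchanged c' st st' -> loaded i c st -> loaded i c st'.
Proof.
case/and4P=> h1 h2 h3 h4 un [l1 l2 l3 l4]; split.
- by have := un TVtx pointV h1 => /= ->.
- by have := un TVtx goalV h2 => /= ->.
- by have := un TNat baseN h3 => /= ->.
- by have := un TNat boundN h4 => /= ->.
Qed.

Lemma eval_closer i c a st : loaded i c st -> nat_mem st inner 0 = a ->
  eval_test O st closer_test = closer i c a.
Proof. by move=> [l1 l2 _ _] ha; rewrite /= l1 l2 ha. Qed.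

Lemma eval_label_node i c a st : loaded i c st -> nat_mem st inner 0 = a ->
  eval O st label_node = node i a.
Proof. by move=> [_ _ l3 _] ha; rewrite /= l3 ha /node addn0. Qed.

(** The numeric budgets here and below are generous upper bounds; only their independence of the
    instance matters. *)
Lemma run_near (b : bool) i c st : loaded i c st ->
  run O (near_code b) st (for_cost k 50 2 + 5) (fun st' =>
    nat_mem st' (if b then nearN' else nearN) 0 = closer_node i c).
Proof.
move=> ld; apply: (run_seqF (B1 := 5) (B2 := for_cost k 50 2)
  (Q1 := fun st1 => nat_mem st1 (if b then nearN' else nearN) 0 = 1%N)); last by lia.
  by apply: run_assign => //=; case: (b).
move=> st1 d1 un1; have ld1 : loaded i c st1 by apply: loaded_unchanged un1 ld; case: (b).
apply: (run_weaken (B := for_cost (deg i) 50 2) (Q := fun st' =>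
    nat_mem st' (if b then nearN' else nearN) 0 = foldl (fun t a =>
      if closer i c a then node i a else t) 1%N (iota 0 (deg i)))) => //; last first.
  by rewrite /for_cost; have := deg_le e x degk i; nia.
apply: (run_for (Inv := fun a st' => nat_mem st' (if b then nearN' else nearN) 0 =
    foldl (fun t a => if closer i c a then node i a else t) 1%N (iota 0 a))).
- by case: (b).
- move=> st' un; have [_ _ _ <-] := ld1.
  by have := un TNat boundN; case: (b) => /= -> .
- by move: d1; case: (b).
move=> a st' alt ha un inv.
have ld' : loaded i c st' by apply: loaded_unchanged un ld1; case: (b).
apply: (run_if (B' := 10)); last by [].
rewrite (eval_closer ld' ha) -[a.+1]addn1 iotaD foldl_cat /= -inv.
case: ifP => cl; last by apply: run_skip; case: (b).
apply: run_assign; first by [].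
rewrite (eval_label_node ld' ha); case: (b) => //=.
Qed.

Lemma run_emit1 (t h : exp TNat) (r : exp TReal) st B (ed : nat * nat * R) :
  [&& untouched (emit1 (NLit 0) (NLit 0) (RLit 0)) t,
      untouched (emit1 (NLit 0) (NLit 0) (RLit 0)) h &
      untouched (emit1 (NLit 0) (NLit 0) (RLit 0)) r] ->
  (exp_cost t + exp_cost h + exp_cost r + 15 <= B)%N ->
  (eval O st t, eval O st h, eval O st r) = ed ->
  run O (emit1 t h r) st B (fun st' => edge_list1 st' = edge_list1 st ++ [:: ed]).
Proof. by case/and3P=> ut uh ur le <-; rewrite cats1; apply: run_emit. Qed.

Lemma run_half i c (t : nat) (q r : R) st : loaded i c st ->
  nat_mem st targetN 0 = t -> real_mem st slopeR 0 = q -> real_mem st kinkR 0 = r ->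
  run O half_code st (for_cost k 100 2) (fun st' =>
    edge_list1 st' = edge_list1 st ++ half_edges i c t q r).
Proof.
move=> ld ht hq hr.
apply: (run_weaken (B := for_cost (deg i) 100 2) (Q := fun st' =>
    edge_list1 st' = edge_list1 st ++ half_edges i c t q r)) => //; last first.
  by rewrite /for_cost; have := deg_le e x degk i; nia.
apply: run_for_emit => //.
  by move=> st' un; have [_ _ _ <-] := ld; have := un TNat boundN isT => /= ->.
move=> a st' alt ha un.
have ld' : loaded i c st' by apply: loaded_unchanged un ld.
have ht' : nat_mem st' targetN 0 = t by rewrite -ht; have := un TNat targetN isT => /= ->.
have hq' : real_mem st' slopeR 0 = q by rewrite -hq; have := un TReal slopeR isT => /= ->.
have hr' : real_mem st' kinkR 0 = r by rewrite -hr; have := un TReal kinkR isT => /= ->.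
have le := eval_label_node ld' ha.
apply: (run_if (B' := 70)); last by [].
rewrite (eval_closer ld' ha); case: ifP => cl.
  by apply: run_emit1; rewrite // le /= hq'.
apply: (run_seqF (B1 := 35) (B2 := 35)); last by [].
  by apply: (run_emit1 (ed := (node i a, 1%N, q))) => //; rewrite le /= hq'.
move=> st2 e2 un2; rewrite -[[:: _; _]]cat1s catA -e2; apply: run_emit1 => //.
by rewrite !(eval_untouched O _ un2) // le /= hr' ht'.
Qed.

Lemma ratr_half (v : R) : ratr one_half * v = 2^-1 * v.
Proof. by rewrite /one_half fmorph_div rmorph1 rmorph_nat mul1r. Qed.

Section Pair.
Variables (i j : 'I_n) (g : int -> R) (val : exp TNat -> exp TReal).
Hypothesis valE : forall st (t : exp TNat), nat_mem st iN 0 = i -> nat_mem st jN 0 = j ->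
  eval O st (val t) = g (eval O st t)%:Z.
Hypothesis val_cost : forall t, (exp_cost (val t) <= exp_cost t + 5)%N.

Lemma run_slopes S st : ready st -> nat_mem st iN 0 = i -> nat_mem st jN 0 = j ->
  nat_mem st distN 0 = S ->
  run O (slopes_code val) st 100 (fun st' =>
    real_mem st' slopeR 0 = slope_left g (movable i && movable j) S /\
    real_mem st' kinkR 0 = slope_right g (movable i && movable j) S -
                           slope_left g (movable i && movable j) S).
Proof.
move=> rd hi hj hS; apply: (run_if (B' := 80)); last by [].
have -> : eval_test O st (NLt (NLit 1) (NAdd (Get TNat movN (var iN)) (Get TNat movN (var jN))))
    = movable i && movable j.
  by rewrite /= hi hj !ready_mov //; case: (movable i); case: (movable j).
have cS := val_cost (var distN); have cS2 := val_cost (NSub (var distN) (NLit 2)).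
have cS2' := val_cost (NAdd (var distN) (NLit 2)).
have cS1 := val_cost (NSub (var distN) (NLit 1)).
have cS1' := val_cost (NAdd (var distN) (NLit 1)).
rewrite /= in cS cS2 cS2' cS1 cS1'.
case: ifP => _.
  apply: (run_seq (B1 := 30) (B2 := 40)) => //; apply: run_assign; rewrite /=; first lia.
  apply: run_assign; rewrite /=; first lia.
  rewrite !valE //= !ratr_half /slope_left /slope_right /upd /= hS.
  by split.
apply: (run_seq (B1 := 30) (B2 := 40)) => //; apply: run_assign; rewrite /=; first lia.
apply: run_assign; rewrite /=; first lia.
rewrite !valE //= !ratr_half /slope_left /slope_right /upd /= hS.
by split.
Qed.

Record pair_ctx ci cj q r L st : Prop := {
  pc_ready : ready st;
  pc_i : nat_mem st iN 0 = i;
  pc_j : nat_mem st jN 0 = j;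
  pc_ci : vtx_mem st toV 0 = ci;
  pc_cj : vtx_mem st toV' 0 = cj;
  pc_q : real_mem st slopeR 0 = q;
  pc_r : real_mem st kinkR 0 = r;
  pc_list : edge_list1 st = L }.

Definition keeps_pair c := [&& keeps c, ~~ writes c TNat iN, ~~ writes c TNat jN,
  ~~ writes c TVtx toV, ~~ writes c TVtx toV', ~~ writes c TReal slopeR &
  ~~ writes c TReal kinkR].

Definition keeps_list c := [&& ~~ writes c TNat edgesN, ~~ writes c TNat tailN,
  ~~ writes c TNat headN & ~~ writes c TReal capR].

Lemma list_unchanged c st st' : unchanged c st st' -> keeps_list c ->
  edge_list1 st' = edge_list1 st.
Proof.
move=> un /and4P[h1 h2 h3 h4]; apply: edge_list_eq.
- exact: (un TNat edgesN h1).
- exact: (un TNat tailN h2).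
- exact: (un TNat headN h3).
- exact: (un TReal capR h4).
Qed.

Lemma pair_ctx_unchanged c ci cj q r L L' st st' : keeps_pair c ->
  unchanged c st st' -> edge_list1 st' = L' ->
  pair_ctx ci cj q r L st -> pair_ctx ci cj q r L' st'.
Proof.
case/and5P=> h0 h1 h2 h3 /and3P[h4 h5 h6] un eL [p0 p1 p2 p3 p4 p5 p6 p7]; split => //.
- exact: ready_unchanged un p0.
- by rewrite -p1; have := un TNat iN h1 => /= ->.
- by rewrite -p2; have := un TNat jN h2 => /= ->.
- by rewrite -p3; have := un TVtx toV h3 => /= ->.
- by rewrite -p4; have := un TVtx toV' h4 => /= ->.
- by rewrite -p5; have := un TReal slopeR h5 => /= ->.
- by rewrite -p6; have := un TReal kinkR h6 => /= ->.
Qed.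

Lemma pair_ctx_unchanged' c ci cj q r L st st' : unchanged c st st' ->
  keeps_pair c && keeps_list c -> pair_ctx ci cj q r L st -> pair_ctx ci cj q r L st'.
Proof.
move=> un /andP[h1 h2] p; apply: (pair_ctx_unchanged h1 un) (p).
by rewrite (list_unchanged un h2) (pc_list p).
Qed.

Lemma run_pair ci cj S st : ready st -> nat_mem st iN 0 = i -> nat_mem st jN 0 = j ->
  nat_mem st distN 0 = S -> vtx_mem st toV 0 = ci -> vtx_mem st toV' 0 = cj ->
  run O (pair_code val) st (4 * for_cost k 100 2 + 220) (fun st' =>
    edge_list1 st' = edge_list1 st ++ pair_edges nb e x g i j ci cj S).
Proof.
move=> rd hi hj hS hci hcj; set L := edge_list1 st.
set q := slope_left g (movable i && movable j) S.
set r := slope_right g (movable i && movable j) S - q.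
set F := for_cost k 100 2; have F50 : (for_cost k 50 2 <= F)%N by rewrite /F /for_cost; nia.
apply: (run_seqF (B1 := 100) (B2 := (4 * F + 120)%N) (run_slopes rd hi hj hS)); last lia.
move=> st1 [hq hr] un1.
have p1 : pair_ctx ci cj q r L st1.
  split => //; first exact: ready_unchanged un1 rd.
  - by rewrite -hi; have := un1 TNat iN isT => /= ->.
  - by rewrite -hj; have := un1 TNat jN isT => /= ->.
  - by rewrite -hci; have := un1 TVtx toV isT => /= ->.
  - by rewrite -hcj; have := un1 TVtx toV' isT => /= ->.
  - exact: (list_unchanged un1 isT).
apply: (run_seqF (B1 := 30) (B2 := (4 * F + 90)%N)
  (run_load (b := true) (pc_ready p1) (pc_j p1) (pc_cj p1))); last lia.
move=> st2 l2 un2; have {un2}p2 := pair_ctx_unchanged' un2 isT p1.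
apply: (run_seqF (B1 := (for_cost k 50 2 + 5)%N) (B2 := (3 * F + 85)%N) (run_near true l2));
  last lia.
move=> st3 n3 un3; have {un3}p3 := pair_ctx_unchanged' un3 isT p2.
apply: (run_seqF (B1 := 30) (B2 := (3 * F + 55)%N)
  (run_load (b := false) (pc_ready p3) (pc_i p3) (pc_ci p3))); last lia.
move=> st4 l4 un4; have p4 := pair_ctx_unchanged' un4 isT p3.
have n4 : nat_mem st4 nearN' 0 = closer_node j cj.
  by rewrite -n3; have := un4 TNat nearN' isT => /= ->.
apply: (run_seqF (B1 := (for_cost k 50 2 + 5)%N) (B2 := (2 * F + 50)%N) (run_near false l4));
  last lia.
move=> st5 n5 un5; have p5 := pair_ctx_unchanged' un5 isT p4.
have n5' : nat_mem st5 nearN' 0 = closer_node j cj.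
  by rewrite -n4; have := un5 TNat nearN' isT => /= ->.
have {}l4 : loaded i ci st5 by apply: loaded_unchanged un5 l4.
apply: (run_seqF (B1 := 5) (B2 := (2 * F + 45)%N)
  (Q1 := fun st6 => nat_mem st6 targetN 0 = closer_node j cj)); [|move=> st6 t6 un6|lia].
  by apply: run_assign => //=; rewrite n5'.
have p6 := pair_ctx_unchanged' un6 isT p5.
have l6 : loaded i ci st6 by apply: loaded_unchanged un6 l4.
have n6 : nat_mem st6 nearN 0 = closer_node i ci.
  by rewrite -n5; have := un6 TNat nearN isT => /= ->.
apply: (run_seqF (B1 := F) (B2 := (F + 45)%N) (run_half l6 t6 (pc_q p6) (pc_r p6))); last lia.
move=> st7; rewrite (pc_list p6) => e7 un7.
have p7 := pair_ctx_unchanged (c := half_code) isT un7 e7 p6.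
have n7 : nat_mem st7 nearN 0 = closer_node i ci.
  by rewrite -n6; have := un7 TNat nearN isT => /= ->.
apply: (run_seqF (B1 := 30) (B2 := (F + 10)%N)
  (run_load (b := true) (pc_ready p7) (pc_j p7) (pc_cj p7))); last lia.
move=> st8 l8 un8; have p8 := pair_ctx_unchanged' un8 isT p7.
have n8 : nat_mem st8 nearN 0 = closer_node i ci.
  by rewrite -n7; have := un8 TNat nearN isT => /= ->.
apply: (run_seqF (B1 := 5) (B2 := F)
  (Q1 := fun st9 => nat_mem st9 targetN 0 = closer_node i ci)); [|move=> st9 t9 un9|lia].
  by apply: run_assign => //=; rewrite n8.
have p9 := pair_ctx_unchanged' un9 isT p8.
have l9 : loaded j cj st9 by apply: loaded_unchanged un9 l8.
apply: (run_weaken (run_half l9 t9 (pc_q p9) (pc_r p9))) => // st10 ->.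
by rewrite (pc_list p9) -catA.
Qed.

End Pair.

Lemma of_E (i : 'I_n) v : of_ O i v = sf P i v.
Proof. by rewrite /= valK. Qed.

Lemma og_E (i j : 'I_n) t : og O i j t = sg P i j t%:Z.
Proof. by rewrite /= !valK. Qed.

Lemma oh_E (i j : 'I_n) t : oh O i j t = sh P i j t%:Z.
Proof. by rewrite /= !valK. Qed.

Lemma eval_RSub st (u v : exp TReal) : eval O st (RSub u v) = eval O st u - eval O st v.
Proof. by []. Qed.

Lemma eval_RScale st (q : rat) (u : exp TReal) : eval O st (RScale q u) = ratr q * eval O st u.
Proof. by []. Qed.

Lemma eval_RLe st (u v : exp TReal) : eval_test O st (RLe u v) = (eval O st u <= eval O st v).
Proof. by []. Qed.

Lemma gvalE (i j : 'I_n) st (t : exp TNat) : nat_mem st iN 0 = i -> nat_mem st jN 0 = j ->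
  eval O st (gval t) = sg P i j (eval O st t)%:Z.
Proof. by move=> hi hj; rewrite -og_E [LHS]/= hi hj. Qed.

Lemma hvalE (i j : 'I_n) st (t : exp TNat) : nat_mem st iN 0 = i -> nat_mem st jN 0 = j ->
  eval O st (hval t) = sh P i j (eval O st t)%:Z.
Proof. by move=> hi hj; rewrite -oh_E [LHS]/= hi hj. Qed.

Lemma run_f (i : 'I_n) st : ready st -> nat_mem st iN 0 = i ->
  run O f_code st (for_cost k 100 2 + 30) (fun st' =>
    edge_list1 st' = edge_list1 st ++ f_edges nb e x i (sf P i)).
Proof.
move=> rd hi.
apply: (run_seqF (B1 := 30) (B2 := for_cost k 100 2)
  (run_load (b := false) rd hi erefl)); last lia.
move=> st1 ld un1; rewrite -(list_unchanged un1 isT).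
have hi1 : nat_mem st1 iN 0 = i by rewrite -hi; have := un1 TNat iN isT => /= ->.
apply: (run_weaken (B := for_cost (deg i) 100 2) (Q := fun st' =>
    edge_list1 st' = edge_list1 st1 ++ flatten [seq [:: if sf P i (x i) <= sf P i (lab i a)
    then (node i a, 1%N, sf P i (lab i a) - sf P i (x i))
    else (0%N, node i a, sf P i (x i) - sf P i (lab i a))] | a <- iota 0 (deg i)])); first last.
- by move=> st' ->; rewrite flatten_map1.
- by rewrite /for_cost; have := deg_le e x degk i; nia.
apply: run_for_emit => //.
  by move=> st' un; have [_ _ _ <-] := ld; have := un TNat boundN isT => /= ->.
move=> a st' alt ha un.
have ld' : loaded i (vtx_mem st toV 0) st' by apply: loaded_unchanged un ld.
have hi' : nat_mem st' iN 0 = i by rewrite -hi1; have := un TNat iN isT => /= ->.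
have le := eval_label_node ld' ha.
have here : eval O st' (FVal (var iN) (vvar pointV)) = sf P i (x i).
  by rewrite -of_E [LHS]/= hi' (loaded_point ld').
have there : eval O st' (FVal (var iN) (Nbr (vvar pointV) (var inner))) = sf P i (lab i a).
  by rewrite -of_E [LHS]/= hi' (loaded_point ld') ha.
apply: (run_if (B' := 60)); last by [].
rewrite eval_RLe here there.
by case: ifP => h; apply: run_emit1; rewrite // eval_RSub le here there.
Qed.

Lemma run_star (i j : 'I_n) st : ready st -> nat_mem st iN 0 = i -> nat_mem st jN 0 = j ->
  run O star_code st (for_cost k 100 2 + 80) (fun st' => edge_list1 st' = edge_list1 st ++
    star_edges nb e x i j (2^-1 * (sg P i j 2%N%:Z - sg P i j 0%N%:Z))).
Proof.
move=> rd hi hj; set p := 2^-1 * _; set F := for_cost k 100 2.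
apply: (run_seqF (B1 := 30) (B2 := (F + 50)%N)
  (Q1 := fun st1 => real_mem st1 slopeR 0 = p)); [|move=> st1 e1 un1|lia].
  apply: run_assign => //.
  change (eval O st (RScale one_half (RSub (gval (NLit 2)) (gval (NLit 0)))) = p).
  by rewrite eval_RScale eval_RSub !(gvalE _ hi hj) ratr_half.
have rd1 : ready st1 by apply: ready_unchanged un1 rd.
have hi1 : nat_mem st1 iN 0 = i by rewrite -hi; have := un1 TNat iN isT => /= ->.
have hj1 : nat_mem st1 jN 0 = j by rewrite -hj; have := un1 TNat jN isT => /= ->.
have L1 := list_unchanged un1 isT.
apply: (run_seqF (B1 := 30) (B2 := (F + 20)%N) (run_load (b := false) rd1 hi1 erefl)); last lia.
move=> st2 ld2 un2; have rd2 : ready st2 by apply: ready_unchanged un2 rd1.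
have hj2 : nat_mem st2 jN 0 = j by rewrite -hj1; have := un2 TNat jN isT => /= ->.
have e2 : real_mem st2 slopeR 0 = p by rewrite -e1; have := un2 TReal slopeR isT => /= ->.
have L2 := list_unchanged un2 isT.
apply: (run_seqF (B1 := 10) (B2 := (F + 10)%N)
  (Q1 := fun st3 => nat_mem st3 baseN' 0 = node j 0)); [|move=> st3 b3 un3|lia].
  by apply: run_assign => //=; rewrite hj2 /upd /= ready_off.
have ld3 := loaded_unchanged (c' := set_var baseN' (Get TNat offN (var jN))) isT un3 ld2.
have e3 : real_mem st3 slopeR 0 = p by rewrite -e2; have := un3 TReal slopeR isT => /= ->.
have L3 := list_unchanged un3 isT.
rewrite -L1 -L2 -L3.
apply: (run_weaken (B := for_cost (deg i) 100 2) (Q := fun st' =>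
    edge_list1 st' = edge_list1 st3 ++ star_edges nb e x i j p)) => //; last first.
  by rewrite /F /for_cost; have := deg_le e x degk i; nia.
apply: run_for_emit => //.
  by move=> st' un; have [_ _ _ <-] := ld3; have := un TNat boundN isT => /= ->.
move=> a st' alt ha un.
have ld' : loaded i (vtx_mem st1 toV 0) st' by apply: loaded_unchanged un ld3.
have b' : nat_mem st' baseN' 0 = node j 0 by rewrite -b3; have := un TNat baseN' isT => /= ->.
have e' : real_mem st' slopeR 0 = p by rewrite -e3; have := un TReal slopeR isT => /= ->.
have le := eval_label_node ld' ha.
have oe : eval O st' (NAdd (var baseN') (var inner)) = node j a.
  by rewrite /= b' ha /node addn0.
have re : eval O st' (rvar slopeR) = p by [].
apply: (run_seqF (B1 := 50) (B2 := 50)); last by [].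
  by apply: (run_emit1 (ed := (node i a, node j a, p))); rewrite // le oe re.
move=> st4 e4 un4; rewrite -[[:: _; _]]cat1s catA -e4; apply: run_emit1 => //.
by rewrite !(eval_untouched O _ un4) // le oe re.
Qed.

Lemma gval_cost t : (exp_cost (gval t) <= exp_cost t + 5)%N.
Proof. by rewrite /=; lia. Qed.

Lemma hval_cost t : (exp_cost (hval t) <= exp_cost t + 5)%N.
Proof. by rewrite /=; lia. Qed.

Lemma run_g (i j : 'I_n) st : ready st -> nat_mem st iN 0 = i -> nat_mem st jN 0 = j ->
  run O g_code st (4 * for_cost k 100 2 + 300) (fun st' =>
    edge_list1 st' = edge_list1 st ++ g_edges nb e x (sg P i j) i j).
Proof.
move=> rd hi hj; set F := for_cost k 100 2.
apply: run_assign_seq; first by rewrite /=; lia.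
apply: run_assign_seq; first by rewrite /=; lia.
apply: run_assign_seq; first by rewrite /=; lia.
set st1 := set_cell _ _ _ _.
have rd1 : ready st1 by case: rd.
have L1 : edge_list1 st1 = edge_list1 st by apply: edge_list_eq.
have S1 : nat_mem st1 distN 0 = dist (x i) (x j) by rewrite /= /upd /= hi hj (ready_x rd).
have c1 : vtx_mem st1 toV 0 = x j by rewrite /= /upd /= hj (ready_x rd).
have c2 : vtx_mem st1 toV' 0 = x i by rewrite /= /upd /= hi (ready_x rd).
apply: (run_if (B' := (4 * F + 240)%N)); last by rewrite /=; lia.
have -> : eval_test O st1 (NLt (NLit 0) (var distN)) = (dist (x i) (x j) != 0%N).
  by rewrite -lt0n -S1.
rewrite -L1 /g_edges; case: eqP => d0 /=.
  by apply: (run_weaken (run_star rd1 hi hj)) => //; rewrite -/F; lia.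
apply: (run_weaken (run_pair (g := sg P i j) (fun st t => gvalE (i := i) (j := j) t)
  gval_cost rd1 hi hj S1 c1 c2)) => //.
by rewrite -/F; lia.
Qed.

Lemma run_h (i j : 'I_n) st : ready st -> nat_mem st iN 0 = i -> nat_mem st jN 0 = j ->
  run O h_code st (4 * for_cost k 100 2 + 300) (fun st' =>
    edge_list1 st' = edge_list1 st ++ h_edges nb e x (sh P i j) i j (sz P i) (sw P j)).
Proof.
move=> rd hi hj; set F := for_cost k 100 2.
apply: run_assign_seq; first by rewrite /=; lia.
apply: run_assign_seq; first by rewrite /=; lia.
apply: run_assign_seq; first by rewrite /=; lia.
set st1 := set_cell _ _ _ _.
have rd1 : ready st1 by case: rd.
have L1 : edge_list1 st1 = edge_list1 st by apply: edge_list_eq.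
have S1 : nat_mem st1 distN 0 = (dist (x i) (sz P i) + dist (x j) (sw P j))%N.
  by rewrite /= /upd /= hi hj (ready_x rd) (ready_z rd) (ready_w rd).
have c1 : vtx_mem st1 toV 0 = sz P i by rewrite /= /upd /= hi (ready_z rd).
have c2 : vtx_mem st1 toV' 0 = sw P j by rewrite /= /upd /= hj (ready_w rd).
rewrite -L1; apply: (run_weaken (run_pair (g := sh P i j)
  (fun st t => hvalE (i := i) (j := j) t) hval_cost rd1 hi hj S1 c1 c2)) => //.
by rewrite -/F /=; lia.
Qed.

Record terms st : Prop := {
  tm_n : nat_mem st 0 0 = n;
  tm_F : nat_mem st 0 1 = #|idxF P|;
  tm_G : nat_mem st 0 2 = #|idxG P|;
  tm_H : nat_mem st 0 3 = #|idxH P|;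
  tm_listF : forall f : 'I_#|idxF P|, nat_mem st 1 f = enum_val f;
  tm_listG : forall f : 'I_#|idxG P|,
    nat_mem st 2 f = (enum_val f).1 /\ nat_mem st 3 f = (enum_val f).2;
  tm_listH : forall f : 'I_#|idxH P|,
    nat_mem st 4 f = (enum_val f).1 /\ nat_mem st 5 f = (enum_val f).2 }.

Definition keeps_terms c := [&& ~~ writes c TNat 0, ~~ writes c TNat 1, ~~ writes c TNat 2,
  ~~ writes c TNat 3, ~~ writes c TNat 4 & ~~ writes c TNat 5].

Lemma terms_unchanged c st st' : keeps_terms c -> unchanged c st st' -> terms st -> terms st'.
Proof.
case/and5P=> h0 h1 h2 h3 /andP[h4 h5] un [t0 t1 t2 t3 t4 t5 t6].
have e0 := un TNat 0%N h0; have e1 := un TNat 1%N h1; have e2 := un TNat 2 h2.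
have e3 := un TNat 3 h3; have e4 := un TNat 4 h4; have e5 := un TNat 5 h5.
rewrite /= in e0 e1 e2 e3 e4 e5.
by split; rewrite ?e0 ?e1 ?e2 ?e3 ?e4 ?e5.
Qed.

Lemma run_for_terms (I : finType) (A : {set I}) (E : I -> seq (nat * nat * R)) b body B st :
  ~~ writes body TNat outer -> keeps body && keeps_terms body -> ready st -> terms st ->
  nat_mem st 0 b = #|A| ->
  (forall (f : 'I_#|A|) st', nat_mem st' outer 0 = f -> ready st' -> terms st' ->
    run O body st' B (fun st'' => edge_list1 st'' = edge_list1 st' ++ E (enum_val f))) ->
  run O (For outer (Get TNat 0 (NLit b)) body) st (for_cost #|A| B 2) (fun st' =>
    edge_list1 st' = edge_list1 st ++ flatten [seq E t | t <- enum A]).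
Proof.
move=> nw /andP[kb kt] rd tm hb step; set c := For _ _ _.
have kc : keeps c by move: kb; rewrite /keeps /c /= !orbF.
have ktc : keeps_terms c by move: kt; rewrite /keeps_terms /c /= !orbF.
rewrite -[[seq E t | t <- _]](mkseq_nth [::]) size_map -cardE /mkseq.
apply: (run_for_emit (E := nth [::] [seq E t | t <- enum A])) => //.
  move=> st' un /=; rewrite -hb; case/andP: ktc => h _.
  by have := un TNat 0%N h => /= ->.
move=> f st' flt hf un.
have -> : nth [::] [seq E t | t <- enum A] f = E (enum_val (Ordinal flt)).
  rewrite (nth_map (enum_val (Ordinal flt))); last by rewrite -cardE.
  by congr E; rewrite [RHS](enum_val_nth (enum_val (Ordinal flt))).
by apply: step => //; [exact: ready_unchanged un rd|exact: terms_unchanged un tm].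
Qed.

Lemma run_edges st : ready st -> terms st ->
  run O edges_code st (10 + for_cost #|idxF P| (for_cost k 100 2 + 50) 2
     + for_cost #|idxG P| (4 * for_cost k 100 2 + 320) 2
     + for_cost #|idxH P| (4 * for_cost k 100 2 + 320) 2) (fun st' =>
    edge_list1 st' = net_edges nb e x P).
Proof.
move=> rd tm; set F := for_cost k 100 2.
set fF := for_cost _ _ _; set fG := for_cost _ _ _; set fH := for_cost _ _ _.
apply: (run_seqF (B1 := 10) (B2 := (fF + (fG + fH))%N)
  (Q1 := fun st1 => edge_list1 st1 = [::])); [|move=> st1 e1 un1|lia].
  by apply: run_assign => //=; rewrite /edge_list /= /upd.
have rd1 : ready st1 by apply: ready_unchanged un1 rd.
have tm1 : terms st1 by apply: terms_unchanged un1 tm.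
apply: (run_seqF (B1 := fF) (B2 := (fG + fH)%N) (Q1 := fun st2 => edge_list1 st2 = _));
  [|move=> st2 e2 un2|lia].
  apply: (run_for_terms (A := idxF P) (E := fun i => f_edges nb e x i (sf P i))) => //.
    exact: tm_F tm1.
  move=> f st' hf rd' tm'.
  apply: run_assign_seq => /=; first lia.
  set st3 := State _ _ _; have rd3 : ready st3 by case: rd'.
  rewrite -(edge_list_eq (st := st') (st' := st3) (aN := edgesN)) //.
  have hi : nat_mem st3 iN 0 = enum_val f by rewrite /= hf /upd /= (tm_listF tm').
  by apply: (run_weaken (run_f rd3 hi)) => //; rewrite -/F; lia.
rewrite e1 cat0s in e2.
have rd2 : ready st2 by apply: ready_unchanged un2 rd1.
have tm2 : terms st2 by apply: terms_unchanged un2 tm1.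
apply: (run_seqF (B1 := fG) (B2 := fH) (Q1 := fun st3 => edge_list1 st3 = _));
  [|move=> st3 e3 un3|lia].
  apply: (run_for_terms (A := idxG P)
    (E := fun ij => g_edges nb e x (sg P ij.1 ij.2) ij.1 ij.2)) => //; first exact: tm_G tm2.
  move=> f st' hf rd' tm'.
  apply: run_assign_seq => /=; first lia.
  apply: run_assign_seq => /=; first lia.
  set st3 := State _ _ _; have rd3 : ready st3 by case: rd'.
  rewrite -(edge_list_eq (st := st') (st' := st3) (aN := edgesN)) //.
  have [l1 l2] := tm_listG tm' f.
  have hi : nat_mem st3 iN 0 = (enum_val f).1 by rewrite /= hf /upd /= l1.
  have hj : nat_mem st3 jN 0 = (enum_val f).2 by rewrite /= /upd /= hf l2.
  by apply: (run_weaken (run_g rd3 hi hj)) => //; rewrite -/F; lia.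
have rd3 : ready st3 by apply: ready_unchanged un3 rd2.
have tm3 : terms st3 by apply: terms_unchanged un3 tm2.
apply: (run_weaken (B := fH) (Q := fun st4 => edge_list1 st4 = edge_list1 st3 ++ _)) => //;
  last by move=> st4 ->; rewrite e3 e2 -catA.
apply: (run_for_terms (A := idxH P) (E := fun ij =>
  h_edges nb e x (sh P ij.1 ij.2) ij.1 ij.2 (sz P ij.1) (sw P ij.2))) => //; first exact: tm_H tm3.
move=> f st' hf rd' tm'.
apply: run_assign_seq => /=; first lia.
apply: run_assign_seq => /=; first lia.
set st4 := State _ _ _; have rd4 : ready st4 by case: rd'.
rewrite -(edge_list_eq (st := st') (st' := st4) (aN := edgesN)) //.
have [l1 l2] := tm_listH tm' f.
have hi : nat_mem st4 iN 0 = (enum_val f).1 by rewrite /= hf /upd /= l1.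
have hj : nat_mem st4 jN 0 = (enum_val f).2 by rewrite /= /upd /= hf l2.
by apply: (run_weaken (run_h rd4 hi hj)) => //; rewrite -/F; lia.
Qed.

End EdgesCode.

(** [nodesN] runs through the partial sums of the degrees, starting from 2 for the source and the
    sink, so its current value is the offset of the next coordinate. A Boolean and its negation are
    stored as [phaseN] and [1 - phaseN]. *)
Definition setup_loop : cmd :=
  let xi := Get TVtx xV (var outer) in
  For outer (Get TNat 0 (NLit 0))
    (Seq (If (IsBlack xi) (Assign movN (var outer) (var phaseN))
                          (Assign movN (var outer) (NSub (NLit 1) (var phaseN))))
    (Seq (Assign offN (var outer) (var nodesN))
    (Seq (If (NLt (NLit 0) (Get TNat movN (var outer)))
            (Assign degN (var outer) (Deg xi)) (Assign degN (var outer) (NLit 0)))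
    (set_var nodesN (NAdd (var nodesN) (Get TNat degN (var outer))))))).

Definition setup_code : cmd := Seq (set_var nodesN (NLit 2)) setup_loop.

(** The machine cannot convert naturals to reals, so the bound [1 + 2 m] in [bigR] is built by
    repeated addition. Nonresidual edges are listed with capacity 0, which keeps the four blocks of
    [m] edges at fixed positions. *)
Definition residual_code : cmd :=
  let t := Get TNat tailN (var outer) in
  let h := Get TNat headN (var outer) in
  let c := Get TReal capR (var outer) in
  let f := Get TReal flowR (var outer) in
  Seq (set_var bigR (RLit 1))
  (Seq (For outer (var edgesN) (set_var bigR (RAdd (rvar bigR) (RLit 2))))
  (Seq (set_var edgesN2 (NLit 0))
  (Seq (For outer (var edgesN) (emit2 t (var nodesN) (RLit 1)))
  (Seq (For outer (var edgesN) (emit2 h (var nodesN) (RLit 1)))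
  (Seq (For outer (var edgesN) (If (RLe c f) (emit2 t h (RLit 0)) (emit2 t h (rvar bigR))))
  (For outer (var edgesN) (If (RLe f (RLit 0)) (emit2 h t (RLit 0)) (emit2 h t (rvar bigR))))))))).

Definition mark_code (b : bool) : cmd :=
  For outer (var edgesN)
    (If (RLe (Get TReal flowR2 (if b then NAdd (var edgesN) (var outer) else var outer)) (RLit 0))
      Skip (Assign markN (Get TNat (if b then headN else tailN) (var outer)) (NLit 1))).

Definition reach_code : cmd :=
  Seq residual_code
  (Seq (MaxFlow (NAdd (var nodesN) (NLit 1)) (var edgesN2) (NLit 0) (var nodesN)
          tailN2 headN2 capR2 flowR2)
  (Seq (For outer (var nodesN) (Assign markN (var outer) (NLit 0)))
  (Seq (mark_code false) (mark_code true)))).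

Definition decode_code : cmd :=
  For outer (Get TNat 0 (NLit 0))
    (Seq (set_var countN (NLit 0))
    (Seq (For inner (Get TNat degN (var outer))
           (If (NLt (NLit 0) (Get TNat markN (NAdd (Get TNat offN (var outer)) (var inner))))
             (Seq (set_var countN (NAdd (var countN) (NLit 1))) (set_var lastN (var inner)))
             Skip))
      (If (NLt (NLit 0) (var countN)) (If (NLt (var countN) (NLit 2))
        (Seq (Assign xV (var outer) (Nbr (Get TVtx xV (var outer)) (var lastN)))
             (set_var changedN (NLit 1))) Skip) Skip))).

Definition phase_code : cmd :=
  Seq setup_code
  (Seq edges_code
  (Seq (MaxFlow (var nodesN) (var edgesN) (NLit 0) (NLit 1) tailN headN capR flowR)
  (Seq reach_code (Seq decode_code (set_var phaseN (NSub (NLit 1) (var phaseN))))))).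

(** * Correctness of the setup, of residual reachability and of decoding *)

Section Setup.
Variables (R : realType) (T : tree) (nb : T -> seq T).
Variables (n : nat) (P : sep2 R T n) (solve : network R -> nat -> R)
  (MF : nat -> nat -> nat) (e : bool) (x : nat -> T).
Local Notation O := (sep2_oracles nb P solve MF).
Local Notation node := (node nb e x).
Local Notation deg := (deg nb e x).
Local Notation movable := (movable e x).
Implicit Types st : state R T.

Lemma run_setup_loop st : vtx_mem st xV = x ->
  (forall i : 'I_n, vtx_mem st zV i = sz P i) ->
  (forall i : 'I_n, vtx_mem st wV i = sw P i) ->
  nat_mem st 0 0 = n -> nat_mem st phaseN 0 = e -> nat_mem st nodesN 0 = 2%N ->
  run O setup_loop st (for_cost n 60 2) (fun st' =>
    ready nb P e x st' /\ nat_mem st' nodesN 0 = node n 0).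
Proof.
move=> hx hz hw hn he h2.
pose Inv f st' := (forall i, (i < f)%N -> [/\ nat_mem st' degN i = deg i,
  nat_mem st' offN i = node i 0 & nat_mem st' movN i = movable i]) /\
  nat_mem st' nodesN 0 = node f 0.
suff h : run O setup_loop st (for_cost n 60 2) (Inv n).
  apply: (run_weaken (run_unchanged h)) => // st' [[{}h hnod] un]; split => //; split.
  - by rewrite -hx; have := un TVtx xV isT.
  - by move=> i; rewrite -hz; have := un TVtx zV isT => /= ->.
  - by move=> i; rewrite -hw; have := un TVtx wV isT => /= ->.
  - by move=> i; have [] := h i (ltn_ord i).
  - by move=> i; have [] := h i (ltn_ord i).
  - by move=> i; have [] := h i (ltn_ord i).
apply: run_for => //.
- by move=> st' un /=; have := un TNat 0%N isT => /= ->.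
- by split=> //=; rewrite /upd /= h2 /node big_ord0.
move=> f st' flt hf un [inv hnod].
have hx' : vtx_mem st' xV = x.
  by rewrite -hx; have := un TVtx xV isT.
have he' : nat_mem st' phaseN 0 = e.
  by rewrite -he; have := un TNat phaseN isT => /= ->.
pose st2 := set_cell (s := TNat) st' movN f (movable f).
apply: (run_seq (B1 := 20) (B2 := 40)); last by [].
apply: (run_if (B' := 10)) => //; rewrite /= hf hx'.
apply: (run_weaken (B := 10) (Q := fun st => st = st2)) => //.
  rewrite /st2 /movable; case: ifP => bx; apply: run_assign => //=;
    by rewrite hf he'; case: (e).
move=> _ ->; apply: run_assign_seq => //.
set st3 := set_cell _ _ _ _; have mov3 : nat_mem st3 movN f = movable f.
  by rewrite /= /upd /= eqxx.
have out3 : nat_mem st3 outer 0 = f by rewrite /= /upd /= hf.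
pose st4 := set_cell (s := TNat) st3 degN f (deg f).
apply: (run_seq (B1 := 20) (B2 := 15)); last by [].
apply: (run_if (B' := 10)); last by [].
have -> : eval_test O st3 (NLt (NLit 0) (Get TNat movN (var outer))) = movable f.
  change ((0 < nat_mem st3 movN (nat_mem st3 outer 0))%N = movable f).
  by rewrite out3 mov3; case: (movable f).
apply: (run_weaken (B := 10) (Q := fun st => st = st4)) => //.
  have eo : eval O st3 (var outer) = f := out3.
  have ed : eval O st3 (Deg (Get TVtx xV (var outer))) = size (nb (x f)).
    change (size (nb (vtx_mem st' xV (nat_mem st3 outer 0))) = size (nb (x f))).
    by rewrite /= /upd /= hf hx'.
  by rewrite /st4 /deg; case: ifP => bx; apply: run_assign; rewrite // eo // ed.
move=> _ ->; apply: run_assign => //.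
rewrite /Inv /= /upd /= hf hnod eqxx; split; last first.
  by rewrite /node !addn0 big_ord_recr /= addnA.
move=> i; rewrite ltnS leq_eqVlt => /orP[/eqP ->|ilt]; first by rewrite eqxx.
by rewrite (ltn_eqF ilt); have [] := inv i ilt.
Qed.

Lemma run_setup st : vtx_mem st xV = x -> (forall i : 'I_n, vtx_mem st zV i = sz P i) ->
  (forall i : 'I_n, vtx_mem st wV i = sw P i) ->
  nat_mem st 0 0 = n -> nat_mem st phaseN 0 = e ->
  run O setup_code st (for_cost n 60 2 + 10) (fun st' =>
    ready nb P e x st' /\ nat_mem st' nodesN 0 = node n 0).
Proof.
move=> hx hz hw hn he; apply: (run_seq (B1 := 10) (B2 := for_cost n 60 2)); last lia.
by apply: run_assign => //; apply: run_setup_loop.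
Qed.

End Setup.

Section Reach.
Variables (R : realType) (V : Type) (O : oracles R V).
Implicit Types st : state R V.
Local Notation edge_list2 := (edge_list edgesN2 tailN2 headN2 capR2).

Record same_net st0 big st : Prop := {
  sn_edges : nat_mem st edgesN = nat_mem st0 edgesN;
  sn_nodes : nat_mem st nodesN = nat_mem st0 nodesN;
  sn_tail : nat_mem st tailN = nat_mem st0 tailN;
  sn_head : nat_mem st headN = nat_mem st0 headN;
  sn_cap : real_mem st capR = real_mem st0 capR;
  sn_flow : real_mem st flowR = real_mem st0 flowR;
  sn_big : real_mem st bigR 0 = big }.

Definition keeps_net c := [&& ~~ writes c TNat edgesN, ~~ writes c TNat nodesN,
  ~~ writes c TNat tailN, ~~ writes c TNat headN, ~~ writes c TReal capR &
  ~~ writes c TReal flowR].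

Lemma same_net_unchanged c st0 big st st' : unchanged c st st' ->
  keeps_net c && ~~ writes c TReal bigR -> same_net st0 big st -> same_net st0 big st'.
Proof.
move=> un /andP[/and5P[h1 h2 h3 h4 /andP[h5 h6]] h7] [s1 s2 s3 s4 s5 s6 s7]; split.
- by rewrite -s1; exact: (un TNat edgesN h1).
- by rewrite -s2; exact: (un TNat nodesN h2).
- by rewrite -s3; exact: (un TNat tailN h3).
- by rewrite -s4; exact: (un TNat headN h4).
- by rewrite -s5; exact: (un TReal capR h5).
- by rewrite -s6; exact: (un TReal flowR h6).
- by rewrite -s7; have := un TReal bigR h7 => /= ->.
Qed.

Lemma run_residual_loop st0 big m body (ed : nat -> nat * nat * R) st :
  nat_mem st0 edgesN 0 = m ->
  keeps_net body && ~~ writes body TReal bigR -> ~~ writes body TNat outer ->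
  (forall f st', nat_mem st' outer 0 = f -> same_net st0 big st' ->
    run O body st' 60 (fun st'' => edge_list2 st'' = edge_list2 st' ++ [:: ed f])) ->
  same_net st0 big st ->
  run O (For outer (var edgesN) body) st (for_cost m 60 2) (fun st' =>
    edge_list2 st' = edge_list2 st ++ map ed (iota 0 m) /\ same_net st0 big st').
Proof.
move=> hm kb nw step sn.
have kf : keeps_net (For outer (var edgesN) body) &&
    ~~ writes (For outer (var edgesN) body) TReal bigR.
  by move: kb; rewrite /keeps_net /= !orbF.
suff h : run O (For outer (var edgesN) body) st (for_cost m 60 2) (fun st' =>
    edge_list2 st' = edge_list2 st ++ flatten [seq [:: ed f] | f <- iota 0 m]).
  apply: (run_weaken (run_unchanged h)) => // st' [e2 un].
  by rewrite e2 flatten_map1; split=> //; apply: same_net_unchanged un kf sn.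
apply: run_for_emit => //.
  by move=> st' un /=; rewrite (sn_edges (same_net_unchanged un kf sn)).
by move=> f st' flt hf un; apply: step => //; apply: same_net_unchanged un kf sn.
Qed.

Lemma run_emit2 (t h : exp TNat) (r : exp TReal) st B (ed : nat * nat * R) :
  [&& untouched (emit2 (NLit 0) (NLit 0) (RLit 0)) t,
      untouched (emit2 (NLit 0) (NLit 0) (RLit 0)) h &
      untouched (emit2 (NLit 0) (NLit 0) (RLit 0)) r] ->
  (exp_cost t + exp_cost h + exp_cost r + 15 <= B)%N ->
  (eval O st t, eval O st h, eval O st r) = ed ->
  run O (emit2 t h r) st B (fun st' => edge_list2 st' = edge_list2 st ++ [:: ed]).
Proof. by case/and3P=> ut uh ur le <-; rewrite cats1; apply: run_emit. Qed.

Lemma run_residual st m nn (tl hd : nat -> nat) (cp fl : nat -> R) (big := 1 + (2 * m)%:R) :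
  nat_mem st edgesN 0 = m -> nat_mem st nodesN 0 = nn -> nat_mem st tailN = tl ->
  nat_mem st headN = hd -> real_mem st capR = cp -> real_mem st flowR = fl ->
  run O residual_code st (5 * for_cost m 60 2 + 20) (fun st' =>
    edge_list2 st' = [seq (tl f, nn, 1) | f <- iota 0 m] ++
      ([seq (hd f, nn, 1) | f <- iota 0 m] ++
      ([seq (tl f, hd f, if fl f < cp f then big else 0) | f <- iota 0 m] ++
       [seq (hd f, tl f, if 0 < fl f then big else 0) | f <- iota 0 m])) /\
    same_net st big st').
Proof.
move=> hm hn ht hh hc hf; set F := for_cost m 60 2.
apply: (run_seqF (B1 := 10) (B2 := (5 * F + 10)%N)
  (Q1 := fun st1 => real_mem st1 bigR 0 = 1)); [|move=> st1 e1 un1|lia].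
  by apply: run_assign => //=; rewrite rmorph1.
have s1 : [/\ nat_mem st1 edgesN = nat_mem st edgesN, nat_mem st1 nodesN = nat_mem st nodesN,
    nat_mem st1 tailN = nat_mem st tailN, nat_mem st1 headN = nat_mem st headN &
    real_mem st1 capR = real_mem st capR /\ real_mem st1 flowR = real_mem st flowR].
  by split; [exact: (un1 TNat edgesN)|exact: (un1 TNat nodesN)|exact: (un1 TNat tailN)|
    exact: (un1 TNat headN)|split; [exact: (un1 TReal capR)|exact: (un1 TReal flowR)]].
apply: (run_seqF (B1 := F) (B2 := (4 * F + 10)%N)
  (Q1 := fun st2 => real_mem st2 bigR 0 = big)); [|move=> st2 e2 un2|lia].
  apply: (run_weaken (B := F) (Q := fun st2 => real_mem st2 bigR 0 = 1 + (2 * m)%:R)) => //.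
  apply: (run_for (Inv := fun f st2 => real_mem st2 bigR 0 = 1 + (2 * f)%:R)) => //.
  - by move=> st' un; have := un TNat edgesN isT => /= ->; case: s1 => -> _ _ _ _.
  - by rewrite /= e1 muln0 addr0.
  move=> f st' flt hf' un inv; apply: run_assign => //=.
  by rewrite inv /upd /= rmorph_nat mulnS natrD; ring.
have sn2 : same_net st big st2.
  case: s1 => a1 a2 a3 a4 [a5 a6]; split => //.
  - by rewrite -a1; exact: (un2 TNat edgesN).
  - by rewrite -a2; exact: (un2 TNat nodesN).
  - by rewrite -a3; exact: (un2 TNat tailN).
  - by rewrite -a4; exact: (un2 TNat headN).
  - by rewrite -a5; exact: (un2 TReal capR).
  - by rewrite -a6; exact: (un2 TReal flowR).
apply: (run_seqF (B1 := 10) (B2 := (4 * F)%N)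
  (Q1 := fun st3 => edge_list2 st3 = [::])); [|move=> st3 e3 un3|lia].
  by apply: run_assign => //=; rewrite /edge_list /= /upd.
have sn3 := same_net_unchanged un3 isT sn2.
apply: (run_seq (B1 := F) (B2 := (3 * F)%N)); last lia.
apply: (run_weaken (run_residual_loop (ed := fun f => (tl f, nn, 1)) hm _ _ _ sn3)) => //.
  move=> f st' ho sn; apply: run_emit2 => //=.
  by rewrite ho (sn_tail sn) (sn_nodes sn) ht hn rmorph1.
move=> st4 [e4 sn4]; rewrite e3 cat0s in e4.
apply: (run_seq (B1 := F) (B2 := (2 * F)%N)); last lia.
apply: (run_weaken (run_residual_loop (ed := fun f => (hd f, nn, 1)) hm _ _ _ sn4)) => //.
  move=> f st' ho sn; apply: run_emit2 => //=.
  by rewrite ho (sn_head sn) (sn_nodes sn) hh hn rmorph1.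
move=> st5 [e5 sn5]; rewrite e4 in e5.
apply: (run_seq (B1 := F) (B2 := F)); last lia.
apply: (run_weaken (run_residual_loop
  (ed := fun f => (tl f, hd f, if fl f < cp f then big else 0)) hm _ _ _ sn5)) => //.
  move=> f st' ho sn; apply: (run_if (B' := 40)) => //.
  rewrite [eval_test _ _ _]/= ho (sn_cap sn) (sn_flow sn) hc hf leNgt.
  case: ltP => lt /=; apply: run_emit2 => //=;
    by rewrite ho (sn_tail sn) (sn_head sn) ht hh ?rmorph0 ?(sn_big sn).
move=> st6 [e6 sn6]; rewrite e5 in e6.
apply: (run_weaken (run_residual_loop
  (ed := fun f => (hd f, tl f, if 0 < fl f then big else 0)) hm _ _ _ sn6)) => //.
  move=> f st' ho sn; apply: (run_if (B' := 40)) => //.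
  rewrite [eval_test _ _ _]/= ho (sn_flow sn) hf rmorph0 leNgt.
  case: ltP => lt /=; apply: run_emit2 => //=;
    by rewrite ho (sn_tail sn) (sn_head sn) ht hh ?rmorph0 ?(sn_big sn).
by move=> st7 [e7 sn7]; split=> //; rewrite e7 e6 -!catA.
Qed.

Lemma run_max_flow (en em es et : exp TNat) aT aH aC aF st B
    (Q : state R V -> Prop) (N := Network (eval O st en) (eval O st em) (eval O st es)
      (eval O st et) (nat_mem st aT) (nat_mem st aH) (real_mem st aC)) :
  (exp_cost en + exp_cost em + exp_cost es + exp_cost et
    + otime O (nodes N) (edges N) < B)%N ->
  Q (write_flow st aF (edges N) (oflow O N)) ->
  run O (MaxFlow en em es et aT aH aC aF) st B Q.
Proof.
move=> le q; do 2 eexists; split; [exact: ExecMaxFlow|exact: le|exact: q].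
Qed.

Lemma run_marks (b : bool) st (S : nat -> Prop) nn m
    (ix := fun f => if b then (m + f)%N else f) (nd := nat_mem st (if b then headN else tailN)) :
  nat_mem st edgesN 0 = m -> (forall v, (v < nn)%N -> (0 < nat_mem st markN v)%N <-> S v) ->
  run O (mark_code b) st (for_cost m 60 2) (fun st' =>
    forall v, (v < nn)%N -> (0 < nat_mem st' markN v)%N <->
      S v \/ exists2 f, (f < m)%N & 0 < real_mem st flowR2 (ix f) /\ nd f = v).
Proof.
move=> hm init.
apply: (run_for (Inv := fun g st' => forall v, (v < nn)%N -> (0 < nat_mem st' markN v)%N <->
      S v \/ exists2 f, (f < g)%N & 0 < real_mem st flowR2 (ix f) /\ nd f = v)).
- by case: (b).
- by move=> st' un /=; have := un TNat edgesN => /= ->; case: (b).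
- move=> v vn /=; rewrite /upd /=; split; first by move/(init v vn); left.
  by case=> [/(init v vn)|[]].
move=> g st' glt hg un inv.
have eix : eval O st' (if b then NAdd (var edgesN) (var outer) else var outer) = ix g.
  rewrite /ix; case: (b) => /=; rewrite hg //.
  by have := un TNat edgesN => /= ->; rewrite ?hm //; case: (b).
have efl : real_mem st' flowR2 = real_mem st flowR2 by apply: (un TReal flowR2); case: (b).
have end' : nat_mem st' (if b then headN else tailN) = nd.
  by rewrite /nd; case: (b) un => un; [exact: (un TNat headN)|exact: (un TNat tailN)].
apply: (run_if (B' := 10)); last by case: (b).
have -> : eval_test O st' (RLe (Get TReal flowR2 (if b then NAdd (var edgesN) (var outer)
    else var outer)) (RLit 0)) = (real_mem st flowR2 (ix g) <= 0).
  change ((real_mem st' flowR2 (eval O st' (if b then NAdd (var edgesN) (var outer)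
    else var outer)) <= ratr 0) = (real_mem st flowR2 (ix g) <= 0)).
  by rewrite eix efl rmorph0.
case: lerP => fl.
  apply: run_skip => v vn /=; rewrite /upd /=; split.
    move/(inv v vn) => [|[f fg h]]; [by left|right]; exists f => //; exact: ltnW.
  case=> [h|[f fg' [h1 h2]]]; apply/(inv v vn); first by left.
  move: fg'; rewrite ltnS leq_eqVlt => /orP[/eqP fg|fg]; last by right; exists f.
  by move: h1; rewrite fg ltNge fl.
apply: run_assign => // v vn.
have ev : eval O st' (Get TNat (if b then headN else tailN) (var outer)) = nd g.
  change (nat_mem st' (if b then headN else tailN) (nat_mem st' outer 0) = nd g).
  by rewrite end' hg.
rewrite ev /= /upd /=; case: (eqVneq v (nd g)) => [->|ne].
  by split=> // _; right; exists g.
split.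
  move/(inv v vn) => [|[f fg h]]; [by left|right]; exists f => //; exact: ltnW.
case=> [h|[f fg' [h1 h2]]]; apply/(inv v vn); first by left.
move: fg'; rewrite ltnS leq_eqVlt => /orP[/eqP fg|fg]; last by right; exists f.
by case/eqP: ne; rewrite -fg h2.
Qed.

End Reach.

Section ReachSpec.
Variables (R : realType) (V : Type) (O : oracles R V).
Implicit Types st : state R V.

Lemma size_edge_list st aN aT aH aC : size (edge_list aN aT aH aC st) = nat_mem st aN 0.
Proof. by rewrite size_map size_iota. Qed.

Lemma nth_edge_list st aN aT aH aC d f : (f < nat_mem st aN 0)%N ->
  nth d (edge_list aN aT aH aC st) f = (nat_mem st aT f, nat_mem st aH f, real_mem st aC f).
Proof. by move=> h; rewrite (nth_map 0%N) ?size_iota // nth_iota. Qed.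

(** Marking the endpoints of edges misses no reachable node except possibly the source. *)
Lemma reach_touched (N : network R) phi v : reach N phi v -> v = source N \/
  exists2 f, (f < edges N)%N & v = etail N f \/ v = ehead N f.
Proof.
by case=> [|f fN _ _|f fN _ _]; [left|right; exists f => //; right|right; exists f => //; left].
Qed.

Hypothesis solves : max_flow_solver (oflow O).

(** Nodes 0 and 1 are left out because a source without edges is reachable but unmarked; decoding
    reads only label nodes, which are larger. *)
Lemma run_reach st phi (nn := nat_mem st nodesN 0) (m := nat_mem st edgesN 0)
    (N := Network nn m 0 1 (nat_mem st tailN) (nat_mem st headN) (real_mem st capR)) :
  network_ok N -> (forall f, (f < m)%N -> real_mem st flowR f = phi f) ->
  run O reach_code st (7 * for_cost m 60 2 + for_cost nn 20 2 + otime O nn.+1 (4 * m) + 100)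
    (fun st' => forall v, (v < nn)%N -> (1 < v)%N ->
       (0 < nat_mem st' markN v)%N <-> reach N phi v).
Proof.
move=> ok hphi; set F := for_cost m 60 2; set FV := for_cost nn 20 2.
set tl := nat_mem st tailN in N ok *; set hd := nat_mem st headN in N ok *.
set cp := real_mem st capR in N ok *; set fl := real_mem st flowR in hphi.
set big := 1 + (2 * m)%:R : R.
apply: (run_seqF (B1 := (5 * F + 20)%N) (B2 := (2 * F + FV + otime O nn.+1 (4 * m) + 80)%N)
  (run_residual O (m := m) (nn := nn) (tl := tl) (hd := hd) (cp := cp) (fl := fl)
    erefl erefl erefl erefl erefl erefl)); last lia.
rewrite -/big => st1 [e1 sn1] _; set L := _ ++ _ in e1.
have szL : size L = (4 * m)%N by rewrite !size_cat !size_map size_iota; lia.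
have m2 : nat_mem st1 edgesN2 0 = (4 * m)%N.
  by rewrite -szL -e1 size_edge_list.
pose N2 := Network nn.+1 (4 * m) 0 nn (nat_mem st1 tailN2) (nat_mem st1 headN2)
  (real_mem st1 capR2).
have nthL f : (f < 4 * m)%N -> (etail N2 f, ehead N2 f, ecap N2 f) = nth (0%N, 0%N, 0) L f.
  by move=> fm; rewrite -e1 nth_edge_list // m2.
have rn : residual_network N phi big N2.
  have part (A B : Type) (g : nat -> A) (s : seq A) (d : A) f : (f < m)%N ->
      nth d ([seq g f | f <- iota 0 m] ++ s) f = g f.
    by move=> fm; rewrite nth_cat size_map size_iota fm (nth_map 0%N) ?size_iota ?nth_iota.
  have skip (A : Type) (g : nat -> A) (s : seq A) (d : A) f :
      nth d ([seq g f | f <- iota 0 m] ++ s) (m + f) = nth d s f.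
    by rewrite nth_cat size_map size_iota ltnNge leq_addr addKn.
  split => //.
  - by rewrite /big; lra.
  - move=> f fm; have := nthL f ltac:(rewrite /= in fm; lia); rewrite /L part //.
    by case.
  - move=> f fm; have := nthL (m + f)%N ltac:(rewrite /= in fm; lia).
    by rewrite /L skip part // => -[].
  - move=> f fm; have := nthL (2 * m + f)%N ltac:(rewrite /= in fm; lia).
    have -> : nth (0%N, 0%N, 0) L (2 * m + f)%N =
        (tl f, hd f, if fl f < cp f then big else 0).
      by rewrite (_ : 2 * m + f = m + (m + f))%N /L ?skip ?part //; lia.
    by rewrite hphi // => -[].
  - move=> f fm; have := nthL (3 * m + f)%N ltac:(rewrite /= in fm; lia).
    have -> : nth (0%N, 0%N, 0) L (3 * m + f)%N =
        (hd f, tl f, if 0 < fl f then big else 0).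
      rewrite (_ : 3 * m + f = m + (m + (m + f)))%N /L ?skip; last lia.
      by rewrite (nth_map 0%N) ?size_iota // nth_iota.
    by rewrite hphi // => -[].
have ok2 := residual_network_ok ok rn.
have mf2 := solves ok2.
apply: (run_seqF (B1 := (otime O nn.+1 (4 * m) + 20)%N) (B2 := (2 * F + FV + 50)%N)
  (Q1 := fun st2 => forall f, (f < 4 * m)%N -> real_mem st2 flowR2 f = oflow O N2 f));
  [|move=> st2 e2 un2|lia].
  have nE : eval O st1 (NAdd (var nodesN) (NLit 1)) = nn.+1.
    by rewrite /= (sn_nodes sn1) addn1.
  have mE : eval O st1 (var edgesN2) = (4 * m)%N by [].
  have tE : eval O st1 (var nodesN) = nn by rewrite /= (sn_nodes sn1).
  apply: run_max_flow; rewrite nE mE tE /=; first lia.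
  by move=> f fm; rewrite fm.
have u2 : [/\ nat_mem st2 edgesN 0 = m, nat_mem st2 nodesN 0 = nn, nat_mem st2 tailN = tl &
    nat_mem st2 headN = hd].
  split; [have := un2 TNat edgesN isT|have := un2 TNat nodesN isT|
    have := un2 TNat tailN isT|have := un2 TNat headN isT] => /= ->;
    by rewrite ?(sn_edges sn1) ?(sn_nodes sn1) ?(sn_tail sn1) ?(sn_head sn1).
case: u2 => um un ut uh.
apply: (run_seqF (B1 := FV) (B2 := (2 * F + 10)%N)
  (Q1 := fun st3 => forall v, (v < nn)%N -> nat_mem st3 markN v = 0%N));
  [|move=> st3 e3 un3|lia].
  apply: (run_for (Inv := fun g st3 => forall v, (v < g)%N -> nat_mem st3 markN v = 0%N)) => //.
    by move=> st' un' /=; have := un' TNat nodesN isT => /= ->.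
  move=> g st' glt hg un' inv; apply: run_assign => // v.
  rewrite ltnS leq_eqVlt /= /upd /= hg; case: eqP => //= _; exact: inv.
have um3 : nat_mem st3 edgesN 0 = m by rewrite -um; have := un3 TNat edgesN isT => /= ->.
have ut3 : nat_mem st3 tailN = tl by rewrite -ut; exact: (un3 TNat tailN isT).
have uh3 : nat_mem st3 headN = hd by rewrite -uh; exact: (un3 TNat headN isT).
have uf3 : real_mem st3 flowR2 = real_mem st2 flowR2 by exact: (un3 TReal flowR2 isT).
have init v : (v < nn)%N -> (0 < nat_mem st3 markN v)%N <-> False.
  by move=> vn; rewrite e3.
apply: (run_seqF (B1 := F) (B2 := F) (run_marks O false um3 init)); last lia.
move=> st4 e4 un4; rewrite ut3 uf3 in e4.
have um4 : nat_mem st4 edgesN 0 = m by rewrite -um3; have := un4 TNat edgesN isT => /= ->.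
have uh4 : nat_mem st4 headN = hd by rewrite -uh3; exact: (un4 TNat headN isT).
have uf4 : real_mem st4 flowR2 = real_mem st2 flowR2 by rewrite -uf3; exact: (un4 TReal flowR2 isT).
apply: (run_weaken (run_marks O true um4 e4)) => // st5; rewrite uh4 uf4 => e5 v vn v1.
have tails f : (f < m)%N -> 0 < real_mem st2 flowR2 f <-> reach N phi (tl f).
  move=> fm; rewrite e2; last lia.
  have h := residual_flow ok rn mf2 (f := f) ltac:(rewrite /=; lia).
  by have [et _ _] := rn_tail_out rn fm; rewrite et in h.
have heads f : (f < m)%N -> 0 < real_mem st2 flowR2 (m + f) <-> reach N phi (hd f).
  move=> fm; rewrite e2; last lia.
  have h := residual_flow ok rn mf2 (f := m + f) ltac:(rewrite /=; lia).
  by have [et _ _] := rn_head_out rn fm; rewrite et in h.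
split.
  move/(e5 v vn) => [[//|[f fm [h <-]]]|[f fm [h <-]]]; first exact/(tails f fm).
  exact/(heads f fm).
move=> rv; apply/(e5 v vn); case: (reach_touched rv) => [v0|[f fm [vt|vh]]].
- by move: v1; rewrite v0.
- by left; right; exists f => //; split=> //; apply/(tails f fm); rewrite -[tl f]vt.
- by right; exists f => //; split=> //; apply/(heads f fm); rewrite -[hd f]vh.
Qed.

End ReachSpec.

Section Decode.
Variables (R : realType) (T : tree) (nb : T -> seq T) (k : nat).
Hypothesis nbP : adjacency_lists nb.
Hypothesis degk : forall v, (size (nb v) <= k)%N.
Variables (n : nat) (P : sep2 R T n) (solve : network R -> nat -> R)
  (MF : nat -> nat -> nat) (e : bool) (x : nat -> T).
Local Notation O := (sep2_oracles nb P solve MF).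
Local Notation node := (node nb e x).
Local Notation deg := (deg nb e x).
Local Notation lab := (lab nb x).
Local Notation decode := (decode nb e x).
Implicit Types st : state R T.

Lemma lab_neq i a : a \in labels nb e x i -> lab i a <> x i.
Proof. by move=> /(lab_adj nbP) h eq; move: h; rewrite eq adj_irr. Qed.

(** The point can be overwritten in place, since a coordinate is decoded from its own old entry and
    from arrays that stay fixed. The flag is exact because a neighbor always differs from the
    vertex. *)
Lemma run_decode st (X := fun v => (0 < nat_mem st markN v)%N) : ready nb P e x st ->
  nat_mem st 0 0 = n -> nat_mem st changedN 0 = 0%N ->
  run O decode_code st (for_cost n (for_cost k 50 3 + 90) 2) (fun st' =>
    (forall i : 'I_n, vtx_mem st' xV i = decode X i) /\
    (nat_mem st' changedN 0 = 0%N <-> forall i : 'I_n, decode X i = x i)).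
Proof.
move=> rd hn h0.
pose Inv f st' := (forall i, vtx_mem st' xV i = if (i < f)%N then decode X i else x i) /\
  (nat_mem st' changedN 0 = 0%N <-> forall i, (i < f)%N -> decode X i = x i).
apply: (run_weaken (B := for_cost n (for_cost k 50 3 + 90) 2) (Q := Inv n)) => //; last first.
  move=> st' [h1 h2]; split; first by move=> i; rewrite h1 ltn_ord.
  by rewrite h2; split=> [h i|h i ilt]; [apply: h|apply: (h (Ordinal ilt))].
apply: run_for => //.
- by move=> st' un /=; have := un TNat 0%N isT => /= ->.
- by split=> [i|]; rewrite /= ?(ready_x rd) // /upd /= h0.
move=> f st' flt hf un [inv1 inv2].
have fdeg : nat_mem st' degN f = deg f.
  by have := un TNat degN isT => /= ->; apply: (ready_deg rd (Ordinal flt)).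
have foff : nat_mem st' offN f = node f 0.
  by have := un TNat offN isT => /= ->; apply: (ready_off rd (Ordinal flt)).
have mark : nat_mem st' markN = nat_mem st markN by exact: (un TNat markN isT).
apply: (run_seqF (B1 := 10) (B2 := (for_cost k 50 3 + 80)%N)
  (Q1 := fun st1 => nat_mem st1 countN 0 = 0%N)); [|move=> st1 c1 un1|lia].
  by apply: run_assign.
pose s a := [seq b <- iota 0 a | X (node f b)].
apply: (run_seqF (B1 := for_cost k 50 3) (B2 := 80)
  (Q1 := fun st2 => nat_mem st2 countN 0 = size (s (deg f)) /\
     (forall b, s (deg f) = [:: b] -> nat_mem st2 lastN 0 = b))); last by lia.
  apply: (run_weaken (B := for_cost (deg f) 50 3)
    (Q := fun st2 => nat_mem st2 countN 0 = size (s (deg f)) /\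
     (s (deg f) <> [::] -> nat_mem st2 lastN 0 = last 0%N (s (deg f))))); first last.
  - by move=> st2 [h1 h2]; split=> // b eb; rewrite h2 eb.
  - by rewrite /for_cost; have := deg_le e x degk f; nia.
  apply: (run_for (Inv := fun a st2 => nat_mem st2 countN 0 = size (s a) /\
     (s a <> [::] -> nat_mem st2 lastN 0 = last 0%N (s a)))) => //.
    move=> st2 un2 /=; have := un2 TNat degN isT => /= ->.
    have := un2 TNat outer isT => /= ->; have := un1 TNat degN isT => /= ->.
    by have := un1 TNat outer isT => /= ->; rewrite hf fdeg.
  move=> a st2 alt ha un2 [i1 i2].
  have test : eval_test O st2 (NLt (NLit 0)
      (Get TNat markN (NAdd (Get TNat offN (var outer)) (var inner)))) = X (node f a).
    rewrite /= ha; have := un2 TNat markN isT => /= ->; have := un2 TNat offN isT => /= ->.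
    have := un2 TNat outer isT => /= ->; have := un1 TNat markN isT => /= ->.
    have := un1 TNat offN isT => /= ->; have := un1 TNat outer isT => /= ->.
    by rewrite hf foff mark /X /node addn0.
  apply: (run_if (B' := 25)); last by [].
  have sS : s a.+1 = s a ++ (if X (node f a) then [:: a] else [::]).
    by rewrite /s -[a.+1]addn1 iotaD filter_cat /=; case: (X _).
  rewrite test sS; case: ifP => Xa.
    apply: run_assign_seq => //; apply: run_assign => //; split=> [|_].
      by rewrite /= /upd /= i1 size_cat.
    by rewrite /= /upd /= ha last_cat.
  by apply: run_skip; rewrite cats0; split.
move=> st2 [c2 l2] un2.
have hf2 : nat_mem st2 outer 0 = f.
  by have := un2 TNat outer isT => /= ->; have := un1 TNat outer isT => /= ->.
have x2 : vtx_mem st2 xV = vtx_mem st' xV.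
  exact: (etrans (un2 TVtx xV isT) (un1 TVtx xV isT)).
have ch2 : nat_mem st2 changedN = nat_mem st' changedN.
  exact: (etrans (un2 TNat changedN isT) (un1 TNat changedN isT)).
have xf : vtx_mem st' xV f = x f by rewrite inv1 ltnn.
have sE : decode X f = if s (deg f) is [:: b] then lab f b else x f by [].
have same : decode X f = x f -> run O Skip st2 1 (fun st'' =>
    Inv f.+1 (set_cell (s := TNat) st'' outer 0%N f.+1)).
  move=> df; apply: run_skip; split=> [i|].
    by rewrite /= x2 inv1 ltnS; case: ltngtP => // ->; rewrite df.
  rewrite /= /upd /= ch2 inv2; split=> h i; last by move=> ilt; apply: h; apply: ltnW.
  by rewrite ltnS leq_eqVlt => /orP[/eqP ->|/h].
apply: (run_if (B' := 60)); last by [].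
rewrite [eval_test _ _ _]/= c2.
case E: (s (deg f)) sE l2 c2 => [|b [|b' t]] sE l2 c2.
- by apply: (run_weaken (same sE)).
- apply: (run_if (B' := 40)); last by [].
  have -> : eval_test O st2 (NLt (var countN) (NLit 2)) = true by rewrite /= c2.
  apply: run_assign_seq => //; apply: run_assign => //.
  have bl : b \in labels nb e x f.
    have : b \in s (deg f) by rewrite E mem_head.
    by rewrite mem_filter => /andP[].
  split=> [i|]; rewrite /= /upd /=.
    rewrite hf2 (l2 b erefl) x2 xf ltnS inv1; case: ltngtP => // ->.
    by rewrite sE.
  split=> // h; have := h f (ltnSn f); rewrite sE => /(lab_neq bl) //.
- apply: (run_if (B' := 40)); last by [].
  have -> : eval_test O st2 (NLt (var countN) (NLit 2)) = false by rewrite /= c2.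
  by apply: (run_weaken (same sE)).
Qed.

End Decode.

(** Without terms the relaxation is zero, and in a tree with a single vertex there is only one
    point, so the input is returned. The two guards make [k], [n] and the number of terms positive,
    as the scaling of [MF] requires. The first test also protects the second one, which reads a
    coordinate, from [n = 0]. *)
Definition algorithm : cmd :=
  If (NLt (NLit 0) (NAdd (Get TNat 0 (NLit 1)) (NAdd (Get TNat 0 (NLit 2)) (Get TNat 0 (NLit 3)))))
    (If (NLt (NLit 0) (Deg (vvar xV)))
      (Seq (set_var phaseN (NLit 1)) (Seq (set_var changedN (NLit 1))
        (While (NLt (NLit 0) (var changedN)) (Seq (set_var changedN (NLit 0)) phase_code))))
      Skip)
    Skip.

(** * One phase, the descent loop and the total running time *)

Section Algorithm.
Variables (R : realType) (T : tree) (nb : T -> seq T) (k : nat).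
Hypothesis nbP : adjacency_lists nb.
Hypothesis degk : forall v, (size (nb v) <= k)%N.
Variables (n : nat) (P : sep2 R T n).
Hypothesis Pc : sep2_convex P.
Variables (solve : network R -> nat -> R) (MF : nat -> nat -> nat).
Hypothesis solves : max_flow_solver solve.
Hypothesis MF_mono : forall a b a' b', (a <= a')%N -> (b <= b')%N -> (MF a b <= MF a' b')%N.
Local Notation O := (sep2_oracles nb P solve MF).
Local Notation F := (sep2_relax P).
Local Notation m := (nterms P).
Local Notation to_fun := (@to_fun T n).
Implicit Types st : state R T.

Record instance st (e : bool) (x : nat -> T) : Prop := {
  is_x : vtx_mem st xV = x;
  is_z : forall i : 'I_n, vtx_mem st zV i = sz P i;
  is_w : forall i : 'I_n, vtx_mem st wV i = sw P i;
  is_terms : terms P st;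
  is_phase : nat_mem st phaseN 0 = e }.

(** The first flow network has at most [2 + n * k] nodes and [4 * (k * m)] edges; the residual
    network adds one node and has four times as many edges. *)
Definition phase_time : nat :=
  (3000 * (k * n + k * m + n + m + 1) + MF (2 + n * k) (4 * (k * m))
   + MF (3 + n * k) (16 * (k * m)))%N.

Lemma edges_time : (0 < k)%N -> (10 + for_cost #|idxF P| (for_cost k 100 2 + 50) 2
     + for_cost #|idxG P| (4 * for_cost k 100 2 + 320) 2
     + for_cost #|idxH P| (4 * for_cost k 100 2 + 320) 2 <= 900 * (k * m + m) + 50)%N.
Proof. by move=> k0; rewrite /for_cost /nterms; nia. Qed.

Lemma run_phase st e x : (0 < k)%N -> instance st e x -> nat_mem st changedN 0 = 0%N ->
  run O phase_code st phase_time (fun st' => exists y, [/\ instance st' (~~ e) y,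
    nbhd e (to_fun x) (to_fun y),
    forall y', nbhd e (to_fun x) y' -> F (to_fun y) <= F y',
    F (to_fun x) <= F (to_fun y) -> to_fun y = to_fun x &
    nat_mem st' changedN 0 = 0%N <-> to_fun y = to_fun x]).
Proof.
move=> k0 [hx hz hw ht he] hc.
have szE := size_net_edges e x P degk; have nnE := nnodes_le e x n degk.
set es := net_edges nb e x P in szE; set nn := nnodes nb e x n in nnE.
set tS := (for_cost n 60 2 + 10)%N; set tD := for_cost n (for_cost k 50 3 + 90) 2.
have et := edges_time k0; set tE := (_ + _ + _ + _)%N in et.
pose tR := (7 * for_cost (size es) 60 2 + for_cost nn 20 2 + MF nn.+1 (4 * size es) + 100)%N.
pose tM := (MF nn (size es) + 20)%N.
apply: (run_weaken (B := (tS + (tE + (tM + (tR + (tD + 10)))))%N) (Q := fun st' => exists y,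
   [/\ instance st' (~~ e) y,
    nbhd e (to_fun x) (to_fun y),
    forall y', nbhd e (to_fun x) y' -> F (to_fun y) <= F y',
    F (to_fun x) <= F (to_fun y) -> to_fun y = to_fun x &
    nat_mem st' changedN 0 = 0%N <-> to_fun y = to_fun x])) => //; last first.
  have m1 : (MF nn (size es) <= MF (2 + n * k) (4 * (k * m)))%N by apply: MF_mono.
  have m2 : (MF nn.+1 (4 * size es) <= MF (3 + n * k) (16 * (k * m)))%N.
    by apply: MF_mono; lia.
  have d1 : (tD <= 200 * (k * n + n) + 20)%N by rewrite /tD /for_cost; nia.
  move: et m1 m2 d1; rewrite /phase_time /tS /tR /tM /for_cost; lia.
apply: (run_seqF (B1 := tS) (B2 := (tE + (tM + (tR + (tD + 10))))%N)
  (run_setup nb solve MF hx hz hw (tm_n ht) he)) => //.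
move=> st1 [rd1 n1] un1; have tm1 : terms P st1 by apply: terms_unchanged un1 ht.
have hc1 : nat_mem st1 changedN 0 = 0%N by have := un1 TNat changedN isT => /= ->.
have hp1 : nat_mem st1 phaseN 0 = e by have := un1 TNat phaseN isT => /= ->.
apply: (run_seqF (B1 := tE) (B2 := (tM + (tR + (tD + 10)))%N)
  (run_edges degk solve MF rd1 tm1)) => //.
move=> st2 e2 un2; rewrite -/es in e2.
have rd2 : ready nb P e x st2 by apply: ready_unchanged un2 rd1.
have tm2 : terms P st2 by apply: terms_unchanged un2 tm1.
have hc2 : nat_mem st2 changedN 0 = 0%N by have := un2 TNat changedN isT => /= ->.
have hp2 : nat_mem st2 phaseN 0 = e by have := un2 TNat phaseN isT => /= ->.
have n2 : nat_mem st2 nodesN 0 = nn by have := un2 TNat nodesN isT => /= ->; exact: n1.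
have m2 : nat_mem st2 edgesN 0 = size es by rewrite -e2 size_edge_list.
pose N := Network (nat_mem st2 nodesN 0) (nat_mem st2 edgesN 0) 0 1 (nat_mem st2 tailN)
  (nat_mem st2 headN) (real_mem st2 capR).
have Nedge f : (f < size es)%N ->
    (etail N f, ehead N f, ecap N f) = nth (0%N, 0%N, 0) es f.
  by move=> fm; rewrite -e2 nth_edge_list // m2.
have okN : network_ok N by apply: (phase_network_ok (nb := nb) Pc (e := e) (x := x)).
have mfN := solves okN.
apply: (run_seqF (B1 := tM) (B2 := (tR + (tD + 10))%N)
  (Q1 := fun st3 => forall f, (f < size es)%N -> real_mem st3 flowR f = solve N f)) => //.
  apply: run_max_flow.
    by rewrite /= n2 m2 /tM; lia.
  move=> f fm /=; have fm' : (f < nat_mem st2 edgesN 0)%N by rewrite m2.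
  by rewrite fm'.
move=> st3 e3 un3.
have rd3 : ready nb P e x st3 by apply: ready_unchanged un3 rd2.
have tm3 : terms P st3 by apply: terms_unchanged un3 tm2.
have hc3 : nat_mem st3 changedN 0 = 0%N by have := un3 TNat changedN isT => /= ->.
have hp3 : nat_mem st3 phaseN 0 = e by have := un3 TNat phaseN isT => /= ->.
have n3 : nat_mem st3 nodesN = nat_mem st2 nodesN by exact: (un3 TNat nodesN isT).
have m3 : nat_mem st3 edgesN = nat_mem st2 edgesN by exact: (un3 TNat edgesN isT).
have NE : Network (nat_mem st3 nodesN 0) (nat_mem st3 edgesN 0) 0 1 (nat_mem st3 tailN)
    (nat_mem st3 headN) (real_mem st3 capR) = N.
  rewrite /N n3 m3; congr (Network _ _ _ _ _ _ _).
  - exact: (un3 TNat tailN isT).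
  - exact: (un3 TNat headN isT).
  - exact: (un3 TReal capR isT).
have reach3 := @run_reach R T O solves st3 (solve N).
cbv zeta in reach3; rewrite NE in reach3; have {}reach3 := reach3 okN.
rewrite n3 m3 n2 m2 in reach3; have {}reach3 := reach3 e3.
apply: (run_seqF (B1 := tR) (B2 := (tD + 10)%N) reach3) => //.
move=> st4 e4 un4.
have rd4 : ready nb P e x st4 by apply: ready_unchanged un4 rd3.
have tm4 : terms P st4 by apply: terms_unchanged un4 tm3.
have hc4 : nat_mem st4 changedN 0 = 0%N by have := un4 TNat changedN isT => /= ->.
have hp4 : nat_mem st4 phaseN 0 = e by have := un4 TNat phaseN isT => /= ->.
apply: (run_seqF (B1 := tD) (B2 := 10)
  (run_decode nbP degk solve MF rd4 (tm_n tm4) hc4)) => //.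
move=> st5 [e5 c5] un5; set X : pred nat := fun v => _ in e5 c5.
have yE : to_fun (vtx_mem st5 xV) = to_fun (decode nb e x X).
  by apply: funext => i; apply: e5.
have XP v : (1 < v)%N -> (v < nn)%N -> X v <-> reach N (solve N) v by move=> v1 vn; apply: e4.
apply: run_assign => //; exists (vtx_mem st5 xV); rewrite yE; split.
- split=> //=.
  + by move=> i; have := un5 TVtx zV isT => /= ->; apply: ready_z rd4 i.
  + by move=> i; have := un5 TVtx wV isT => /= ->; apply: ready_w rd4 i.
  + have tm5 : terms P st5 by apply: terms_unchanged un5 tm4.
    by case: tm5.
  + rewrite /upd /=; have := un5 TNat phaseN isT => /= ->; rewrite hp4; by case: (e).
- exact: decode_nbhd.
- by apply: (phase_minimizes nbP Pc _ _ _ _ Nedge mfN XP); rewrite ?n2 ?m2.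
- by apply: (phase_strict nbP Pc _ _ _ _ Nedge mfN XP); rewrite ?n2 ?m2.
- rewrite /= /upd /= c5; split=> [h|h i]; first by apply: funext => i; apply: h.
  exact: (congr1 (fun y => y i) h).
Qed.

Lemma run_while_stop b c st B (Q : state R T -> Prop) : ~~ eval_test O st b ->
  (test_cost b < B)%N -> Q st -> run O (While b c) st B Q.
Proof. by move=> h1 h2 h3; do 2 eexists; split; [exact: ExecWhileStop|exact: h2|]. Qed.

Lemma run_while_loop B1 B2 b c st B (Q : state R T -> Prop) : eval_test O st b ->
  run O c st B1 (fun st1 => run O (While b c) st1 B2 Q) ->
  (test_cost b + B1 + B2 < B)%N -> run O (While b c) st B Q.
Proof.
move=> hb [st1 [t1 [h1 l1 [st2 [t2 [h2 l2 q]]]]]] le.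
exists st2, (test_cost b + t1 + t2).+1; split=> //; first exact: ExecWhileLoop h1 h2.
by lia.
Qed.

(** A coordinate that has moved has changed its color and cannot move again. So a minimizer over the
    moves of [x] also minimizes over its own moves of the same color, which is the invariant of the
    loop. *)
Lemma nbhd_nbhd e (x y y' : 'I_n -> T) : nbhd e x y -> nbhd e y y' -> nbhd e x y'.
Proof.
move=> xy yy' i; case: (yy' i) => [->|[by' ad']]; first exact: xy.
case: (xy i) => [yx|[bx ad]]; first by right; rewrite -yx.
by have := black_proper ad; rewrite bx by' eqxx.
Qed.

Lemma run_loop D : (0 < k)%N -> forall e x z st, instance st e x ->
  (0 < nat_mem st changedN 0)%N ->
  (forall y, nbhd (~~ e) (to_fun x) y -> F (to_fun x) <= F y) ->
  opt F z -> (forall i, dist (to_fun x i) (z i) <= D)%N ->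
  run O (While (NLt (NLit 0) (var changedN)) (Seq (set_var changedN (NLit 0)) phase_code))
    st (D.+1 * (phase_time + 20) + 10) (fun st' => opt F (@output R T n st')).
Proof.
move=> k0; elim: D => [|D IH] e x z st is_st hc xopt zo xz.
  apply: (run_while_loop (B1 := (phase_time + 5)%N) (B2 := 10)) => //; last by rewrite /=; lia.
  apply: (run_seq (B1 := 5) (B2 := phase_time)); last by lia.
  apply: run_assign => //; set st1 := set_cell _ _ _ _.
  have is1 : instance st1 e x by case: is_st => ? ? ? [? ? ? ? ? ? ?] ?; split.
  apply: (run_weaken (run_phase k0 is1 erefl)) => // st2 [y [is2 xy ymin strict chg]].
  have xz' : to_fun x = z.
    by apply: funext => i; apply: dist_eq0; have := xz i; rewrite leqn0 => /eqP.
  (* At distance 0 the point is a minimizer, and one more phase is spent on noticing that nothing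
     changes. *)
  have yx : to_fun y = to_fun x by apply: strict; rewrite xz'; apply: zo.
  apply: run_while_stop; first by rewrite /= chg.2.
    by [].
  have -> : @output R T n st2 = z by rewrite -xz' -yx -(is_x is2).
  exact: zo.
apply: (run_while_loop (B1 := (phase_time + 5)%N) (B2 := (D.+1 * (phase_time + 20) + 10)%N)) => //;
  last by rewrite /=; have := mulSn D.+1 (phase_time + 20); lia.
apply: (run_seq (B1 := 5) (B2 := phase_time)); last by lia.
apply: run_assign => //; set st1 := set_cell _ _ _ _.
have is1 : instance st1 e x by case: is_st => ? ? ? [? ? ? ? ? ? ?] ?; split.
apply: (run_weaken (run_phase k0 is1 erefl)) => // st2 [y [is2 xy ymin strict chg]].
have [ch|ch] := posnP (nat_mem st2 changedN 0).
  have yx := chg.1 ch; apply: run_while_stop; [by rewrite /= ch|by rewrite /=; lia|].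
  have -> : @output R T n st2 = to_fun x by rewrite -yx -(is_x is2).
  (* The loop may stop early: [x] is optimal for the color of this phase because it did not move,
     and for the other color by the invariant. *)
  apply: (local_opt Pc (z := z)) => // e' y' xy'.
  have [ee'|ee'] := eqVneq e' e; first by rewrite -yx; apply: ymin; rewrite -ee'.
  by apply: xopt; have -> : ~~ e = e' by move: ee'; case: (e); case: (e').
have [z' zo' yz'] := descent Pc xopt xy ymin zo xz.
apply: (IH (~~ e) y z') => // y' yy'; apply: ymin.
by rewrite negbK in yy'; apply: nbhd_nbhd yy'.
Qed.

Lemma run_algorithm st (x : 'I_n -> T) D : sep2_input P x st -> in_Bn x ->
  max_degree nb k -> dist_to (opt F) x D ->
  run O algorithm st 50 (fun st' => opt F (@output R T n st')) \/
  [/\ (0 < k)%N, (0 < n)%N, (0 < m)%N &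
    run O algorithm st (D.+1 * (phase_time + 20) + 70)
      (fun st' => opt F (@output R T n st'))].
Proof.
move=> [i1 i2 i3 i4 i5 i6 i7 i8 i9 i10] xB [_ [v0 dv0]] [[z [zo zx]] _].
have ox : @output R T n st = x by apply: funext => i; apply: i8.
have t1 : eval_test O st (NLt (NLit 0) (NAdd (Get TNat 0 (NLit 1))
    (NAdd (Get TNat 0 (NLit 2)) (Get TNat 0 (NLit 3))))) = (0 < m)%N.
  by rewrite /= i2 i3 i4 /nterms addnA.
have [m0|mpos] := posnP m.
  left; apply: (run_if (B' := 5)); last by []; rewrite t1 m0.
  apply: run_skip; rewrite ox => y.
  have emp (I : finType) (A : {set I}) : #|A| = 0%N -> A = finset.set0.
    by move=> /eqP; rewrite cards_eq0 => /eqP.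
  have [a1 [a2 a3]] : #|idxF P| = 0%N /\ #|idxG P| = 0%N /\ #|idxH P| = 0%N.
    by move: m0; rewrite /nterms; lia.
  by rewrite /sep2_relax /sep2_sum (emp _ _ a1) (emp _ _ a2) (emp _ _ a3) !big_set0.
have npos : (0 < n)%N.
  have hF : (#|idxF P| <= n)%N by have := max_card (mem (idxF P)); rewrite card_ord.
  have hG : (#|idxG P| <= n * n)%N.
    by have := max_card (mem (idxG P)); rewrite card_prod card_ord.
  have hH : (#|idxH P| <= n * n)%N.
    by have := max_card (mem (idxH P)); rewrite card_prod card_ord.
  move: mpos hF hG hH; rewrite /nterms; nia.
set r := vtx_mem st xV 0.
have t2 : eval_test O st (NLt (NLit 0) (Deg (vvar xV))) = (0 < size (nb r))%N by [].
have [r0|rpos] := posnP (size (nb r)).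
  left; apply: (run_if (B' := 20)); last by []; rewrite t1 mpos.
  apply: (run_if (B' := 5)); last by []; rewrite t2 r0.
  apply: run_skip; rewrite ox => y; have -> // : y = x; apply: funext => i.
  have all_r u : u = r.
    have [[|a p] [rp <-]] := tree_connected r u => //.
    by move: rp => /= /andP[ra _]; have [_ h] := nbP r; rewrite -h (size0nil r0) in ra.
  by rewrite (all_r (y i)) (all_r (x i)).
have k0 : (0 < k)%N by apply: leq_trans rpos (degk r).
right; split=> //; apply: (run_if (B' := (D.+1 * (phase_time + 20) + 55)%N));
  last by rewrite /=; lia.
rewrite t1 mpos; apply: (run_if (B' := (D.+1 * (phase_time + 20) + 45)%N));
  last by rewrite /=; lia.
rewrite t2 rpos; apply: run_assign_seq; first by rewrite /=; lia.
apply: run_assign_seq; first by rewrite /=; lia.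
set st1 := set_cell _ _ _ _.
have is1 : instance st1 true (vtx_mem st xV) by split.
have tx : to_fun (vtx_mem st xV) = x by apply: funext => i; apply: i8.
have c1 : (0 < nat_mem st1 changedN 0)%N by [].
apply: (run_weaken (run_loop (D := D) (z := z) k0 is1 c1 _ zo _)) => //.
(* All coordinates of the input are black, so it has no white moves and is trivially optimal for
   them. This is why the first phase moves the black coordinates. *)
- rewrite tx => y xy; have -> // : y = x; apply: funext => i.
  by case: (xy i) => // -[]; rewrite xB.
- by move=> i; rewrite tx distC -zx /dist_max;
    apply: (leq_bigmax (F := fun i => dist (z i) (x i))).
- by rewrite /=; lia.
Qed.

End Algorithm.

Lemma phase_time_le MF : flow_time MF -> exists C, forall k n m : nat,
  (0 < k)%N -> (0 < n)%N -> (0 < m)%N ->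
  (3000 * (k * n + k * m + n + m + 1) + MF (2 + n * k) (4 * (k * m))
   + MF (3 + n * k) (16 * (k * m)) <= C * MF (k * n) (k * m))%N.
Proof.
move=> [mono [c lin] scale]; have [c' hc'] := scale 16%N.
(* The linear part is at most [2 * (k * n + k * m + 1)], which [MF_linear] bounds by [2 * c * MF].
   Both flow calls fit into a network scaled by 16, because [k * n] is positive and absorbs the
   additive 2 and 3. *)
exists (3000 * (2 * c) + 2 * c')%N => k n m k0 n0 m0.
set a := (k * n)%N; set b := (k * m)%N.
have a0 : (0 < a)%N by rewrite muln_gt0 k0.
have b0 : (0 < b)%N by rewrite muln_gt0 k0.
have na : (n <= a)%N by apply: leq_pmull.
have mb : (m <= b)%N by apply: leq_pmull.
have h := lin a b; have s := hc' a b a0 b0.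
have h1 : (MF (2 + n * k) (4 * b) <= MF (16 * a) (16 * b))%N.
  by apply: mono; rewrite ?(mulnC n) -/a; lia.
have h2 : (MF (3 + n * k) (16 * b) <= MF (16 * a) (16 * b))%N.
  by apply: mono; rewrite ?(mulnC n) -/a; lia.
rewrite mulnDl -!mulnA; set t := (c * MF a b)%N in h *; set t' := (c' * MF a b)%N in s *; lia.
Qed.

Theorem theorem2p16 (R : realType) :
  (forall MF : nat -> nat -> nat, flow_time MF ->
     exists (alg : cmd) (C : nat),
     forall (T : tree) (nb : T -> seq T) (k : nat),
     adjacency_lists nb -> max_degree nb k ->
     forall (n : nat) (P : sep2 R T n), sep2_convex P ->
     forall (x : 'I_n -> T) (D : nat), in_Bn x ->
     dist_to (opt (sep2_relax P)) x D ->
     forall solve : network R -> nat -> R, max_flow_solver solve ->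
     forall st : state R T, sep2_input P x st ->
     exists (st' : state R T) (t : nat),
       [/\ exec (sep2_oracles nb P solve MF) alg st st' t,
           opt (sep2_relax P) (output st')
         & (t <= C * (D.+1 * MF (k * n) (k * nterms P)))%N])
  /\
  (forall (T : tree) (n : nat) (P : multifac R T n), multifac_convex P ->
     forall xs : 'I_n -> T, opt (multifac_relax P) xs ->
     forall y : T, black y ->
     approx2 (multifac_fun P) (round_to y xs)).
Proof.
split; last by move=> T n P Pc xs xopt y yB; apply: rounding_approx2.
move=> MF MFt; have [C hC] := phase_time_le MFt; have [mono [c lin] _] := MFt.
(* The overhead of 20 per phase and the fixed 70 are together at most 90 for each of the [D.+1]
   phases, and [c * MF] is at least 1. The same term covers the early exits. *)
exists algorithm, (C + 90 * c)%N => T nb k nbP kmax n P Pc x D xB dD solve solves st inp.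
set a := (k * n)%N; set b := (k * nterms P)%N.
have lb : (0 < c * MF a b)%N by have := lin a b; lia.
have [degk _] := kmax.
have [[st' [t [ex tB op]]]|[k0 n0 m0 [st' [t [ex tB op]]]]] :=
    run_algorithm nbP degk Pc solves mono inp xB kmax dD.
  exists st', t; split=> //; apply: leq_trans tB _.
  apply: (@leq_trans (90 * c * MF a b)); first by rewrite -mulnA; lia.
  by apply: leq_mul; [exact: leq_addl|exact: leq_pmull].
exists st', t; split=> //; apply: leq_trans tB _.
have := hC k n (nterms P) k0 n0 m0; rewrite -/(phase_time k P MF) -/a -/b => h.
move: (phase_time k P MF) h => u h; apply: (@leq_trans (D.+1 * (u + 90))).
  by rewrite -[90%N]/(20 + 70)%N addnA [leqRHS]mulnDr leq_add2l leq_pmull.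
rewrite mulnCA leq_mul2l /= mulnDl; apply: leq_add; first exact: h.
by rewrite -mulnA -[leqLHS]muln1 leq_mul2l lb.
Qed.
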